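(* Let $G$ be a locally compact, compactly generated group and let $(K_n)_{n=1}^\infty$ be a sequence of compactly supported, centered probability densities on $G$. Define $T_nf=K_n*f$, $f\in L^p$. Suppose there exist $\varepsilon>0$ and two relatively compact, symmetric generating neighborhoods $W,W'$ of the identity $e$ such that $W\subseteq W'$, $W$ is open, and $$\varepsilon\chi_W\le K_n\le\varepsilon^{-1}\chi_{W'}\quad\text{for all } n\in\mathbb{N}.$$ Then there exist $\omega,c,b>0$ such that $$\|e^{\lambda\psi}T_{m+n}\cdots T_{m+1}e^{-\lambda\psi}\|_{2\to2}\le e^{\omega\lambda^2n}$$ for all $m\in\mathbb{N}_0$, $n\in\mathbb{N}$, $\lambda\in\mathbb{R}$, $\psi\in\mathcal{E}$, and $$(K_{m+n}*\cdots*K_{m+1})(g)\le c\,\Delta(g)^{-1/2}e^{-b\rho(g)^2/n}$$ for all $m\in\mathbb{N}_0$, $n\in\mathbb{N}$ and $g\in G$.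
   Context: $\mathbb{N}=\{1,2,3,\dots\}$, $\mathbb{N}_0=\{0,1,2,\dots\}$; $dg$ is a left Haar measure on $G$ and $\Delta:G\to(0,\infty)$ is the modular function, normalized so that $d(g^{-1})=\Delta(g^{-1})dg$ is a right Haar measure; $L^p=L^p(G;dg)$ (complex-valued); $\|\cdot\|_{p\to q}$ is the norm of bounded operators $L^p\to L^q$; $\chi_W$ is the characteristic function of $W$. Convolution: $(f_1*f_2)(g)=\int_G dh\,f_1(h)f_2(h^{-1}g)$. A probability density on $G$ is a Borel measurable $K:G\to[0,\infty)$ with $\int_G dg\,K(g)=1$. Distance: fix a relatively compact, open, symmetric ($U=U^{-1}$) neighborhood $U$ of $e$ which generates $G$, and set $\rho(g)=\inf\{n\in\mathbb{N}: g\in U^n\}$, where $U^n=\{g_1\cdots g_n: g_i\in U\}$. $(L(g)f)(h)=f(g^{-1}h)$, $\partial_g=L(g)-I$. $\mathcal{E}$ is the class of all locally bounded Borel measurable $\psi:G\to\mathbb{R}$ (not assumed bounded) with $\sup_{u\in U}\|\partial_u\psi\|_\infty\le1$. For a density $P$ and $Sf=P*f$, $e^{\lambda\psi}Se^{-\lambda\psi}$ is the operator $f\mapsto e^{\lambda\psi}S(e^{-\lambda\psi}f)$, i.e. $g\mapsto\int_G dh\,P(h)e^{\lambda(\psi(g)-\psi(h^{-1}g))}f(h^{-1}g)$. Centered: let $G_0=\overline{[G,G]}$ be the closure of the commutator subgroup, $\pi_0:G\to G/G_0$ the canonical homomorphism. $G/G_0$ is a compactly generated locally compact abelian group, so $G/G_0\cong\mathbb{R}^q\times\mathbb{Z}^r\times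 M$ with integers $q,r\ge0$ and $M$ a compact abelian group. Put $G_1=\pi_0^{-1}(\{0\}\times M)$, and let $\pi_1:G\to G/G_1\cong\mathbb{R}^q\times\mathbb{Z}^r$ have components $\pi_1^{(i)}$, $i\in\{1,\dots,q+r\}$ (real-valued for $i\le q$, integer-valued for $i>q$). A density $K$ is centered if $\int_G dg\,K(g)\pi_1^{(i)}(g)=0$ for all $i\in\{1,\dots,q+r\}$. *)

(* Defs.v *)
From HB Require Import structures.
From mathcomp Require Import all_boot all_order all_algebra.
From mathcomp Require Import all_classical all_reals all_analysis.
From mathcomp Require Import complex.

Set Implicit Arguments.
Unset Strict Implicit.
Unset Printing Implicit Defensive.
Import Order.TTheory GRing.Theory Num.Theory.
Import numFieldNormedType.Exports.

Local Open Scope classical_set_scope.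
Local Open Scope ring_scope.

(** The [Pointed] structure is what MathComp-Analysis asks of the carrier of a measurable space; the point
    plays no role. *)
HB.mixin Record isTopologicalGroup G of PointedTopological G & Group G := {
  mulg_continuous : continuous (fun x : G * G => (x.1 * x.2)%g) ;
  invg_continuous : continuous (fun x : G => x^-1%g)
}.

#[short(type="topGroupType")]
HB.structure Definition TopologicalGroup :=
  {G of PointedTopological G & Group G & isTopologicalGroup G}.

(** [int] carries the discrete topology, as [nat] does in the library. *)
HB.instance Definition _ := hasNbhs.Build int principal_filter.
HB.instance Definition _ := Discrete_ofNbhs.Build int erefl.

Section Subgroups.
Context {G : topGroupType}.
Implicit Types (A H : set G).

Definition is_subgroup H := H 1%g /\ forall x y, H x -> H y -> H (x / y)%g.

Definition generated A : set G := smallest is_subgroup A.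

Definition generates A := generated A = [set: G].

Definition compactly_generated :=
  exists2 C : set G, compact C & generates C.

Definition symmetric_set A := [set x^-1%g | x in A] = A.

Definition generating_nbhd A :=
  [/\ precompact A, nbhs (1%g : G) A, symmetric_set A & generates A].

Fixpoint setpow A (n : nat) : set G :=
  if n is n'.+1 then [set (x.1 * x.2)%g | x in A `*` setpow A n'] else [set 1%g].

End Subgroups.
Arguments compactly_generated : clear implicits.

Section Abelianization.
Variable G : topGroupType.

Definition commutator_subgroup : set G :=
  generated [set z | exists x y : G, z = [~ x, y]%g].

Definition G0 : set G := closure commutator_subgroup.

Lemma generated_subgroup (A : set G) : is_subgroup (generated A).
Proof.
split=> [H [[H1 _] _]//|x y Ax Ay H HA].
by have [[_ HV] _] := HA; apply: HV; [exact: Ax|exact: Ay].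
Qed.

Lemma closure_subgroup (H : set G) : is_subgroup H -> is_subgroup (closure H).
Proof.
move=> [H1 HV]; split; first exact: subset_closure.
move=> x y Hx Hy B; set f := fun z : G * G => (z.1 / z.2)%g.
have fc : f @ nbhs (x, y) --> nbhs (f (x, y)).
  rewrite /f; apply: (@continuous_comp _ _ _
    (fun z : G * G => (z.1, z.2^-1%g)) (fun z : G * G => (z.1 * z.2)%g)).
    apply: cvg_pair; first exact: cvg_fst.
    apply: (cvg_comp _ _ (@cvg_snd _ _ _ _ _)); exact: invg_continuous.
  exact: mulg_continuous.
move=> /fc [[P Q] /= [Px Qy] PQ].
have [a [Ha Pa]] := Hx _ Px.
have [b [Hb Qb]] := Hy _ Qy.
by exists (a / b)%g; split; [exact: HV|exact: (PQ (a, b))].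
Qed.

Lemma G0_subgroup : is_subgroup G0.
Proof. exact/closure_subgroup/generated_subgroup. Qed.

Definition G0_rel : rel G := fun x y => `[< G0 (x^-1 * y)%g >].

Lemma G0_rel_equiv : equiv_class_of G0_rel.
Proof.
have [G1 GV] := G0_subgroup.
have GI x : G0 x -> G0 x^-1%g by move=> /(GV _ _ G1); rewrite mul1g.
have GM x y : G0 x -> G0 y -> G0 (x * y)%g.
  by move=> Gx /GI Gy; rewrite -(invgK y); exact: GV.
have sub x y : G0_rel x y -> G0_rel y x.
  by move=> /asboolP /GI xy; apply/asboolP; rewrite invgM invgK in xy.
split=> [x|x y|y x z].
- by apply/asboolP; rewrite mulVg.
- by apply/idP/idP; exact: sub.
- move=> /asboolP xy /asboolP yz; apply/asboolP.
  by have := GM _ _ xy yz; rewrite -mulgA (mulgA y) mulgV mul1g.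
Qed.

Canonical G0_equiv := EquivRelPack G0_rel_equiv.

(** [G / G0] with the quotient topology.  Its group law is the one that makes
    [pi0] a homomorphism; it is only used through [splitting_isoM] below. *)
Definition abelianization := quotient_topology {eq_quot G0_equiv}%qT.

Definition pi0 (g : G) : abelianization := (\pi g)%qT.

End Abelianization.

(** An identification of the topological groups [G / G0] and
    [R^q * Z^r * M], with [M] a compact abelian group. *)
Record splitting (R : realType) (G : topGroupType) := Splitting {
  splitting_q : nat;
  splitting_r : nat;
  splitting_M : topologicalZmodType;
  splitting_iso :
    abelianization G -> 'rV[R]_splitting_q * 'rV[int]_splitting_r * splitting_M;
  splitting_inv :
    'rV[R]_splitting_q * 'rV[int]_splitting_r * splitting_M -> abelianization G;
  splitting_M_compact : compact [set: splitting_M];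
  splitting_isoM : forall g h : G,
    splitting_iso (pi0 (g * h)%g) = splitting_iso (pi0 g) + splitting_iso (pi0 h);
  splitting_isoK : cancel splitting_iso splitting_inv;
  splitting_invK : cancel splitting_inv splitting_iso;
  splitting_iso_continuous : continuous splitting_iso;
  splitting_inv_continuous : continuous splitting_inv
}.

(** Components of [pi1 : G -> G / G1], i.e. of the projection of [G / G0] onto
    [R^q * Z^r], whose kernel in [G] is [G1]. *)
Definition pi1 (R : realType) (G : topGroupType) (D : splitting R G)
    (i : 'I_(splitting_q D + splitting_r D)) (g : G) : R :=
  let v := splitting_iso D (pi0 g) in
  match fintype.split i with
  | inl j => v.1.1 ord0 j
  | inr j => (v.1.2 ord0 j)%:~R
  end.

Arguments pi1 {R G} D i g.

Definition borel (G : ptopologicalType) := g_sigma_algebraType (@open G).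

Section Haar.
Context {R : realType} {G : topGroupType}.
Variable mu : {measure set (borel G) -> \bar R}.
Implicit Types (f : G -> R[i]) (K psi : G -> R) (U : set G) (p q : \bar R).

Local Notation bmeasurable := (measurable : set (set (borel G))).
Local Notation bmeasurable_fun F :=
  (@measurable_fun _ _ (borel G) (measurableTypeR R) setT F).

(** Nonzero left-invariant Radon measure. *)
Record left_haar : Prop := LeftHaar {
  haar_invariant : forall (g : G) (A : set G), bmeasurable A ->
    mu [set (g * a)%g | a in A] = mu A;
  haar_neq0 : mu [set: G] != 0%E;
  haar_compact : forall C : set G, compact C -> (mu C < +oo)%E;
  haar_outer : forall A : set G, bmeasurable A ->
    mu A = ereal_inf [set mu V | V in [set V : set G | open V /\ A `<=` V]];
  haar_inner : forall V : set G, open V ->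
    mu V = ereal_sup [set mu C | C in [set C : set G | compact C /\ C `<=` V]]
}.

(** The normalization is [d(g^-1) = Delta(g^-1) dg]. *)
Record modular_function (Delta : G -> R) : Prop := ModularFunction {
  modular_gt0 : forall g, 0 < Delta g;
  modularM : forall g h, Delta (g * h)%g = Delta g * Delta h;
  modular_continuous : continuous Delta;
  modular_inv : forall A : set G, bmeasurable A ->
    mu [set a^-1%g | a in A] = (\int[mu]_(g in A) (Delta g^-1%g)%:E)%E
}.

Record density K : Prop := Density {
  density_measurable : bmeasurable_fun K;
  density_ge0 : forall g, 0 <= K g;
  density_int : (\int[mu]_g (K g)%:E = 1)%E
}.

Definition compactly_supported K := compact (closure [set g | K g != 0]).

(** An extended integral equal to [0] is that of an integrable function
    ([+oo - +oo] is [-oo] here). *)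
Definition centered (D : splitting R G) K :=
  forall i, (\int[mu]_g (K g * pi1 D i g)%:E = 0)%E.

Definition cmeasurable f :=
  bmeasurable_fun (fun g => complex.Re (f g)) /\
  bmeasurable_fun (fun g => complex.Im (f g)).

Definition cintegral f : R[i] :=
  Complex (\int[mu]_g complex.Re (f g)) (\int[mu]_g complex.Im (f g)).

Definition cnorm p f : \bar R :=
  Lnorm mu p (fun g : borel G => (complex.Re `|f g|)%:E).

Definition inLp p f := cmeasurable f /\ (cnorm p f < +oo)%E.

Definition maps_Lp p q (S : (G -> R[i]) -> (G -> R[i])) :=
  forall f, inLp p f -> inLp q (S f).

Definition opnorm p q (S : (G -> R[i]) -> (G -> R[i])) : \bar R :=
  ereal_sup [set cnorm q (S f) | f in [set f | inLp p f /\ (cnorm p f <= 1)%E]].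

Definition convolution K1 K2 : G -> R :=
  fun g => \int[mu]_h (K1 h * K2 (h^-1 * g)%g).

Definition convop K f : G -> R[i] :=
  fun g => cintegral (fun h => (K h)%:C%C * f (h^-1 * g)%g).

(** [convn K m n] is [K_(m+n) * ... * K_(m+1)] for [n >= 1]; the value at
    [n = 0] is a dummy. *)
Fixpoint convn (K : nat -> G -> R) (m n : nat) : G -> R :=
  match n with
  | 0 => cst 0
  | 1 => K m.+1
  | n'.+1 => convolution (K (m + n)%N) (convn K m n')
  end.

(** [convops K m n] is [T_(m+n) o ... o T_(m+1)], where [T_k f = K_k * f]. *)
Fixpoint convops (K : nat -> G -> R) (m n : nat) f : G -> R[i] :=
  if n is n'.+1 then convop (K (m + n)%N) (convops K m n' f) else f.

(** [e^(lambda psi) S e^(- lambda psi)] *)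
Definition twist (lambda : R) psi (S : (G -> R[i]) -> (G -> R[i])) f :
    G -> R[i] :=
  fun g => (expR (lambda * psi g))%:C%C *
    S (fun h => (expR (- (lambda * psi h)))%:C%C * f h) g.

Definition rho U (g : G) : R :=
  inf [set n%:R | n in [set n | (0 < n)%N /\ setpow U n g]].

Definition ltrans (g : G) psi : G -> R := fun h => psi (g^-1 * h)%g.

Definition partial (g : G) psi : G -> R := ltrans g psi \- psi.

(** [Lnorm mu +oo] is the essential supremum norm. *)
Record classE U psi : Prop := ClassE {
  classE_measurable : bmeasurable_fun psi;
  classE_locally_bounded :
    forall g : G, exists M : R, \forall h \near g, `|psi h| <= M;
  classE_partial :
    (ereal_sup [set Lnorm mu +oo (fun g : borel G => (partial u psi g)%:E)
               | u in U] <= 1)%E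
}.

End Haar.
Arguments rho {R G}.

(* Main.v *)
(** For f >= 0 put w(g, h) = e^(lam (psi g - psi (h^-1 g))) f(h^-1 g), so that the twisted operator
    applied to f is the K-mean Tf(g) of w(g, .).  The variance identity
      int Tf^2 = int_h K(h) int_g w(g, h)^2 - Q,   Q = int_h K(h) int_g (w(g, h) - Tf(g))^2,
    leaves room for a first order term: for |lam| <= 1,
      int_g w(g, h)^2 <= |f|^2 + 2 lam A(h) + O(lam^2) |f|^2,   A(h) = int f(g)^2 (psi(h g) - psi g) dg.
    A is additive up to an error which is at most a multiple of the integral of |f_k^2 - f^2|, where
    f_k(g) = f(k^-1 g), hence is controlled by t D(k) + |f|^2 / t with D(k) = int (f_k - f)^2.  As K >= eps
    on a generating neighborhood, D is bounded on compacts by a multiple of Q + lam^2 |f|^2.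
    A function which is additive up to an error delta stays, on compacts, within O(delta) of a linear
    combination of the pi1^(i), so centeredness gives |int K A| = O(delta).  With t ~ 1/|lam| the term
    2 lam int K A is thus absorbed by Q and O(lam^2) |f|^2.  The constants depend only on eps, W, W' and
    U, so the estimate int Tf^2 <= e^(w lam^2) |f|^2 can be iterated along the sequence.

    For the kernel, take psi = rho and f = K_(m+1).  One more convolution turns the L^2 bound into a
    pointwise one, the substitution h -> h^-1 g being responsible for Delta(g)^(-1/2), and lam is chosen
    proportional to rho(g)/n.

    G need not be second countable, so that the Borel sets of G * G can exceed the product of the Borel
    sigma-algebras, and Tonelli's theorem has to be proved for Borel functions on G * G. *)
Require Import Defs.
From HB Require Import structures.
From mathcomp Require Import all_boot all_order all_algebra.
From mathcomp Require Import all_classical all_reals all_analysis.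
From mathcomp Require Import complex.
From mathcomp Require Import measurable_realfun ess_sup_inf.
From mathcomp Require Import ring lra.
Set Implicit Arguments.
Unset Strict Implicit.
Unset Printing Implicit Defensive.
Import Order.TTheory GRing.Theory Num.Theory.
Import numFieldNormedType.Exports.
Local Open Scope classical_set_scope.
Local Open Scope ring_scope.

(** The one-step estimate is proved for bounded [f] of compact support, where every integral is
    finite although psi need not be bounded. Truncation and monotone convergence carry it to
    [0, +oo]-valued functions, which can be iterated without integrability conditions, and complex
    functions are dominated through their modulus. Uniformity shapes the rest: no constant may
    depend on [f], psi or K. Both propagation arguments are therefore stated for whole classes,
    namely for all D, E, Y with [spread], and for all A with [quasi_hom] and a fixed weight [kappa]
    on compact sets. The first yields its constants by averaging, the second by contradiction. The
    bound on D is needed at every point, not on average, because additivity of A is tested on each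
    pair h, k; it is available because D is a squared distance between translates. With t = 1 / (M
    |lam|) the term 2 lam int K A contributes a multiple of Q of order 1/M, which is at most Q for M
    large, at the price of M lam^2 |f|^2. For |lam| > 1 the crude bound e^(L |lam|) <= e^(L lam^2)
    suffices. *)

(** If [P C] fails, the sets [S] with [P (C \ S)] form a proper filter containing [C]. A cluster
    point in [C] has a neighborhood [N] with [P N], so the complement of [N] is in the filter, a
    contradiction. This replaces the extraction of finite subcovers throughout. *)
Lemma compact_local (X : topologicalType) (C : set X) (P : set X -> Prop) :
  compact C -> P set0 -> (forall A B, P A -> P B -> P (A `|` B)) ->
  (forall A B, A `<=` B -> P B -> P A) ->
  (forall x, C x -> exists2 N, nbhs x N & P N) -> P C.
Proof.
move=> cC P0 PU Psub Ploc; apply: contrapT => nPC.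
pose F : set_system X := [set S | P (C `\` S)].
have FF : ProperFilter F.
  split; first by rewrite /F /= setD0.
  split; rewrite /F /=.
  - by rewrite setDT.
  - move=> A B PA PB; apply: Psub (PU _ _ PA PB) => x [Cx nABx].
    by have [Ax|] := pselect (A x); [right; split=> // Bx; exact: nABx|left].
  - by move=> A B AB; apply: Psub => x [Cx nBx]; split=> // /AB.
have FC : F C by rewrite /F /= setDv.
have [x [Cx clx]] := cC _ FF FC.
have [N Nx PN] := Ploc _ Cx.
have FN : F (~` N) by apply: Psub PN => y [_ /contrapT].
by have [y [nNy Ny]] := clx _ _ FN Nx.
Qed.

(** The library does not declare products of pointed topological spaces. *)
HB.saturate prod.

(** * Borel maps, and induction over nonnegative measurable functions *)

Section BorelMaps.
Context {R : realType}.

Lemma open_borel (X : ptopologicalType) (A : set X) :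
  open A -> measurable (A : set (borel X)).
Proof. exact: sub_sigma_algebra. Qed.

Lemma closed_borel (X : ptopologicalType) (A : set X) :
  closed A -> measurable (A : set (borel X)).
Proof.
move=> cA; rewrite -(setCK A); apply: measurableC.
by apply: open_borel; exact: closed_openC.
Qed.

Lemma compact_borel (X : ptopologicalType) (A : set X) :
  hausdorff_space X -> compact A -> measurable (A : set (borel X)).
Proof. by move=> hX cA; apply: closed_borel; exact: compact_closed. Qed.

Lemma continuous_borel (X Y : ptopologicalType) (f : X -> Y) :
  continuous f -> measurable_fun setT (f : borel X -> borel Y).
Proof.
move=> /continuousP cf; apply: (measurability (@open Y : set (set (borel Y)))) => //.
by move=> _ [B oB <-]; rewrite setTI; apply: open_borel; exact: cf.
Qed.

Lemma continuous_borelR (X : ptopologicalType) (f : X -> R) :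
  continuous f -> measurable_fun setT (f : borel X -> measurableTypeR R).
Proof.
move=> /continuousP cf; apply: (measurability _ (RGenOpens.measurableE R)) => //.
move=> _ [_ [a [b ->] <-]]; rewrite setTI; apply: open_borel.
by apply: cf; exact: interval_open.
Qed.

Lemma borel_comp d (Z : measurableType d) (X Y : ptopologicalType)
    (f : borel Y -> Z) (c : X -> Y) : continuous c ->
  measurable_fun setT f ->
  measurable_fun setT ((fun x => f (c x)) : borel X -> Z).
Proof.
by move=> cc mf; exact: (measurableT_comp mf (continuous_borel cc)).
Qed.

Lemma borel_preimage (X Y : ptopologicalType) (c : X -> Y)
    (A : set (borel Y)) :
  continuous c -> measurable A -> measurable (c @^-1` A : set (borel X)).
Proof.
by move=> /continuous_borel mc mA; rewrite -[X in measurable X]setTI; exact: mc.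
Qed.

End BorelMaps.

Section Ge0Induction.
Import HBNNSimple.
Context d {T : measurableType d} {R : realType}.
Implicit Types (f : T -> \bar R).
Local Open Scope ereal_scope.

Lemma ge0_measurable_ind (P : (T -> \bar R) -> Prop) :
  (forall A, measurable A -> P (fun x => (\1_A x)%:E)) ->
  (forall f g, measurable_fun setT f -> measurable_fun setT g ->
    (forall x, 0 <= f x) -> (forall x, 0 <= g x) -> P f -> P g ->
    P (fun x => f x + g x)) ->
  (forall (k : R) f, (0 <= k)%R -> measurable_fun setT f ->
    (forall x, 0 <= f x) -> P f -> P (fun x => k%:E * f x)) ->
  (forall f (u : nat -> T -> \bar R), (forall n, measurable_fun setT (u n)) ->
    (forall n x, 0 <= u n x) ->
    (forall x m n, (m <= n)%N -> u m x <= u n x) ->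
    (forall n, P (u n)) -> (forall x, u ^~ x @ \oo --> f x) -> P f) ->
  forall f, measurable_fun setT f -> (forall x, 0 <= f x) -> P f.
Proof.
move=> P1 PD PZ Plim f mf f0.
pose u n := EFin \o (nnsfun_approx measurableT mf n : T -> R).
apply: (Plim f u).
- by move=> n; exact/measurable_EFinP.
- by move=> n x; rewrite lee_fin.
- move=> x m n mn; rewrite lee_fin.
  by have /lefP := nd_nnsfun_approx measurableT mf mn; exact.
- move=> n; rewrite /u; set h := nnsfun_approx _ _ _.
  have fr : finite_set (range h) by exact: fimfunP.
  have -> : EFin \o h = (fun x =>
      \sum_(y <- finmap.enum_fset (fset_set (range h))) (y%:E * (\1_(h @^-1` [set y]) x)%:E)).
    apply/funext => x /=; rewrite fimfunE fsbig_finite//= -sumEFin.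
    by [].
  have mA (y : R) : measurable (h @^-1` [set y]).
    by rewrite -[X in measurable X]setTI; exact: measurable_funP1.
  have mt (y : R) : measurable_fun setT
      (fun x => y%:E * (\1_(h @^-1` [set y]) x)%:E).
    apply/measurable_EFinP; apply: measurable_funM => //.
  have P0 : P (cst 0).
    have -> : cst 0 = (fun x => 0%:E * (\1_set0 x)%:E) :> (T -> \bar R).
      by apply/funext => x; rewrite mul0e.
    by apply: PZ => //; [exact/measurable_EFinP|exact: P1].
  have : {in finmap.enum_fset (fset_set (range h)), forall y, 0 <= y}%R.
    by move=> y; rewrite in_fset_set// inE => -[x _ <-].
  (* A simple function is the sum over its list of values of value times indicator of the level set;
     the induction is on that list, and only the nonnegativity of the values is kept. *)
  elim: (finmap.enum_fset _) => [_|y s ih ys].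
    have -> : (fun x => \sum_(y <- [::]) (y%:E * (\1_(h @^-1` [set y]) x)%:E))
      = cst 0 by apply/funext => x; rewrite big_nil.
    exact: P0.
  under eq_fun do rewrite big_cons.
  have y0 : (0 <= y)%R by apply: ys; rewrite inE eqxx.
  have s0 : {in s, forall y, 0 <= y}%R.
    by move=> z zs; apply: ys; rewrite inE zs orbT.
  apply: PD => //.
  + exact: emeasurable_sum.
  + by move=> x; rewrite mule_ge0// lee_fin.
  + move=> x; rewrite big_seq_cond; apply: sume_ge0 => z /andP[zs _].
    by rewrite mule_ge0// lee_fin//; exact: s0.
  + by apply: PZ => //; [exact/measurable_EFinP/measurable_indic|exact: P1].
  + exact: ih.
- by move=> x; exact: cvg_nnsfun_approx.
Qed.

End Ge0Induction.

Section Slices.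
Context {R : realType} {X Y : ptopologicalType}.

Definition slice (E : set (X * Y)) (x : X) : set Y := [set y | E (x, y)].

Lemma continuous_pair (x : X) : continuous (fun y : Y => (x, y)).
Proof. by move=> y; apply: cvg_pair; [exact: cvg_cst|exact: cvg_id]. Qed.

Lemma slice_borel (E : set (borel (X * Y)%type)) x :
  measurable E -> measurable (slice E x : set (borel Y)).
Proof. by move=> mE; exact: (borel_preimage (@continuous_pair x) mE). Qed.

End Slices.

(** * Tonelli's theorem for Borel functions on products *)

Section SliceMeasure.
Context {R : realType} {Y : ptopologicalType}.

(** The part of the Haar measure that Tonelli's theorem uses. Compact sets are Borel by separation,
    open sets are exhausted from within by compact ones, and sigma-finiteness is witnessed by an
    increasing sequence of open sets, so that cutting an open set down to finite measure leaves it
    open. *)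
Record open_radon (nu : {measure set (borel Y) -> \bar R}) : Prop := OpenRadon {
  open_radon_hausdorff : hausdorff_space Y;
  open_radon_inner : forall V : set Y, open V ->
    nu V = ereal_sup [set nu C | C in [set C : set Y | compact C /\ C `<=` V]];
  open_radon_exhaustion : exists B : nat -> set Y, [/\
    forall n, open (B n), {homo B : m n / (m <= n)%N >-> m `<=` n},
    \bigcup_n B n = [set: Y] & forall n, (nu (B n) < +oo)%E] }.

Variable nu : {measure set (borel Y) -> \bar R}.
Hypothesis nuR : open_radon nu.
Local Open Scope ereal_scope.

Lemma open_radon_gt (V : set Y) (r : \bar R) : open V -> r < nu V ->
  exists C : set Y, [/\ compact C, C `<=` V & r < nu C].
Proof.
move=> oV; rewrite (open_radon_inner nuR oV).
by move=> /ereal_sup_gt[_ [C [cC CV] <-] rC]; exists C.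
Qed.

(** The tube lemma. *)
Lemma near_slice_compact (X : ptopologicalType) (E : set (X * Y)) (C : set Y) x :
  open E -> compact C -> C `<=` slice E x -> \forall z \near x, C `<=` slice E z.
Proof.
move=> oE /compact_near_coveringP cC CE.
apply: (cC X (nbhs x) (fun z y => E (z, y))) => y Cy.
have [[A B] /= [Ax By] AB] := open_nbhs_nbhs (conj oE (CE _ Cy)).
by exists (B, A) => // -[y' x'] /= [By' Ax']; exact: (AB (x', y')).
Qed.

(** Lower semicontinuity takes the place of measurability with respect to rectangles: a compact
    subset of the slice at [x] of measure above [r] stays inside the slices at nearby points. *)
Lemma slice_measure_lsc (X : ptopologicalType) (E : set (X * Y)) (r : \bar R) :
  open E -> open [set x | r < nu (slice E x)].
Proof.
move=> oE; rewrite openE => x /= rx.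
have oEx : open (slice E x).
  by have /continuousP := @continuous_pair X Y x; exact.
have [C [cC CE rC]] := open_radon_gt oEx rx.
apply: filterS (near_slice_compact oE cC CE) => z CEz /=.
apply: (lt_le_trans rC); apply: le_measure => //; rewrite inE.
  exact: compact_borel (open_radon_hausdorff nuR) cC.
by apply: open_borel; have /continuousP := @continuous_pair X Y z; exact.
Qed.

(** Open sets are stable under intersection and generate, and for them semicontinuity gives
    measurability; Dynkin's lemma does the rest. Complements require subtracting, hence finite
    measure, so the slices are first cut by [B n]. *)
Lemma slice_measure_measurable (X : ptopologicalType)
    (E : set (borel (X * Y)%type)) : measurable E ->
  measurable_fun setT ((fun x => nu (slice E x)) : borel X -> \bar R).
Proof.
move=> mE.
have [B [oO ndO cO fO]] := open_radon_exhaustion nuR.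
have mO n : measurable (B n : set (borel Y)) by exact: open_borel.
have mS (F : set (borel (X * Y)%type)) n x : measurable F ->
    measurable (slice F x `&` B n : set (borel Y)).
  by move=> mF; apply: measurableI => //; exact: slice_borel.
suff H : forall n, measurable_fun setT
    ((fun x => nu (slice E x `&` B n)) : borel X -> \bar R).
  apply: (@emeasurable_fun_cvg _ (borel X) R setT
    (fun n x => nu (slice E x `&` B n)) (fun x => nu (slice E x))) => // x _.
  have := @nondecreasing_cvg_mu _ _ _ nu (fun n => slice E x `&` B n).
  rewrite -setI_bigcupr cO setIT; apply.
  - by move=> n; exact: mS.
  - exact: slice_borel.
  - by move=> m n mn; apply/subsetPset; apply: setIS; exact: ndO.
move=> n; pose P (F : set (borel (X * Y)%type)) := measurable_fun setT
    ((fun x => nu (slice F x `&` B n)) : borel X -> \bar R).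
apply: (@dynkin_induction _ (borel (X * Y)%type) (@open (X * Y)%type) P) => //.
- exact: openI.
- rewrite /P (_ : (fun x => _) = cst (nu (B n))); first exact: measurable_cst.
  by apply/funext => x; congr (nu _); apply/seteqP; split => y //= -[].
- move=> F oF; apply: (measurability _ (ErealGenOInfty.measurableE R)) => //.
  move=> _ [_ [r ->] <-]; rewrite setTI; apply: open_borel.
  have -> : (fun x => nu (slice F x `&` B n)) @^-1` `]r%:E, +oo[%classic =
      [set x | r%:E < nu (slice (F `&` (snd @^-1` B n)) x)].
    by apply/seteqP; split => x /=; rewrite in_itv/= andbT.
  apply: slice_measure_lsc; apply: openI => //.
  by apply: open_comp => // z _; exact: cvg_snd.
- move=> F mF PF; rewrite /P.
  have -> : (fun x => nu (slice (~` F) x `&` B n)) =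
      (fun x => nu (B n) - nu (slice F x `&` B n)).
    apply/funext => x; rewrite setIC -setDE.
    have -> : slice F x `&` B n = B n `&` slice F x by rewrite setIC.
    by rewrite measureD//; [exact: (slice_borel x mF)|exact: fO].
  apply: (@emeasurable_funB _ (borel X) R setT (cst _)) => //.
- move=> F mF tF PF; rewrite /P.
  have -> : (fun x => nu (slice (\bigcup_k F k) x `&` B n)) =
      (fun x => \sum_(0 <= k <oo) nu (slice (F k) x `&` B n)).
    apply/funext => x.
    have -> : slice (\bigcup_k F k) x `&` B n = \bigcup_k (slice (F k) x `&` B n).
      by rewrite -setI_bigcupl.
    rewrite measure_bigcup//.
    + by apply: eq_eseriesl => k /=; rewrite in_setT.
    + by move=> k _; exact: mS.
    + move=> i j _ _ [y [[Fi _] [Fj _]]].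
      by apply: (tF i j) => //; exists (x, y).
  apply: (@ge0_emeasurable_sum _ (borel X) R setT
    (fun k x => nu (slice (F k) x `&` B n)) xpredT) => // k _; exact: PF.
Qed.

End SliceMeasure.

Section SliceIntegral.
Context {R : realType} {X Y : ptopologicalType}.
Variable nu : {measure set (borel Y) -> \bar R}.
Hypothesis nuR : open_radon nu.
Local Open Scope ereal_scope.

Lemma slice_fun_measurable (f : borel (X * Y)%type -> \bar R) (x : X) :
  measurable_fun setT f ->
  measurable_fun setT ((fun y => f (x, y)) : borel Y -> \bar R).
Proof. by move=> mf; exact: (borel_comp (@continuous_pair X Y x)). Qed.

Lemma slice_integral_measurable (f : borel (X * Y)%type -> \bar R) :
  measurable_fun setT f -> (forall z, 0 <= f z) ->
  measurable_fun setT ((fun x => \int[nu]_y f (x, y)) : borel X -> \bar R).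
Proof.
move: f; apply: ge0_measurable_ind => [A mA|f g mf mg f0 g0 Pf Pg|k f k0 mf f0 Pf
  |f u mu' u0 ndu Pu cu].
- rewrite (_ : (fun x => _) = (fun x => nu (slice A x))).
    exact: slice_measure_measurable.
  apply/funext => x; rewrite (_ : (fun y => _) = (fun y => (\1_(slice A x) y)%:E)).
    by rewrite integral_indic// ?setIT//; exact: slice_borel.
  by apply/funext => y; rewrite !indicE.
- rewrite (_ : (fun x => _) =
      (fun x => \int[nu]_y f (x, y)) \+ (fun x => \int[nu]_y g (x, y))).
    exact: emeasurable_funD.
  apply/funext => x /=; rewrite ge0_integralD//; exact: slice_fun_measurable.
- rewrite (_ : (fun x => _) = (fun x => k%:E * \int[nu]_y f (x, y))).
    exact: (@measurable_funeM _ (borel X)).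
  apply/funext => x /=; rewrite ge0_integralZl//; exact: slice_fun_measurable.
- apply: (@emeasurable_fun_cvg _ (borel X) R setT
    (fun n x => \int[nu]_y u n (x, y)) (fun x => \int[nu]_y f (x, y))) => // x _.
  rewrite [X in _ --> X](_ : _ = \int[nu]_y limn (fun n => u n (x, y))).
    apply: cvg_monotone_convergence => //.
      by move=> n; exact: slice_fun_measurable.
    by move=> y _ m n mn; exact: ndu.
  by apply: eq_integral => y _; apply/esym/cvg_lim => //; exact: cu.
Qed.

End SliceIntegral.

Section OpenTonelli.
Context {R : realType} {X Y : ptopologicalType}.
Variables (mu : {measure set (borel X) -> \bar R}).
Variables (nu : {measure set (borel Y) -> \bar R}).
Hypotheses (muR : open_radon mu) (nuR : open_radon nu).
Local Open Scope ereal_scope.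

Definition pswap {S T : Type} (z : S * T) : T * S := (z.2, z.1).

Lemma continuous_pswap (S T : topologicalType) : continuous (@pswap S T).
Proof. by move=> z; apply: cvg_pair; [exact: cvg_snd|exact: cvg_fst]. Qed.

Let slice' (E : set (X * Y)) (y : Y) : set X := slice (pswap @^-1` E) y.

Variable E : set (X * Y).
Hypothesis oE : open E.

Let mE : measurable (E : set (borel (X * Y)%type)).
Proof. exact: open_borel. Qed.

(** The mass of the part of [E] over [A], integrated in the other order. *)
Let J (A : set X) := \int[nu]_y mu (slice' E y `&` A).

Let slice'I (A : set X) y : slice' E y `&` A = slice' (E `&` (fst @^-1` A)) y.
Proof. by []. Qed.

Let mEA (A : set (borel X)) : measurable A ->
  measurable (E `&` (fst @^-1` A) : set (borel (X * Y)%type)).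
Proof.
move=> mA; apply: measurableI => //.
by apply: (borel_preimage _ mA) => z; exact: cvg_fst.
Qed.

Let mslice' (A : set (borel X)) y : measurable A ->
  measurable (slice' E y `&` A : set (borel X)).
Proof.
move=> mA; rewrite slice'I; apply: slice_borel.
by apply: (borel_preimage (@continuous_pswap Y X)); exact: mEA.
Qed.

Let mJ (A : set (borel X)) : measurable A ->
  measurable_fun setT ((fun y => mu (slice' E y `&` A)) : borel Y -> \bar R).
Proof.
move=> mA; under eq_fun do rewrite slice'I.
apply: slice_measure_measurable => //.
by apply: (borel_preimage (@continuous_pswap Y X)); exact: mEA.
Qed.

Let JU (A B : set (borel X)) : measurable A -> measurable B -> A `&` B = set0 ->
  J (A `|` B) = J A + J B.
Proof.
move=> mA mB AB; rewrite /J -ge0_integralD//; [|exact: mJ|exact: mJ].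
apply: eq_integral => y _; rewrite setIUr measureU//; try exact: mslice'.
by rewrite setIACA AB setI0.
Qed.

Let leJ (A B : set (borel X)) : measurable A -> measurable B -> A `<=` B ->
  J A <= J B.
Proof.
move=> mA mB AB; apply: ge0_le_integral => //; try exact: mJ.
move=> y _; apply: le_measure; rewrite ?inE; try exact: mslice'.
exact: setIS.
Qed.

(** The open set [S'] around [S] lets two bounds be glued: a Borel set inside a union is split along
    the first open set into Borel pieces. *)
Let local_bound (s : R) (S : set X) := exists S' : set X, [/\ open S', S `<=` S' &
  forall A : set (borel X), measurable A -> A `<=` S' -> s%:E * mu A <= J A].

(** Some compact [C] in the slice at [x] has measure above [s], and by the tube lemma [C] lies in
    every slice over a neighborhood. So [E] contains the product of [A] and [C] for each [A] in that
    neighborhood. *)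
Let lb_near (s : R) x : (0 <= s)%R -> s%:E < nu (slice E x) ->
  exists2 N, nbhs x N & local_bound s N.
Proof.
move=> s0 sx.
have oEx : open (slice E x).
  by have /continuousP := @continuous_pair X Y x; exact.
have [C [cC CE sC]] := open_radon_gt nuR oEx sx.
have := near_slice_compact oE cC CE.
rewrite /prop_near1 {1}nbhsE => -[N [oN Nx] NC]; exists N; first by apply: open_nbhs_nbhs; split.
exists N; split=> // A mA AN.
have mC : measurable (C : set (borel Y)).
  exact: compact_borel (open_radon_hausdorff nuR) cC.
apply: (@le_trans _ _ (mu A * nu C)).
  by rewrite muleC lee_wpmul2l//; exact: ltW.
rewrite -integral_cst//.
apply: (@le_trans _ _ (\int[nu]_(y in C) mu (slice' E y `&` A))).
  apply: ge0_le_integral => //.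
  - by apply: measurable_funTS; exact: mJ.
  - move=> y Cy; apply: le_measure; rewrite ?inE//; first exact: mslice'.
    by move=> z Az; split=> //; exact: (NC _ (AN _ Az)).
apply: ge0_subset_integral => //; exact: mJ.
Qed.

Let lbU s S T : local_bound s S -> local_bound s T -> local_bound s (S `|` T).
Proof.
move=> [S' [oS SS' HS]] [T' [oT TT' HT]]; exists (S' `|` T'); split.
- exact: openU.
- exact: setUSS.
- move=> A mA AST.
  have mS : measurable (S' : set (borel X)) by exact: open_borel.
  have mAS : measurable (A `&` S' : set (borel X)) by exact: measurableI.
  have mAD : measurable (A `\` S' : set (borel X)) by exact: measurableD.
  have AS0 : (A `&` S') `&` (A `\` S') = set0.
    by apply/seteqP; split=> // z [[_ Sz] [_ /(_ Sz)]].
  rewrite -(setUIDK A S') measureU// JU// ge0_muleDr//; apply: leeD.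
    by apply: HS => // z [].
  by apply: HT => // z [Az nSz]; have [|] := AST _ Az.
Qed.

(** The local bounds hold on an open set [N] containing [A], but compactness is needed to glue them.
    Within [B n] the set [N] is exhausted, up to small measure, by a compact [C]; gluing over [C]
    gives the bound for [A] inside [C], and the remainder is negligible. *)
Let lb_set (r : R) (A : set (borel X)) : (0 <= r)%R -> measurable A ->
  (forall x, A x -> r%:E <= nu (slice E x)) -> r%:E * mu A <= J A.
Proof.
move=> r0 mA rA.
have [->|rn0] := eqVneq r 0%R; first by rewrite mul0e; exact: integral_ge0.
apply/lee_mul01Pr; first by rewrite mule_ge0.
(* Passing to [s < r] makes the inequality on the slices strict, as [lb_near] requires. *)
move=> d /andP[d0 d1]; rewrite muleA -EFinM; set s := (d * r)%R.
have s0 : (0 <= s)%R by rewrite mulr_ge0// ltW.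
pose N := \bigcup_(S in [set S : set X | open S /\ local_bound s S]) S.
have oN : open N by apply: bigcup_open => S [].
have AN : A `<=` N.
  move=> x Ax; have [|S Sx lbS] := @lb_near s x s0.
    apply: lt_le_trans (rA _ Ax); rewrite lte_fin.
    by rewrite /s -[ltRHS]mul1r ltr_pM2r// lt_neqAle eq_sym rn0.
  have [S' [oS' SS' HS']] := lbS.
  exists S'; last by apply: SS'; exact: nbhs_singleton.
  by split=> //; exists S'; split.
have [B [oB ndB cB fB]] := open_radon_exhaustion muR.
have mB n : measurable (B n : set (borel X)) by exact: open_borel.
have An n : s%:E * mu (A `&` B n) <= J A.
  apply/lee_addgt0Pr => e e0.
  have oV : open (N `&` B n) by exact: openI.
  have mV : measurable (N `&` B n : set (borel X)) by exact: open_borel.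
  have fV : mu (N `&` B n) < +oo.
    by apply: le_lt_trans (fB n); apply: le_measure; rewrite ?inE.
  (* The denominator is [s + 1] so that [s] times the error is at most [e] also when [s] is 0. *)
  have e'0 : (0 < e / (s + 1))%R by rewrite divr_gt0// ltr_wpDl.
  have [C [cC CV VC]] : exists C, [/\ compact C, C `<=` N `&` B n &
      mu (N `&` B n) - (e / (s + 1))%:E < mu C].
    apply: (open_radon_gt muR oV); rewrite lteBlDr// lteDl//.
    by rewrite ge0_fin_numE.
  have mC : measurable (C : set (borel X)).
    exact: compact_borel (open_radon_hausdorff muR) cC.
  have [S' [oS' CS' HS']] : local_bound s C.
    apply: (compact_local cC).
    - exists set0; split=> //; first exact: open0.
      by move=> A' mA'; rewrite subset0 => ->; rewrite measure0 mule0 integral_ge0.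
    - by move=> S T; exact: lbU.
    - move=> S T ST [T' [oT TT' HT]]; exists T'; split=> //.
      exact: subset_trans TT'.
    - move=> x /CV[[S [oS [S' [oS' SS' HS']]] Sx] _]; exists S.
        by apply: open_nbhs_nbhs; split.
      by exists S'; split.
  have mAB : measurable (A `&` B n : set (borel X)) by exact: measurableI.
  rewrite -(setUIDK (A `&` B n) C) measureU//; last 3 first.
  - exact: measurableI.
  - exact: measurableD.
  - by apply/seteqP; split=> // z [[_ Cz] [_ /(_ Cz)]].
  rewrite ge0_muleDr//; apply: leeD.
    apply: (@le_trans _ _ (J (A `&` B n `&` C))).
      apply: HS'; first exact: measurableI.
      by move=> z [_ /CS'].
    by apply: leJ => //; [exact: measurableI|move=> z [[]]].
  apply: (@le_trans _ _ (s%:E * (e / (s + 1))%:E)).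
    rewrite lee_wpmul2l//; apply: (@le_trans _ _ (mu ((N `&` B n) `\` C))).
      apply: le_measure; rewrite ?inE; [exact: measurableD|exact: measurableD|].
      by move=> z [[Az Bz] nCz]; split=> //; split=> //; exact: AN.
    rewrite measureD// (_ : _ `&` C = C); last by rewrite setIidr.
    have fC : mu C \is a fin_num.
      rewrite ge0_fin_numE//; apply: le_lt_trans fV.
      by apply: le_measure; rewrite ?inE.
    by rewrite leeBlDr// addeC -leeBlDr//; exact: ltW.
  rewrite -EFinM lee_fin mulrCA -[leRHS]mulr1 ler_pM2l//.
  by rewrite ler_pdivrMr ?mul1r ?lerDl// ltr_wpDl.
have cvA : mu \o (fun n => A `&` B n) @ \oo --> mu A.
  have := @nondecreasing_cvg_mu _ _ _ mu (fun n => A `&` B n).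
  rewrite -setI_bigcupr cB setIT; apply => //.
  - by move=> n; exact: measurableI.
  - by move=> m n mn; apply/subsetPset; apply: setIS; exact: ndB.
have cvsA : (fun n => s%:E * mu (A `&` B n)) @ \oo --> s%:E * mu A.
  exact: cvgeZl.
apply: (cvge_le _ cvsA).
by apply: nearW => n; exact: An.
Qed.

Import HBNNSimple.

(** A simple function below the slice measure is compared level set by level set by means of
    [lb_set]; on disjoint level sets the values of [J] add up to at most the other iterated
    integral. Exchanging the factors gives the reverse inequality. *)
Lemma open_tonelli_le :
  \int[mu]_x nu (slice E x) <= \int[nu]_y mu (slice (pswap @^-1` E) y).
Proof.
rewrite ge0_integralTE//; apply: ge_ereal_sup => _ [h hE <-].
rewrite sintegralE.
have fr : finite_set (range h) by exact: fimfunP.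
have mA (r : R) : measurable (h @^-1` [set r]).
  by rewrite -[X in measurable X]setTI; exact: measurable_funP1.
apply: (@le_trans _ _ (\sum_(r \in range h) J (h @^-1` [set r]))).
  apply: lee_fsum => // r [x _ <-]; apply: lb_set => //.
  by move=> z /= <-; exact: hE.
rewrite /J -ge0_integral_fsum//; last by move=> r; exact: mJ.
apply: ge0_le_integral => //.
- by move=> y _; rewrite fsume_ge0.
- rewrite (_ : (fun y => _) = (fun y => mu (slice' E y `&` setT))).
    exact: mJ.
  apply/funext => y; rewrite -measure_fsbig//.
  + by rewrite fsbig_setU// -setI_bigcupr -fsbig_setU// nnsfun_cover.
  + by move=> r _; exact: mslice'.
  + by move=> i j _ _ [z [[_ /= <-] [_ /= <-]]].
- under eq_fun do rewrite -[slice _ _]setIT.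
  exact: mJ.
- move=> y _; rewrite -measure_fsbig//.
  + by rewrite fsbig_setU// -setI_bigcupr -fsbig_setU// nnsfun_cover setIT.
  + by move=> r _; exact: mslice'.
  + by move=> i j _ _ [z [[_ /= <-] [_ /= <-]]].
Qed.

End OpenTonelli.

Section SliceInt.
Context {R : realType} {X Y : ptopologicalType}.
Variables (mu : {measure set (borel X) -> \bar R}).
Variables (nu : {measure set (borel Y) -> \bar R}).
Hypothesis nuR : open_radon nu.
Local Open Scope ereal_scope.

Definition slice_int (E : set (borel (X * Y)%type)) := \int[mu]_x nu (slice E x).

Lemma slice_int_semi_sigma_additive : semi_sigma_additive slice_int.
Proof.
move=> F mF tF mUF; rewrite /slice_int.
have -> : \int[mu]_x nu (slice (\bigcup_n F n) x) =
    \int[mu]_x \sum_(0 <= n <oo) nu (slice (F n) x).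
  apply: eq_integral => x _.
  have -> : slice (\bigcup_k F k) x = \bigcup_k (slice (F k) x) by [].
  rewrite measure_semi_bigcup//.
  - by move=> i; exact: slice_borel.
  - move=> i j _ _ [y [Fi Fj]].
    by apply: (tF i j) => //; exists (x, y).
  - by apply: bigcup_measurable => i _; exact: slice_borel.
rewrite integral_nneseries//; last first.
  by move=> n; exact: slice_measure_measurable.
apply: is_cvg_nneseries => n _ _; exact: integral_ge0.
Qed.

End SliceInt.

Section Tonelli.
Context {R : realType} {X Y : ptopologicalType}.
Variables (mu : {measure set (borel X) -> \bar R}).
Variables (nu : {measure set (borel Y) -> \bar R}).
Hypotheses (muR : open_radon mu) (nuR : open_radon nu).
Local Open Scope ereal_scope.

Lemma open_tonelli (E : set (X * Y)) : open E ->
  \int[mu]_x nu (slice E x) = \int[nu]_y mu (slice (pswap @^-1` E) y).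
Proof.
move=> oE; apply/eqP; rewrite eq_le open_tonelli_le//=.
have oE' : open (pswap @^-1` E) by apply: open_comp => // z _; exact: continuous_pswap.
exact: (open_tonelli_le nuR muR oE').
Qed.

(** Both sides are measures in [E]. They agree on open sets, which are stable under intersection,
    and are finite on the open rectangles [A n * B n] exhausting the product, so uniqueness of
    measures applies. *)
Lemma slice_int_swap (E : set (borel (X * Y)%type)) : measurable E ->
  slice_int mu nu E = slice_int nu mu (pswap @^-1` E).
Proof.
have H1 := @slice_int_semi_sigma_additive _ _ _ mu nu nuR.
have H2 : semi_sigma_additive (fun E : set (borel (X * Y)%type) =>
    slice_int nu mu (pswap @^-1` E)).
  move=> F mF tF mUF.
  have mp (A : set (borel (X * Y)%type)) : measurable A ->
      measurable (pswap @^-1` A : set (borel (Y * X)%type)).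
    by move=> mA; exact: (borel_preimage (@continuous_pswap Y X) mA).
  rewrite preimage_bigcup.
  apply: (@slice_int_semi_sigma_additive _ _ _ nu mu muR).
  - by move=> n; exact: mp.
  - by move=> i j _ _ [z [Fi Fj]]; apply: (tF i j) => //; exists (pswap z).
  - by apply: bigcup_measurable => n _; exact: mp.
have s0 (S T : ptopologicalType) (m : {measure set (borel S) -> \bar R})
    (n : {measure set (borel T) -> \bar R}) : slice_int m n set0 = 0.
  rewrite /slice_int; apply: integral0_eq => x _.
  by rewrite (_ : slice set0 x = set0) ?measure0.
pose M1 : {measure set (borel (X * Y)%type) -> \bar R} :=
  HB.pack (slice_int mu nu) (isMeasure.Build _ _ _ (slice_int mu nu)
    (s0 _ _ mu nu) (fun E => integral_ge0 _ (fun x _ => measure_ge0 _ _)) H1).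
pose M2 : {measure set (borel (X * Y)%type) -> \bar R} :=
  HB.pack (fun E : set (borel (X * Y)%type) => slice_int nu mu (pswap @^-1` E))
   (isMeasure.Build _ _ _
    (fun E : set (borel (X * Y)%type) => slice_int nu mu (pswap @^-1` E))
    (s0 _ _ nu mu) (fun E => integral_ge0 _ (fun x _ => measure_ge0 _ _)) H2).
have [A [oA ndA cA fA]] := open_radon_exhaustion muR.
have [B [oB ndB cB fB]] := open_radon_exhaustion nuR.
have oAB n : open (A n `*` B n).
  apply: openI; apply: open_comp => // z _; [exact: cvg_fst|exact: cvg_snd].
move=> mE; suff : M1 E = M2 E by [].
apply: (@measure_unique _ _ (borel (X * Y)%type) (@open (X * Y)%type)
  (fun n => A n `*` B n)) => //.
- exact: openI.
- rewrite -subTset => -[x y] _.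
  have [m _ Am] : (\bigcup_n A n) x by rewrite cA.
  have [n _ Bn] : (\bigcup_n B n) y by rewrite cB.
  exists (maxn m n) => //; split => /=.
    by apply: ndA Am; rewrite leq_maxl.
  by apply: ndB Bn; rewrite leq_maxr.
- by move=> F oF; exact: open_tonelli.
- move=> n; rewrite /M1 /= /slice_int.
  rewrite (_ : (fun x => _) = fun x => nu (B n) * (\1_(A n) x)%:E); last first.
    apply/funext => x; rewrite indicE; have [Ax|Ax] := boolP (x \in A n).
      rewrite mule1; congr (nu _); apply/seteqP; split=> [y []//|y By].
      by split=> //; rewrite inE in Ax.
    rewrite mule0 (_ : slice _ _ = set0) ?measure0//.
    by apply/seteqP; split=> // y []; rewrite notin_setE in Ax.
  have mA : measurable (A n : set (borel X)) by exact: open_borel.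
  rewrite ge0_integralZl//; last exact/measurable_EFinP/measurable_indic.
  by rewrite integral_indic// setIT lte_mul_pinfty// ge0_fin_numE.
Qed.

Theorem borel_tonelli (f : borel (X * Y)%type -> \bar R) :
  measurable_fun setT f -> (forall z, 0 <= f z) ->
  \int[mu]_x \int[nu]_y f (x, y) = \int[nu]_y \int[mu]_x f (x, y).
Proof.
have mswap (g : borel (X * Y)%type -> \bar R) : measurable_fun setT g ->
    measurable_fun setT ((fun z => g (pswap z)) : borel (Y * X)%type -> \bar R).
  by move=> mg; exact: (borel_comp (@continuous_pswap Y X)).
have mI (g : borel (X * Y)%type -> \bar R) : measurable_fun setT g ->
    (forall z, 0 <= g z) ->
    measurable_fun setT ((fun y => \int[mu]_x g (x, y)) : borel Y -> \bar R).
  by move=> mg g0; exact: (slice_integral_measurable muR (mswap _ mg)).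
have mS (g : borel (X * Y)%type -> \bar R) y : measurable_fun setT g ->
    measurable_fun setT ((fun x => g (x, y)) : borel X -> \bar R).
  by move=> mg; exact: (slice_fun_measurable y (mswap _ mg)).
have iX (g : borel (X * Y)%type -> \bar R) : (forall z, 0 <= g z) ->
    forall x : borel X, [set: borel X] x -> 0 <= \int[nu]_y g (x, y).
  by move=> g0 x _; exact: integral_ge0.
have iY (g : borel (X * Y)%type -> \bar R) : (forall z, 0 <= g z) ->
    forall y : borel Y, [set: borel Y] y -> 0 <= \int[mu]_x g (x, y).
  by move=> g0 y _; exact: integral_ge0.
move: f; apply: ge0_measurable_ind => [A mA|f g mf mg f0 g0 Pf Pg
  |k f k0 mf f0 Pf|f u mu' u0 ndu Pu cu].
- transitivity (slice_int mu nu A).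
    apply: eq_integral => x _.
    rewrite (_ : (fun y => _) = (fun y => (\1_(slice A x) y)%:E)).
      by rewrite integral_indic// ?setIT//; exact: slice_borel.
    by apply/funext => y; rewrite !indicE.
  rewrite slice_int_swap//; apply: eq_integral => y _.
  rewrite (_ : (fun x => _) = (fun x => (\1_(slice (pswap @^-1` A) y) x)%:E)).
    rewrite integral_indic// ?setIT//; apply: slice_borel.
    exact: (borel_preimage (@continuous_pswap Y X) mA).
  by apply/funext => x; rewrite !indicE.
- transitivity (\int[mu]_x (\int[nu]_y f (x, y) + \int[nu]_y g (x, y))).
    apply: eq_integral => x _.
    by rewrite ge0_integralD//; exact: slice_fun_measurable.
  have sI := slice_integral_measurable nuR.
  rewrite (ge0_integralD mu measurableT (iX _ f0) (sI _ _ mf f0) (iX _ g0) (sI _ _ mg g0)).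
  rewrite Pf Pg -(ge0_integralD nu measurableT (iY _ f0) (mI _ mf f0) (iY _ g0) (mI _ mg g0)).
  by apply: eq_integral => y _; rewrite ge0_integralD//; exact: mS.
- transitivity (\int[mu]_x (k%:E * \int[nu]_y f (x, y))).
    apply: eq_integral => x _.
    by rewrite ge0_integralZl//; exact: slice_fun_measurable.
  rewrite (ge0_integralZl mu measurableT (slice_integral_measurable nuR mf f0) (iX _ f0))//.
  rewrite Pf -(ge0_integralZl nu measurableT (mI _ mf f0) (iY _ f0))//.
  by apply: eq_integral => y _; rewrite ge0_integralZl//; exact: mS.
- have flim z : f z = limn (fun n => u n z) by apply/esym/cvg_lim => //; exact: cu.
  have -> : \int[mu]_x \int[nu]_y f (x, y) =
      limn (fun n => \int[mu]_x \int[nu]_y u n (x, y)).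
    rewrite -monotone_convergence//.
    + apply: eq_integral => x _; rewrite -monotone_convergence//.
      * by apply: eq_integral => y _; rewrite flim.
      * by move=> n; exact: slice_fun_measurable.
      * by move=> y _ m n mn; exact: ndu.
    + by move=> n; exact: slice_integral_measurable.
    + by move=> n x _; exact: integral_ge0.
    + move=> x _ m n mn; apply: ge0_le_integral => //; try exact: slice_fun_measurable.
      by move=> y _; exact: ndu.
  have -> : \int[nu]_y \int[mu]_x f (x, y) =
      limn (fun n => \int[nu]_y \int[mu]_x u n (x, y)).
    rewrite -monotone_convergence//.
    + apply: eq_integral => y _; rewrite -monotone_convergence//.
      * by apply: eq_integral => x _; rewrite flim.
      * by move=> n; exact: mS.
      * by move=> x _ m n mn; exact: ndu.
    + by move=> n; exact: mI.
    + by move=> n y _; exact: integral_ge0.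
    + move=> y _ m n mn; apply: ge0_le_integral => //; try exact: mS.
      by move=> x _; exact: ndu.
  by congr (limn _); apply/funext => n; exact: Pu.
Qed.

End Tonelli.

(** * Generating neighborhoods and Haar measure *)

Section TopGroup.
Context {G : topGroupType}.

Lemma continuous_mulg (X : topologicalType) (f g : X -> G) :
  continuous f -> continuous g -> continuous (fun x => f x * g x)%g.
Proof.
move=> cf cg x; apply: (@continuous_comp _ _ _ (fun x => (f x, g x))
  (fun z : G * G => (z.1 * z.2)%g)); last exact: mulg_continuous.
by apply: cvg_pair; [exact: cf|exact: cg].
Qed.

Lemma continuous_invg (X : topologicalType) (f : X -> G) :
  continuous f -> continuous (fun x => (f x)^-1)%g.
Proof.
move=> cf x; apply: (@continuous_comp _ _ _ f (fun z : G => z^-1%g)).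
  exact: cf.
exact: invg_continuous.
Qed.

Lemma continuous_mulgl (a : G) : continuous (fun x : G => (a * x)%g).
Proof. by apply: continuous_mulg => x; [exact: cvg_cst|exact: cvg_id]. Qed.

Lemma continuous_mulgr (a : G) : continuous (fun x : G => (x * a)%g).
Proof. by apply: continuous_mulg => x; [exact: cvg_id|exact: cvg_cst]. Qed.

Lemma nbhs_mulgl (a x : G) (N : set G) :
  nbhs (a * x)%g N -> nbhs x [set y | N (a * y)%g].
Proof. exact: continuous_mulgl. Qed.

Lemma nbhs_mulg (x y : G) (N : set G) : nbhs (x * y)%g N ->
  exists A B : set G, [/\ nbhs x A, nbhs y B &
    forall a b, A a -> B b -> N (a * b)%g].
Proof.
move=> /(@mulg_continuous G (x, y))[[A B] /= [Ax By] AB].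
by exists A, B; split=> // a b Aa Bb; exact: (AB (a, b)).
Qed.

Lemma open_mulgl (a : G) (A : set G) : open A -> open [set (a * x)%g | x in A].
Proof.
move=> oA; rewrite (_ : [set _ | _ in _] = (fun x => (a^-1 * x)%g) @^-1` A).
  by apply: open_comp => // x _; exact: continuous_mulgl.
apply/seteqP; split => [_ [x Ax <-]|x Ax] /=; first by rewrite mulKg.
by exists (a^-1 * x)%g => //; rewrite mulVKg.
Qed.

Section Powers.
Variable A : set G.

Lemma setpowD m n x y :
  setpow A m x -> setpow A n y -> setpow A (m + n) (x * y)%g.
Proof.
elim: m x => [x /= ->|m ih x /=]; first by rewrite mul1g.
move=> [[a z] /= [Aa zm] <-] ny; rewrite -mulgA.
by exists (a, z * y)%g => //; split => //=; exact: ih.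
Qed.

Lemma setpow1 x : A x -> setpow A 1 x.
Proof. by move=> Ax; exists (x, 1%g) => //=; rewrite mulg1. Qed.

Lemma setpowV n x : symmetric_set A -> setpow A n x -> setpow A n x^-1%g.
Proof.
move=> sA; elim: n x => [x /= ->|n ih x /= [[a z] /= [Aa zn] <-]].
  by rewrite invg1.
rewrite invgM; have /setpow1 : A a^-1%g by rewrite -sA; exists a.
by move=> /(setpowD (ih _ zn)); rewrite addn1.
Qed.

Lemma setpow_sub m n : A 1%g -> (m <= n)%N -> setpow A m `<=` setpow A n.
Proof.
move=> A1 /subnK <- x xm; rewrite -(mul1g x); apply: setpowD xm.
elim: (n - m)%N => [//|k ih] /=; exists (1, 1)%g => //=; exact: mulg1.
Qed.

Lemma open_setpow n : open A -> (0 < n)%N -> open (setpow A n).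
Proof.
move=> oA; case: n => // n _ /=.
rewrite (_ : [set _ | _ in _] =
    \bigcup_(y in setpow A n) (fun x => (x * y^-1)%g) @^-1` A).
  apply: bigcup_open => y _.
  by apply: open_comp => // x _; exact: continuous_mulgr.
apply/seteqP; split => [_ [[a y] /= [Aa yn] <-]|x [y yn /= Axy]].
  by exists y => //=; rewrite mulgK.
by exists (x * y^-1, y)%g => //=; rewrite mulgVK.
Qed.

Lemma setpow_cover : A 1%g -> symmetric_set A -> generates A ->
  forall x, exists n, setpow A n x.
Proof.
move=> A1 sA gA x; have : generated A x by rewrite gA.
move=> /(_ [set y | exists n, setpow A n y]); apply; split; last first.
  by move=> y Ay; exists 1%N; exact: setpow1.
split; first by exists 0%N.
move=> y z [m ym] [n zn]; exists (m + n)%N.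
by apply: setpowD => //; exact: setpowV.
Qed.

End Powers.

Section GeneratingNbhd.
Variable U : set G.
Hypothesis U_gen : generating_nbhd U.

Lemma generating_nbhd1 : U 1%g.
Proof. by have [_ /nbhs_singleton] := U_gen. Qed.

Lemma generating_nbhdV x : U x -> U x^-1%g.
Proof. by have [_ _ sU _] := U_gen; move=> Ux; rewrite -sU; exists x. Qed.

Lemma generating_nbhd_cover x : exists n, setpow U n x.
Proof.
have [_ _ sU gU] := U_gen; exact: (setpow_cover generating_nbhd1 sU gU).
Qed.

Lemma setpow_ge1 n x : setpow U n x -> setpow U n.+1 x.
Proof. exact: (setpow_sub generating_nbhd1). Qed.

Lemma compact_setpow (C : set G) : open U -> compact C ->
  exists2 n, (0 < n)%N & C `<=` setpow U n.
Proof.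
move=> oU cC; have U1 := generating_nbhd1.
apply: (compact_local (P := fun C => exists2 n, (0 < n)%N & C `<=` setpow U n)
  cC).
- by exists 1%N.
- move=> A B [m m0 Am] [n n0 Bn]; exists (maxn m n); first by rewrite leq_max m0.
  move=> x [/Am|/Bn]; apply: setpow_sub => //; [exact: leq_maxl|exact: leq_maxr].
- by move=> A B AB [n n0 Bn]; exists n => //; exact: subset_trans Bn.
- move=> x _; have [n xn] := generating_nbhd_cover x.
  exists (setpow U n.+1); last by exists n.+1.
  apply: open_nbhs_nbhs; split; first exact: open_setpow.
  exact: setpow_ge1.
Qed.

End GeneratingNbhd.

End TopGroup.

Lemma compact_setmulg (G : topGroupType) (A B : set G) :
  compact A -> compact B -> compact [set (x.1 * x.2)%g | x in A `*` B].
Proof.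
move=> cA cB; apply: continuous_compact; last exact: compact_setX.
by apply: continuous_subspaceT => z; exact: mulg_continuous.
Qed.

Lemma compact_image (X Y : topologicalType) (f : X -> Y) (C : set X) :
  continuous f -> compact C -> compact (f @` C).
Proof. by move=> cf; apply: continuous_compact; exact: continuous_subspaceT. Qed.

Section Haar.
Context {R : realType} {G : topGroupType}.
Variable mu : {measure set (borel G) -> \bar R}.
Hypothesis hG : hausdorff_space G.
Hypothesis mu_haar : left_haar mu.
Local Open Scope ereal_scope.

Lemma compact_haar_lty (C : set G) : compact C -> mu C < +oo.
Proof. exact: haar_compact. Qed.

Lemma precompact_haar_lty (A : set (borel G)) : measurable A ->
  precompact (A : set G) -> mu A < +oo.
Proof.
move=> mA; rewrite precompactE => cA.
apply: le_lt_trans (compact_haar_lty cA); apply: le_measure; rewrite ?inE//.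
  exact: compact_borel.
exact: subset_closure.
Qed.

Lemma precompact_setpow (A : set G) n : precompact A -> precompact (setpow A n).
Proof.
rewrite precompactE => cA.
have cn : compact (setpow (closure A) n).
  by elim: n => [|n ih] /=; [exact: compact_set1|exact: compact_setmulg].
have : setpow A n `<=` setpow (closure A) n.
  elim: n {cn} => [//|n ih] /= _ [[a y] /= [Aa yn] <-].
  by exists (a, y) => //; split => //=; [exact: subset_closure|exact: ih].
move=> /precompact_subset; apply; rewrite precompact_closed//.
exact: compact_closed.
Qed.

(** The exhaustion consists of the powers of [U], starting at exponent 1 because the power 0 is a
    single point. *)
Lemma haar_open_radon (U : set G) : open U -> generating_nbhd U -> open_radon mu.
Proof.
move=> oU U_gen; split=> //; first exact: haar_inner.
have oUn n : open (setpow U n.+1) by exact: open_setpow.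
exists (fun n => setpow U n.+1); split => //.
- by move=> m n mn; apply: setpow_sub => //; exact: generating_nbhd1.
- rewrite -subTset => x _; have [n xn] := generating_nbhd_cover U_gen x.
  by exists n => //; exact: setpow_ge1.
- move=> n; apply: precompact_haar_lty; first exact: open_borel.
  by apply: precompact_setpow; have [] := U_gen.
Qed.

(** If [V] were null, each compact set would be covered by finitely many null translates of [V], and
    inner regularity would make the whole group null. *)
Lemma haar_open_gt0 (V : set G) x : open V -> V x -> 0 < mu V.
Proof.
move=> oV Vx; rewrite lt0e measure_ge0 andbT; apply/eqP => V0.
have tV g : mu [set (g * a)%g | a in V] = 0.
  by rewrite (haar_invariant mu_haar)//; exact: open_borel.
have C0 (C : set G) : compact C -> mu C = 0.
  move=> cC.
  suff [S [oS S0 CS]] : exists S, [/\ open S, mu S = 0 & C `<=` S].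
    apply: (subset_measure0 _ _ _ S0) => //; last exact: open_borel.
    exact: compact_borel.
  apply: (compact_local
    (P := fun C => exists S, [/\ open S, mu S = 0 & C `<=` S]) cC).
  - by exists set0; split=> //; exact: open0.
  - move=> A B [S [oS S0 AS]] [T [oT T0 BT]]; exists (S `|` T).
    split; [exact: openU| |exact: setUSS].
    have mS : measurable (S : set (borel G)) by exact: open_borel.
    have mT : measurable (T : set (borel G)) by exact: open_borel.
    apply/eqP; rewrite eq_le measure_ge0 andbT -S0 -[leRHS]adde0 -T0.
    exact: (measureU2 mu mS mT).
  - move=> A B AB [S [oS S0 BS]]; exists S; split=> //.
    exact: subset_trans BS.
  - move=> y _; exists [set (y * x^-1 * a)%g | a in V].
      apply: open_nbhs_nbhs; split; first exact: open_mulgl.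
      by exists x => //; rewrite mulgVK.
    exists [set (y * x^-1 * a)%g | a in V]; split=> //; exact: open_mulgl.
move: (haar_neq0 mu_haar) => /negP; apply; apply/eqP.
rewrite (haar_inner mu_haar openT); apply/eqP; rewrite eq_le; apply/andP; split.
  by apply: ge_ereal_sup => _ [C [cC _] <-]; rewrite C0.
apply: ereal_sup_ubound; exists set0; last by rewrite measure0.
by split=> //; exact: compact0.
Qed.

Lemma haar_translate (g : G) (f : borel G -> \bar R) :
  measurable_fun setT f -> (forall x, 0 <= f x) ->
  \int[mu]_x f (g * x)%g = \int[mu]_x f x.
Proof.
move=> mf f0.
have mphi := continuous_borel (@continuous_mulgl G g).
have := @ge0_integral_pushforward _ _ (borel G) (borel G) R _ mphi mu setT f
  measurableT mf (fun x _ => f0 x).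
rewrite preimage_setT => <-.
apply: eq_measure_integral => A mA _; rewrite /pushforward.
rewrite -(haar_invariant mu_haar g^-1%g mA); congr (mu _).
apply/seteqP; split => [x Ax|_ [x Ax <-]] /=; last by rewrite mulVKg.
by exists (g * x)%g => //; rewrite mulKg.
Qed.

Lemma haar_inverse (Delta : G -> R) (f : borel G -> \bar R) :
  modular_function mu Delta ->
  measurable_fun setT f -> (forall x, 0 <= f x) ->
  \int[mu]_x f (x^-1)%g = \int[mu]_x (f x * (Delta x^-1%g)%:E).
Proof.
move=> D.
have cV : continuous (fun x : G => x^-1%g) by exact: invg_continuous.
have D0 x : 0 <= (Delta x)%:E by rewrite lee_fin ltW// (modular_gt0 D).
have mD : measurable_fun setT ((fun x => (Delta x^-1%g)%:E) : borel G -> \bar R).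
  apply/measurable_EFinP.
  apply: (continuous_borelR (f := fun x => Delta x^-1%g)) => x.
  apply: (@continuous_comp _ _ _ (fun x : G => x^-1%g) Delta).
    exact: cV.
  exact: (modular_continuous D).
have mV (h : borel G -> \bar R) : measurable_fun setT h ->
    measurable_fun setT ((fun x => h x^-1%g) : borel G -> \bar R).
  by move=> mh; exact: (borel_comp cV mh).
have mM (h : borel G -> \bar R) : measurable_fun setT h ->
    measurable_fun setT ((fun x => h x * (Delta x^-1%g)%:E) : borel G -> \bar R).
  by move=> mh; exact: emeasurable_funM.
move: f; apply: ge0_measurable_ind => [A mA|f g mf mg f0 g0 Pf Pg|k f k0 mf f0 Pf
  |f u mu' u0 ndu Pu cu].
- transitivity (mu [set a^-1%g | a in A]).
    rewrite (_ : (fun x => _) = (fun x => (\1_[set a^-1%g | a in A] x)%:E)).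
      rewrite integral_indic//= ?setIT//.
      rewrite (_ : [set _ | _ in _] = (fun x : G => x^-1%g) @^-1` A).
        exact: (borel_preimage cV mA).
      apply/seteqP; split => [_ [a Aa <-]|x Ax] /=; first by rewrite invgK.
      by exists x^-1%g => //; rewrite invgK.
    apply/funext => x; rewrite !indicE; congr ((nat_of_bool _)%:R%:E).
    apply/idP/idP; rewrite !inE; last by move=> [a Aa <-]; rewrite invgK.
    by move=> Ax; exists x^-1%g => //; rewrite invgK.
  rewrite (modular_inv D mA) integral_mkcond; apply: eq_integral => x _.
  by rewrite patchE indicE; case: ifPn => _; rewrite ?mul1e ?mul0e.
- rewrite ge0_integralD//; try exact: mV.
  rewrite Pf Pg -ge0_integralD//; try exact: mM;
    try by move=> x _; rewrite mule_ge0.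
  by apply: eq_integral => x _; rewrite ge0_muleDl.
- rewrite ge0_integralZl//; try exact: mV.
  rewrite Pf -ge0_integralZl//; try exact: mM;
    try by move=> x _; rewrite mule_ge0.
  by apply: eq_integral => x _; rewrite muleA.
- have flim z : f z = limn (fun n => u n z) by apply/esym/cvg_lim => //; exact: cu.
  transitivity (limn (fun n => \int[mu]_x u n x^-1%g)).
    rewrite -monotone_convergence//.
    + by apply: eq_integral => y _; rewrite flim.
    + by move=> n; exact: mV.
    + by move=> y _ m n mn; exact: ndu.
  transitivity (limn (fun n => \int[mu]_x (u n x * (Delta x^-1%g)%:E))).
    by congr (limn _); apply/funext => n.
  rewrite -monotone_convergence//.
  + apply: eq_integral => x _; apply/cvg_lim => //.
    apply: cvgeMr => //; exact: cu.
  + by move=> n; exact: mM.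
  + by move=> n x _; rewrite mule_ge0.
  + by move=> x _ m n mn; rewrite lee_wpmul2r//; exact: ndu.
Qed.

End Haar.

(** * Locally bounded functions and integrals of compactly supported functions *)

Section LocallyBounded.
Context {R : realType}.
Implicit Types X Y : ptopologicalType.

(** Local boundedness is expressed on compact sets, the form that passes through composition with a
    continuous map. *)
Definition lbm X (f : X -> R) :=
  measurable_fun setT (f : borel X -> measurableTypeR R) /\
  forall C, compact C -> exists M, forall x, C x -> `|f x| <= M.

(** Bounded Borel functions vanishing off a compact set. They are integrable and stay in the class
    after multiplication by an [lbm] weight such as e^(lam psi), translation, convolution integrands
    and partial integration, so that their real integrals can be computed freely. *)
Definition bcs X (f : X -> R) :=
  lbm f /\ exists2 C : set X, compact C & forall x, ~ C x -> f x = 0.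

Lemma lbm_cst X (k : R) : lbm (fun _ : X => k).
Proof. by split=> [|C _]; [exact: measurable_cst|exists `|k|]. Qed.

Lemma lbmD X (f g : X -> R) : lbm f -> lbm g -> lbm (fun x => f x + g x).
Proof.
move=> [mf bf] [mg bg]; split; first exact: (measurable_funD mf mg).
move=> C cC; have [M fM] := bf _ cC; have [N gN] := bg _ cC; exists (M + N).
move=> x Cx; apply: le_trans (ler_normD _ _) _.
by apply: lerD; [exact: fM|exact: gN].
Qed.

Lemma lbmM X (f g : X -> R) : lbm f -> lbm g -> lbm (fun x => f x * g x).
Proof.
move=> [mf bf] [mg bg]; split; first exact: (measurable_funM mf mg).
move=> C cC; have [M fM] := bf _ cC; have [N gN] := bg _ cC; exists (M * N).
by move=> x Cx; rewrite normrM ler_pM//; [exact: fM|exact: gN].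
Qed.

Lemma lbmN X (f : X -> R) : lbm f -> lbm (fun x => - f x).
Proof.
move=> lf; rewrite (_ : (fun x => _) = (fun x => -1 * f x)).
  by apply: lbmM => //; exact: lbm_cst.
by apply/funext => x; rewrite mulN1r.
Qed.

Lemma lbmB X (f g : X -> R) : lbm f -> lbm g -> lbm (fun x => f x - g x).
Proof. by move=> lf lg; apply: lbmD => //; exact: lbmN. Qed.

Lemma lbmX X (f : X -> R) n : lbm f -> lbm (fun x => f x ^+ n).
Proof.
move=> lf; elim: n => [|n ih].
  by rewrite (_ : (fun x => _) = (fun=> 1))//; exact: lbm_cst.
rewrite (_ : (fun x => _) = (fun x => f x * f x ^+ n)).
  exact: lbmM.
by apply/funext => x; rewrite exprS.
Qed.

Lemma lbm_expR X (f : X -> R) : lbm f -> lbm (fun x => expR (f x)).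
Proof.
move=> [mf bf]; split; first exact: (measurableT_comp (@measurable_expR R) mf).
move=> C cC; have [M fM] := bf _ cC; exists (expR M) => x Cx.
rewrite ger0_norm ?expR_ge0// ler_expR; apply: le_trans (fM _ Cx).
exact: ler_norm.
Qed.

Lemma lbm_max0 X (f : X -> R) : lbm f -> lbm (fun x => Num.max (f x) 0).
Proof.
move=> [mf bf]; split.
  apply: (measurable_maxr mf); exact: measurable_cst.
move=> C cC; have [M fM] := bf _ cC; exists M => x Cx.
have := fM _ Cx; case: (leP (f x) 0) => // _; rewrite normr0.
by apply: le_trans.
Qed.

Lemma lbm_comp X Y (c : X -> Y) (f : Y -> R) : continuous c -> lbm f ->
  lbm (fun x => f (c x)).
Proof.
move=> cc [mf bf]; split; first exact: (borel_comp cc mf).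
move=> C cC; have [M fM] := bf _ (compact_image cc cC); exists M => x Cx.
by apply: fM; exists x.
Qed.

Lemma lbm_continuous X (f : X -> R) : continuous f -> lbm f.
Proof.
move=> cf; split; first exact: continuous_borelR.
move=> C cC.
apply: (compact_local
  (P := fun C => exists M, forall x, C x -> `|f x| <= M) cC).
- by exists 0.
- move=> A B [M AM] [N BN]; exists (Num.max M N) => x [/AM|/BN];
    by rewrite le_max => ->; rewrite ?orbT.
- by move=> A B AB [M BM]; exists M => x /AB /BM.
- move=> x _; exists (f @^-1` (ball (f x) 1)).
    by apply: cf; exact: nbhsx_ballx.
  exists (1 + `|f x|) => y /= fxy.
  rewrite -[f y](subrK (f x)); apply: le_trans (ler_normD _ _) _.
  by rewrite lerD2r distrC ltW.
Qed.

Lemma bcs_lbm X (f : X -> R) : bcs f -> lbm f. Proof. by case. Qed.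

Lemma bcsMl X (f g : X -> R) : lbm f -> bcs g -> bcs (fun x => f x * g x).
Proof.
move=> lf [lg [C cC g0]]; split; first exact: lbmM.
by exists C => // x nCx; rewrite g0// mulr0.
Qed.

Lemma bcsMr X (f g : X -> R) : bcs f -> lbm g -> bcs (fun x => f x * g x).
Proof.
move=> bf lg; under eq_fun do rewrite mulrC; exact: bcsMl.
Qed.

Lemma bcsD X (f g : X -> R) : bcs f -> bcs g -> bcs (fun x => f x + g x).
Proof.
move=> [lf [C cC f0]] [lg [D cD g0]]; split; first exact: lbmD.
exists (C `|` D); first exact: compactU.
by move=> x nx; rewrite f0 ?g0 ?addr0// => ?; apply: nx; [right|left].
Qed.

Lemma bcsN X (f : X -> R) : bcs f -> bcs (fun x => - f x).
Proof.
move=> [lf [C cC f0]]; split; first exact: lbmN.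
by exists C => // x /f0 ->; rewrite oppr0.
Qed.

Lemma bcsB X (f g : X -> R) : bcs f -> bcs g -> bcs (fun x => f x - g x).
Proof. by move=> bf bg; apply: bcsD => //; exact: bcsN. Qed.

Lemma bcsZ X (k : R) (f : X -> R) : bcs f -> bcs (fun x => k * f x).
Proof. by move=> bf; apply: bcsMl => //; exact: lbm_cst. Qed.

Lemma bcsX X (f : X -> R) n : bcs f -> bcs (fun x => f x ^+ n.+1).
Proof.
move=> [lf [C cC f0]]; split; first exact: lbmX.
by exists C => // x /f0 ->; rewrite expr0n.
Qed.

Lemma bcs_max0 X (f : X -> R) : bcs f -> bcs (fun x => Num.max (f x) 0).
Proof.
move=> [lf [C cC f0]]; split; first exact: lbm_max0.
by exists C => // x /f0 ->; rewrite maxxx.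
Qed.

Lemma bcs_norm X (f : X -> R) : bcs f -> bcs (fun x => `|f x|).
Proof.
move=> bf.
rewrite (_ : (fun x => _) = (fun x => Num.max (f x) 0 + Num.max (- f x) 0)).
  by apply: bcsD; apply: bcs_max0 => //; exact: bcsN.
apply/funext => x; have [f0|f0] := leP 0 (f x).
  by rewrite ger0_norm// [Num.max (- _) _]max_r ?oppr_le0// addr0.
by rewrite ltr0_norm// [Num.max (- _) _]max_l ?oppr_ge0 ?ltW// add0r.
Qed.

Lemma bcs_bounded X (f : X -> R) : bcs f ->
  exists2 M, 0 <= M & forall x, `|f x| <= M.
Proof.
move=> [[_ bf] [C cC f0]]; have [M fM] := bf _ cC.
exists `|M| => // x; have [Cx|nCx] := pselect (C x).
  by apply: le_trans (fM _ Cx) _; exact: ler_norm.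
by rewrite f0// normr0.
Qed.

Lemma posneg_partE (a : R) : a = Num.max a 0 - Num.max (- a) 0.
Proof.
have [f0|f0] := leP 0 a.
  by rewrite max_r ?oppr_le0// subr0.
by rewrite max_l ?oppr_ge0 ?ltW// sub0r opprK.
Qed.

End LocallyBounded.

Section Integral.
Context {R : realType} {Y : ptopologicalType}.
Variable nu : {measure set (borel Y) -> \bar R}.
Hypothesis hY : hausdorff_space Y.
Hypothesis nu_compact : forall C : set Y, compact C -> (nu C < +oo)%E.

Lemma bcs_integrable (f : Y -> R) : bcs f -> nu.-integrable setT (EFin \o f).
Proof.
move=> bf; have [M M0 fM] := bcs_bounded bf.
have [[mf _] [C cC f0]] := bf.
have mC : measurable (C : set (borel Y)) by exact: compact_borel.
apply/integrableP; split; first exact/measurable_EFinP.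
apply: (@le_lt_trans _ _ (\int[nu]_x (M%:E * (\1_C x)%:E)))%E.
  apply: ge0_le_integral => //.
  - by apply: measurableT_comp => //; exact/measurable_EFinP.
  - by apply: measurable_funeM; exact/measurable_EFinP/measurable_indic.
  - move=> x _ /=; rewrite -EFinM lee_fin indicE.
    have [Cx|Cx] := boolP (x \in C); first by rewrite mulr1.
    by rewrite f0 ?normr0 ?mulr0//; rewrite notin_setE in Cx.
rewrite ge0_integralZl//; last exact/measurable_EFinP/measurable_indic.
rewrite integral_indic// setIT lte_mul_pinfty//.
exact: nu_compact.
Qed.

Lemma bcs_intEFin (f : Y -> R) : bcs f ->
  ((\int[nu]_x f x)%:E = \int[nu]_x (f x)%:E)%E.
Proof.
move=> bf; rewrite /Rintegral fineK//.
exact: (integrable_fin_num measurableT (bcs_integrable bf)).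
Qed.

Lemma bcs_intD (f g : Y -> R) : bcs f -> bcs g ->
  \int[nu]_x (f x + g x) = \int[nu]_x f x + \int[nu]_x g x.
Proof. by move=> bf bg; apply: RintegralD => //; exact: bcs_integrable. Qed.

Lemma bcs_intB (f g : Y -> R) : bcs f -> bcs g ->
  \int[nu]_x (f x - g x) = \int[nu]_x f x - \int[nu]_x g x.
Proof. by move=> bf bg; apply: RintegralB => //; exact: bcs_integrable. Qed.

Lemma bcs_intZ (k : R) (f : Y -> R) : bcs f ->
  \int[nu]_x (k * f x) = k * \int[nu]_x f x.
Proof. by move=> bf; apply: RintegralZl => //; exact: bcs_integrable. Qed.

Lemma bcs_le_int (f g : Y -> R) : bcs f -> bcs g -> (forall x, f x <= g x) ->
  \int[nu]_x f x <= \int[nu]_x g x.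
Proof. by move=> bf bg fg; apply: le_Rintegral => //; exact: bcs_integrable. Qed.

(** Needed because functions of class E satisfy their Lipschitz inequality only off a null set. The
    negative part of [g - f] vanishes almost everywhere. *)
Lemma bcs_ae_le_int (f g : Y -> R) : bcs f -> bcs g ->
  {ae nu, forall x : borel Y, f x <= g x} -> \int[nu]_x f x <= \int[nu]_x g x.
Proof.
move=> bf bg fg; rewrite -subr_ge0 -bcs_intB//.
have bh : bcs (fun x => g x - f x) by exact: bcsB.
have bp := bcs_max0 bh; have bm := bcs_max0 (bcsN bh).
have mm : measurable_fun setT
    ((fun x => (Num.max (- (g x - f x)) 0)%:E) : borel Y -> \bar R).
  by apply/measurable_EFinP; have [[]] := bm.
have m0 : \int[nu]_x Num.max (- (g x - f x)) 0 = 0.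
  rewrite /Rintegral (_ : (\int[nu]_x _)%E = 0%E)//.
  have := @ae_eq_integral _ (borel Y) R nu setT (cst 0%E) _ measurableT mm
    (@measurable_cst _ _ _ _ _ _).
  rewrite integral0; apply; apply: filterS fg => x fgx _ /=.
  by rewrite max_r// oppr_le0 subr_ge0.
rewrite (_ : (fun x => g x - f x) =
    (fun x => Num.max (g x - f x) 0 - Num.max (- (g x - f x)) 0)); last first.
  by apply/funext => x; exact: posneg_partE.
rewrite bcs_intB// m0 subr0; apply: Rintegral_ge0 => x _.
by rewrite le_max lexx orbT.
Qed.

Lemma le_norm_bcs_int (f g : Y -> R) : bcs f -> bcs g ->
  (forall x, `|f x| <= g x) -> `|\int[nu]_x f x| <= \int[nu]_x g x.
Proof.
move=> bf bg fg.
apply: le_trans (bcs_le_int (bcs_norm bf) bg fg).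
by apply: le_normr_Rintegral => //; exact: bcs_integrable.
Qed.

End Integral.

(** * Iterated integrals and translation for bounded functions of compact support *)

Section ProductCalculus.
Context {R : realType}.
Implicit Types X Y : ptopologicalType.

Lemma bcs_slicel X Y (F : X * Y -> R) x : bcs F -> bcs (fun y => F (x, y)).
Proof.
move=> [lF [C cC F0]]; split; first exact: (lbm_comp (@continuous_pair X Y x)).
exists (snd @` C); first by apply: compact_image => // z; exact: cvg_snd.
by move=> y nCy; apply: F0 => Cxy; apply: nCy; exists (x, y).
Qed.

Lemma bcs_pswap X Y (F : X * Y -> R) : bcs F -> bcs (fun z => F (pswap z)).
Proof.
move=> [lF [C cC F0]]; split; first exact: (lbm_comp (@continuous_pswap Y X)).
exists (pswap @` C); first by apply: compact_image => //; exact: continuous_pswap.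
by move=> z nCz; apply: F0 => Cz; apply: nCz; exists (pswap z) => //; case: (z).
Qed.

Lemma bcs_slicer X Y (F : X * Y -> R) y : bcs F -> bcs (fun x => F (x, y)).
Proof. by move=> /bcs_pswap /(bcs_slicel y). Qed.

Section Partial.
Context {X Y : ptopologicalType}.
Variable nu : {measure set (borel Y) -> \bar R}.
Hypothesis nuR : open_radon nu.
Hypothesis nu_compact : forall C : set Y, compact C -> (nu C < +oo)%E.
Let hY := open_radon_hausdorff nuR.

Lemma partial_int_measurable (F : X * Y -> R) : bcs F -> (forall z, 0 <= F z) ->
  measurable_fun setT
    ((fun x => \int[nu]_y F (x, y)) : borel X -> measurableTypeR R).
Proof.
move=> bF F0; apply: measurableT_comp => //.
apply: (@slice_integral_measurable R X Y nu nuR (EFin \o F)).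
  by apply/measurable_EFinP; have [[]] := bF.
by move=> z; rewrite lee_fin.
Qed.

Lemma bcs_partial_int (F : X * Y -> R) : bcs F ->
  bcs (fun x => \int[nu]_y F (x, y)).
Proof.
move=> bF; have [M M0 FM] := bcs_bounded bF.
have bp := bcs_max0 bF; have bm := bcs_max0 (bcsN bF).
have [_ [C cC F0]] := bF; split; [split|].
- rewrite (_ : (fun x => _) = (fun x => \int[nu]_y (Num.max (F (x, y)) 0) -
      \int[nu]_y (Num.max (- F (x, y)) 0))).
    apply: measurable_funB.
      by apply: (partial_int_measurable bp) => z; rewrite le_max lexx orbT.
    by apply: (partial_int_measurable bm) => z; rewrite le_max lexx orbT.
  apply/funext => x; rewrite -bcs_intB//.
  + by apply: eq_Rintegral => y _; exact: posneg_partE.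
  + exact: (bcs_slicel x bp).
  + exact: (bcs_slicel x bm).
- move=> D _; pose C2 := snd @` C.
  have cC2 : compact C2 by apply: compact_image => // z; exact: cvg_snd.
  have mC2 : measurable (C2 : set (borel Y)) by exact: compact_borel.
  have b1 : bcs (\1_C2 : Y -> R).
    split; last by exists C2 => // y nCy; rewrite indicE memNset.
    split; first exact: measurable_indic.
    by move=> K _; exists 1 => y _; rewrite indicE; case: (_ \in _); rewrite ?normr1 ?normr0.
  exists (M * \int[nu]_y \1_C2 y) => x _; rewrite -bcs_intZ//.
  apply: le_norm_bcs_int => //; [exact: bcs_slicel|exact: bcsZ|].
  move=> y; rewrite indicE; have [Cy|nCy] := boolP (y \in C2).
    by rewrite mulr1.
  rewrite F0 ?normr0 ?mulr0// => Cxy.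
  by move: nCy; rewrite notin_setE; apply; exists (x, y).
- exists (fst @` C); first by apply: compact_image => // z; exact: cvg_fst.
  move=> x nCx; rewrite (eq_Rintegral nu (g := cst 0)).
    by rewrite /Rintegral integral0.
  by move=> y _; apply: F0 => Cxy; apply: nCx; exists (x, y).
Qed.

End Partial.

Section Fubini.
Context {X Y : ptopologicalType}.
Variable mu : {measure set (borel X) -> \bar R}.
Variable nu : {measure set (borel Y) -> \bar R}.
Hypotheses (muR : open_radon mu) (nuR : open_radon nu).
Hypothesis mu_compact : forall C : set X, compact C -> (mu C < +oo)%E.
Hypothesis nu_compact : forall C : set Y, compact C -> (nu C < +oo)%E.
Let hX := open_radon_hausdorff muR.
Let hY := open_radon_hausdorff nuR.

Lemma bcs_fubini (F : X * Y -> R) : bcs F ->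
  \int[mu]_x \int[nu]_y F (x, y) = \int[nu]_y \int[mu]_x F (x, y).
Proof.
have pos (H : X * Y -> R) : bcs H -> (forall z, 0 <= H z) ->
    \int[mu]_x \int[nu]_y H (x, y) = \int[nu]_y \int[mu]_x H (x, y).
  move=> bH H0; apply: EFin_inj.
  rewrite (bcs_intEFin hX mu_compact (bcs_partial_int nuR nu_compact bH)).
  rewrite (bcs_intEFin hY nu_compact
    (bcs_partial_int muR mu_compact (bcs_pswap bH))).
  have mH : measurable_fun setT (EFin \o H : borel (X * Y)%type -> \bar R).
    by apply/measurable_EFinP; have [[]] := bH.
  transitivity (\int[mu]_x \int[nu]_y (H (x, y))%:E)%E.
    apply: eq_integral => x _; rewrite -bcs_intEFin//; exact: bcs_slicel.
  rewrite (borel_tonelli muR nuR mH); last by move=> z; rewrite lee_fin.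
  by apply: eq_integral => y _; rewrite -bcs_intEFin//; exact: bcs_slicer.
move=> bF; have bp := bcs_max0 bF; have bm := bcs_max0 (bcsN bF).
have spl1 x : \int[nu]_y F (x, y) = \int[nu]_y (Num.max (F (x, y)) 0) -
      \int[nu]_y (Num.max (- F (x, y)) 0).
  rewrite -bcs_intB//; [|exact: (bcs_slicel x bp)|exact: (bcs_slicel x bm)].
  by apply: eq_Rintegral => y _; exact: posneg_partE.
have spl2 y : \int[mu]_x F (x, y) = \int[mu]_x (Num.max (F (x, y)) 0) -
      \int[mu]_x (Num.max (- F (x, y)) 0).
  rewrite -bcs_intB//; [|exact: (bcs_slicer y bp)|exact: (bcs_slicer y bm)].
  by apply: eq_Rintegral => x _; exact: posneg_partE.
rewrite (eq_Rintegral mu (g := fun x => \int[nu]_y (Num.max (F (x, y)) 0) -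
      \int[nu]_y (Num.max (- F (x, y)) 0))); last by move=> x _; exact: spl1.
rewrite [RHS](eq_Rintegral nu (g := fun y => \int[mu]_x (Num.max (F (x, y)) 0) -
      \int[mu]_x (Num.max (- F (x, y)) 0))); last by move=> y _; exact: spl2.
have max_ge0 (a : R) : 0 <= Num.max a 0 by rewrite le_max lexx orbT.
rewrite !bcs_intB//.
- rewrite (pos (fun z => Num.max (F z) 0))// (pos (fun z => Num.max (- F z) 0))//.
- exact: (bcs_partial_int muR mu_compact (bcs_pswap bp)).
- exact: (bcs_partial_int muR mu_compact (bcs_pswap bm)).
- exact: (bcs_partial_int nuR nu_compact bp).
- exact: (bcs_partial_int nuR nu_compact bm).
Qed.

End Fubini.
End ProductCalculus.

Section GroupCalculus.
Context {R : realType} {G : topGroupType}.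
Implicit Types f k : G -> R.

Lemma bcs_translate (a : G) f : bcs f -> bcs (fun x => f (a * x)%g).
Proof.
move=> [lf [C cC f0]]; split; first exact: (lbm_comp (@continuous_mulgl G a)).
exists [set (a^-1 * x)%g | x in C].
  by apply: compact_image => //; exact: continuous_mulgl.
move=> x nCx; apply: f0 => Cax; apply: nCx.
by exists (a * x)%g => //; rewrite mulKg.
Qed.

Lemma continuous_mulVg2 : continuous (fun z : G * G => (z.2^-1 * z.1)%g).
Proof.
apply: continuous_mulg => [|z]; last exact: cvg_fst.
by apply: continuous_invg => z; exact: cvg_snd.
Qed.

Lemma bcs_conv k f : bcs k -> bcs f ->
  bcs (fun z : G * G => k z.2 * f (z.2^-1 * z.1)%g).
Proof.
move=> [lk [C cC k0]] [lf [D cD f0]]; split.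
  apply: lbmM; last exact: (lbm_comp continuous_mulVg2).
  by apply: (@lbm_comp R (G * G)%type G snd) => // z; exact: cvg_snd.
exists ([set (x.1 * x.2)%g | x in C `*` D] `*` C).
  by apply: compact_setX => //; exact: compact_setmulg.
move=> [g h] /= nCD; have [Ch|/k0->] := pselect (C h); last by rewrite mul0r.
rewrite f0 ?mulr0// => Dhg; apply: nCD; split => //=.
by exists (h, h^-1 * g)%g => //=; rewrite mulVKg.
Qed.

Variable mu : {measure set (borel G) -> \bar R}.
Hypothesis hG : hausdorff_space G.
Hypothesis mu_haar : left_haar mu.

Lemma int_translate (a : G) f : bcs f -> \int[mu]_x f (a * x)%g = \int[mu]_x f x.
Proof.
have muC := compact_haar_lty mu_haar.
have pos h : bcs h -> (forall x, 0 <= h x) ->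
    \int[mu]_x h (a * x)%g = \int[mu]_x h x.
  move=> bh h0; apply: EFin_inj.
  rewrite !bcs_intEFin//; last exact: bcs_translate.
  apply: (haar_translate mu_haar a (f := EFin \o h)).
    by apply/measurable_EFinP; have [[]] := bh.
  by move=> x; rewrite lee_fin.
move=> bf; have bp := bcs_max0 bf; have bm := bcs_max0 (bcsN bf).
have max_ge0 (b : R) : 0 <= Num.max b 0 by rewrite le_max lexx orbT.
rewrite (eq_Rintegral mu (g := fun x =>
    Num.max (f (a * x)%g) 0 - Num.max (- f (a * x)%g) 0)); last first.
  by move=> x _; exact: posneg_partE.
rewrite [RHS](eq_Rintegral mu (g := fun x =>
    Num.max (f x) 0 - Num.max (- f x) 0)); last first.
  by move=> x _; exact: posneg_partE.
rewrite !bcs_intB//; [|exact: (bcs_translate a bp)|exact: (bcs_translate a bm)].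
by rewrite (pos (fun x => Num.max (f x) 0))// (pos (fun x => Num.max (- f x) 0)).
Qed.

End GroupCalculus.

(** * Propagation of bounds from a generating neighborhood *)

Section Indicators.
Context {R : realType} {G : topGroupType}.
Hypothesis hG : hausdorff_space G.
Implicit Types S T : set G.

Definition indR S : G -> R := \1_S.

Lemma indR1 S x : S x -> indR S x = 1.
Proof. by move=> Sx; rewrite /indR indicE mem_set. Qed.

Lemma indR0 S x : ~ S x -> indR S x = 0.
Proof. by move=> Sx; rewrite /indR indicE memNset. Qed.

Lemma indR_ge0 S x : 0 <= indR S x.
Proof. by rewrite /indR indicE. Qed.

Lemma lbm_indR S : measurable (S : set (borel G)) -> lbm (indR S).
Proof.
move=> mS; split; first exact: measurable_indic.
move=> C _; exists 1 => x _; rewrite /indR indicE.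
by case: (_ \in _); rewrite ?normr1 ?normr0.
Qed.

Lemma bcs_indR S : measurable (S : set (borel G)) -> precompact S -> bcs (indR S).
Proof.
move=> mS; rewrite precompactE => cS; split; first exact: lbm_indR.
exists (closure S) => // x nS; rewrite indR0// => Sx; apply: nS.
exact: subset_closure.
Qed.

Variable mu : {measure set (borel G) -> \bar R}.
Hypothesis mu_haar : left_haar mu.

Lemma int_indR S : measurable (S : set (borel G)) ->
  \int[mu]_x indR S x = fine (mu S).
Proof. by move=> mS; rewrite /Rintegral integral_indic// setIT. Qed.

Lemma int_indR_gt0 S x : open S -> precompact S -> S x -> 0 < \int[mu]_x indR S x.
Proof.
move=> oS pS Sx; have mS : measurable (S : set (borel G)) by exact: open_borel.
rewrite int_indR// fine_gt0// (haar_open_gt0 hG mu_haar oS Sx)/=.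
exact: (precompact_haar_lty hG mu_haar).
Qed.

End Indicators.

Section Spread.
Context {R : realType} {G : topGroupType}.
Hypothesis hG : hausdorff_space G.
Variable mu : {measure set (borel G) -> \bar R}.
Hypothesis mu_haar : left_haar mu.
Variable W : set G.
Hypotheses (oW : open W) (W_gen : generating_nbhd W).

Let muC := compact_haar_lty mu_haar.

Definition local_bcs (D : G -> R) := forall S : set G, open S -> precompact S ->
  bcs (fun x => indR S x * D x).

(** The model is: [D] is the squared distance between [f] and its translate, which gives symmetry
    and the triangle inequality with factor 2; [E] is a multiple of the deviation of w(., h) from
    its mean; [Y] bounds everything in sight. In the lemmas below the constants are quantified
    before [D], [E], [Y], hence depend only on [W] and on the point or compact set. *)
Record spread (D E : G -> R) (Y : R) : Prop := Spread {
  spreadD : local_bcs D;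
  spreadE : local_bcs E;
  spreadD0 : forall x, 0 <= D x;
  spreadE0 : forall x, 0 <= E x;
  spreadV : forall x, D x^-1%g = D x;
  spreadM : forall x y, D (x * y)%g <= 2 * D x + 2 * D y;
  spreadDE : forall h k, W h -> W k -> D (h^-1 * k)%g <= E h + E k + Y;
  spread_int : \int[mu]_x (indR W x * E x) <= Y }.

Let pW : precompact W. Proof. by case: W_gen. Qed.
Let W1 : W 1%g. Proof. exact: generating_nbhd1. Qed.

Lemma spread_ge0 D E Y : spread D E Y -> 0 <= Y.
Proof.
move=> s; apply: le_trans (spread_int s); apply: Rintegral_ge0 => x _.
by rewrite mulr_ge0 ?indR_ge0// (spreadE0 s).
Qed.

Lemma nbhs_open1 (N : set G) : nbhs (1%g : G) N ->
  exists V : set G, [/\ open V, V 1%g, V `<=` N & forall x, V x -> V x^-1%g].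
Proof.
rewrite nbhsE => -[V [oV V1] VN].
exists (V `&` (fun x => x^-1%g) @^-1` V); split.
- apply: openI => //; apply: open_comp => // x _; exact: invg_continuous.
- by split => //=; rewrite invg1.
- by move=> x [/VN].
- by move=> x [Vx Vx'] /=; split => //=; rewrite invgK.
Qed.

Lemma precompactW (S : set G) : S `<=` W -> precompact S.
Proof. by move=> SW; exact: precompact_subset pW. Qed.

(** For fixed [h] in [V] write [w x] as [h^-1 (h w x)], so that [D (w x) <= E h + E (h w x) + Y].
    Integrating in [x], left invariance bounds the middle term by [Y]; averaging over [h] in [V]
    then bounds the first one. *)
Lemma spread_average w : W w -> exists V : set G, [/\ open V, V 1%g,
  [set (w * x)%g | x in V] `<=` W, V `<=` W &
  exists2 c, 0 <= c & forall D E Y, spread D E Y ->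
  \int[mu]_x (indR [set (w * x)%g | x in V] x * D x) <= c * Y].
Proof.
move=> Ww.
have [V [oV V1 VW VwVW]] : exists V : set G, [/\ open V, V 1%g, V `<=` W &
    forall h x, V h -> V x -> W (h * (w * x))%g].
  have W1w : nbhs (1 * w)%g W by rewrite mul1g; exact: open_nbhs_nbhs.
  have [A [B [A1 Bw AB]]] := nbhs_mulg W1w.
  have Bw1 : nbhs (w * 1)%g B by rewrite mulg1.
  have N1 : nbhs (1%g : G) (A `&` [set y | B (w * y)%g] `&` W).
    apply: filterI; last exact: open_nbhs_nbhs.
    by apply: filterI => //; exact: nbhs_mulgl.
  have [V [oV V1 VN _]] := nbhs_open1 N1.
  exists V; split => //; first by move=> x /VN[].
  by move=> h x /VN[[Ah _] _] /VN[[_ Bx] _]; exact: AB.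
have wVW : [set (w * x)%g | x in V] `<=` W.
  by move=> _ [x Vx <-]; rewrite -[(w * x)%g]mul1g; exact: VwVW.
exists V; split => //.
set wV := [set (w * x)%g | x in V].
have owV : open wV by exact: open_mulgl.
have pV : precompact V by exact: precompactW.
have pwV : precompact wV by exact: precompactW.
set m := \int[mu]_x indR V x.
have m0 : 0 < m by exact: (int_indR_gt0 hG mu_haar oV pV V1).
set m' := \int[mu]_x indR wV x.
have m'0 : 0 <= m' by apply: Rintegral_ge0 => x _; exact: indR_ge0.
(* With [m] the measure of [V] and [m'] that of [wV], the double integration gives
   [m I <= m' Y + (m' Y + Y) m]; this is the result of dividing by [m]. *)
exists (m' + m' / m + 1).
  by rewrite !addr_ge0// divr_ge0// ltW.
move=> D E Y s; have Y0 := spread_ge0 s.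
set I := \int[mu]_x (indR wV x * D x).
have bV : bcs (indR V : G -> R) by apply: bcs_indR => //; exact: open_borel.
have bwV : bcs (indR wV : G -> R) by apply: bcs_indR => //; exact: open_borel.
have H h : V h -> I <= m' * (E h + Y) + Y.
  move=> Vh.
  have bE : bcs (fun x => indR W (h * x)%g * E (h * x)%g).
    exact: (bcs_translate h (spreadE s oW pW)).
  apply: (@le_trans _ _ (\int[mu]_x ((E h + Y) * indR wV x +
      indR W (h * x)%g * E (h * x)%g))).
    apply: bcs_le_int => //.
    - exact: (spreadD s owV pwV).
    - by apply: bcsD => //; exact: bcsZ.
    - move=> x; have [[v Vv <-]|nwV] := pselect (wV x); last first.
        rewrite (indR0 nwV) mul0r mulr0 add0r mulr_ge0 ?indR_ge0//.
        exact: (spreadE0 s).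
      have Wh : W (h * (w * v))%g by exact: VwVW.
      rewrite indR1; last by exists v.
      rewrite (indR1 Wh) !mul1r mulr1.
      have := spreadDE s (VW _ Vh) Wh; rewrite mulKg; lra.
  rewrite bcs_intD//; last exact: bcsZ.
  rewrite bcs_intZ// [X in _ + X](int_translate hG mu_haar h (spreadE s oW pW)).
  by rewrite mulrC lerD2l; exact: (spread_int s).
have bVE := spreadE s oV pV.
have H2 : m * I <= m' * \int[mu]_x (indR V x * E x) + (m' * Y + Y) * m.
  rewrite /m -(bcs_intZ hG muC _ bVE) -(bcs_intZ hG muC _ bV) -bcs_intD//; last 2 first.
  - exact: bcsZ.
  - exact: bcsZ.
  rewrite mulrC -bcs_intZ//.
  apply: bcs_le_int => //; [exact: bcsZ|by apply: bcsD; exact: bcsZ|].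
  move=> h; have [Vh|nVh] := pselect (V h); last by rewrite (indR0 nVh) !(mulr0,mul0r) addr0.
  rewrite (indR1 Vh) !mulr1 mul1r; have := H _ Vh; lra.
have H3 : \int[mu]_x (indR V x * E x) <= Y.
  apply: le_trans (spread_int s); apply: bcs_le_int => //; first exact: (spreadE s oW pW).
  move=> x; have [Vx|nVx] := pselect (V x).
    by rewrite (indR1 Vx) (indR1 (VW _ Vx)).
  by rewrite (indR0 nVx) mul0r mulr_ge0 ?indR_ge0// (spreadE0 s).
have H4 : m' * \int[mu]_x (indR V x * E x) <= m' * Y by rewrite ler_wpM2l.
rewrite -(ler_pM2l m0).
rewrite (_ : m * ((m' + m' / m + 1) * Y) = m' * Y + (m' * Y + Y) * m).
  by apply: le_trans H2 _; rewrite lerD2r.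
by field; rewrite gt_eqF.
Qed.

(** An average becomes a pointwise bound through [D u <= 2 D x + 2 D (x^-1 u)], integrated over [x]
    in [V']. By symmetry of [D] the last term is [2 D (u^-1 x)], and both [x] and [u^-1 x] run
    inside the set on which [D] is bounded in mean. *)
Lemma spread_near1 : exists V : set G, [/\ open V, V 1%g, V `<=` W,
  (forall x, V x -> V x^-1%g) & exists2 c, 0 <= c & forall D E Y, spread D E Y ->
  forall u, V u -> D u <= c * Y].
Proof.
have [V [oV V1 _ VW [c c0 Vc]]] := spread_average W1.
have idV : [set (1 * x)%g | x in V] = V.
  apply/seteqP; split => [_ [x Vx <-]|x Vx]; first by rewrite mul1g.
  by exists x => //; rewrite mul1g.
rewrite idV in Vc.
have V11 : nbhs (1 * 1)%g V by rewrite mulg1; exact: open_nbhs_nbhs.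
have [A [B [A1 B1 AB]]] := nbhs_mulg V11.
have N1 : nbhs (1%g : G) (A `&` B `&` V).
  by apply: filterI; [exact: filterI|exact: open_nbhs_nbhs].
have [V' [oV' V'1 V'N V'V]] := nbhs_open1 N1.
have V'sub : V' `<=` V by move=> x /V'N[].
have V'W : V' `<=` W by apply: subset_trans VW.
have pV' : precompact V' by exact: precompactW.
have pV : precompact V by exact: precompactW.
exists V'; split => //.
set m := \int[mu]_x indR V' x.
have m0 : 0 < m by exact: (int_indR_gt0 hG mu_haar oV' pV' V'1).
exists (4 * c / m); first by rewrite divr_ge0 ?mulr_ge0// ltW.
move=> D E Y s u V'u.
have bV' : bcs (indR V' : G -> R) by apply: bcs_indR => //; exact: open_borel.
have bVD := spreadD s oV pV.
have bVDu := bcs_translate u^-1%g bVD.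
have H : D u * m <= \int[mu]_x (2 * (indR V x * D x) +
    2 * (indR V (u^-1 * x)%g * D (u^-1 * x)%g)).
  rewrite -bcs_intZ//; apply: bcs_le_int => //; first exact: bcsZ.
    by apply: bcsD; exact: bcsZ.
  move=> x; have [V'x|nV'x] := pselect (V' x); last first.
    rewrite (indR0 nV'x) mulr0 addr_ge0 ?mulr_ge0 ?indR_ge0//;
      exact: (spreadD0 s).
  rewrite (indR1 V'x) (indR1 (V'sub _ V'x)) indR1; last first.
    have [[_ Bx] _] := V'N _ V'x; apply: AB => //.
    by have [[]] := V'N _ (V'V _ V'u).
  rewrite mulr1 !mul1r; have := spreadM s x (x^-1 * u)%g.
  by rewrite mulVKg -(spreadV s (x^-1 * u)%g) invgM invgK.
rewrite bcs_intD// in H; [|exact: bcsZ|exact: bcsZ].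
rewrite !bcs_intZ// (int_translate hG mu_haar u^-1%g bVD) in H.
rewrite mulrAC ler_pdivlMr//; apply: le_trans H _.
have := Vc _ _ _ s; lra.
Qed.

(** The points with such a constant form a subgroup, so it suffices to reach those of [W]. The
    neighborhood from [spread_near1] would not do, since it need not generate a disconnected group;
    this is why averages around every [w] in [W] were prepared. *)
Lemma spread_point h : exists2 c, 0 <= c & forall D E Y, spread D E Y ->
  D h <= c * Y.
Proof.
have [V [oV V1 VW VV [c c0 Vc]]] := spread_near1.
have [_ _ _ gW] := W_gen.
pose P := [set h : G | exists2 c, 0 <= c &
  forall D E Y, spread D E Y -> D h <= c * Y].
suff : generated W `<=` P by rewrite gW => /(_ h I).
move=> x /(_ P); apply; split; first split.
- by exists c => // D E Y s; exact: (Vc _ _ _ s).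
- move=> y z [a a0 ya] [b b0 zb]; exists (2 * a + 2 * b).
    by rewrite addr_ge0// mulr_ge0.
  move=> D E Y s; have := spreadM s y z^-1%g; rewrite (spreadV s).
  have := ya _ _ _ s; have := zb _ _ _ s; lra.
- move=> w Ww; have [Vw [oVw Vw1 wVW VwW [cw cw0 Vwc]]] := spread_average Ww.
  (* For [y] in [S], [D w <= 2 D y + 2 D (w^-1 y)]: the first term is bounded in mean around [w],
     the second pointwise since [w^-1 y] is in [V]. *)
  set S := [set (w * x)%g | x in Vw] `&` [set (w * x)%g | x in V].
  have oS : open S by apply: openI; exact: open_mulgl.
  have Sw : S w by split; exists 1%g => //; rewrite mulg1.
  have pS : precompact S by apply: precompactW => y [/wVW].
  set m := \int[mu]_x indR S x.
  have m0 : 0 < m by exact: (int_indR_gt0 hG mu_haar oS pS Sw).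
  exists (2 * cw / m + 2 * c).
    by apply: addr_ge0; [apply: divr_ge0; [exact: mulr_ge0|exact: ltW]|exact: mulr_ge0].
  move=> D E Y s; have Y0 := spread_ge0 s.
  have bS : bcs (indR S : G -> R) by apply: bcs_indR => //; exact: open_borel.
  have owVw : open [set (w * x)%g | x in Vw] by exact: open_mulgl.
  have pwVw := precompactW wVW.
  have bD := spreadD s owVw pwVw.
  have H : D w * m <= \int[mu]_x (2 * (indR [set (w * x)%g | x in Vw] x * D x) +
      2 * c * Y * indR S x).
    rewrite -bcs_intZ//; apply: bcs_le_int => //; first exact: bcsZ.
      by apply: bcsD; exact: bcsZ.
    move=> y; have [Sy|nSy] := pselect (S y); last first.
      rewrite (indR0 nSy) !mulr0 addr0 !mulr_ge0 ?indR_ge0//.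
      exact: (spreadD0 s).
    rewrite (indR1 Sy); have [Sy1 [v Vv vy]] := Sy; rewrite (indR1 Sy1).
    rewrite !mulr1 mul1r; have := spreadM s y (y^-1 * w)%g.
    rewrite mulVKg -(spreadV s (y^-1 * w)%g) invgM invgK.
    rewrite -[in D (w^-1 * y)%g]vy mulKg.
    have := Vc _ _ _ s _ Vv; lra.
  rewrite bcs_intD// in H; [|exact: bcsZ|exact: bcsZ].
  rewrite !bcs_intZ// in H.
  rewrite -(ler_pM2r m0); apply: le_trans H _; rewrite -/m.
  rewrite (_ : (_ + _) * Y * m = 2 * (cw * Y) + 2 * c * Y * m); last first.
    by field; rewrite gt_eqF.
  by rewrite lerD2r ler_wpM2l//; exact: (Vwc _ _ _ s).
Qed.

Lemma spread_bound (C : set G) : compact C -> exists2 c, 0 <= c &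
  forall D E Y, spread D E Y -> forall h, C h -> D h <= c * Y.
Proof.
move=> cC; have [V [oV V1 VW VV [c c0 Vc]]] := spread_near1.
apply: (compact_local (P := fun C => exists2 c, 0 <= c &
  forall D E Y, spread D E Y -> forall h, C h -> D h <= c * Y) cC).
- by exists 0.
- move=> A B [a a0 Aa] [b b0 Bb]; exists (a + b); first exact: addr_ge0.
  move=> D E Y s h; have Y0 := spread_ge0 s.
  have aY : 0 <= a * Y by exact: mulr_ge0.
  have bY : 0 <= b * Y by exact: mulr_ge0.
  move=> [Ah|Bh]; [have := Aa _ _ _ s _ Ah|have := Bb _ _ _ s _ Bh]; lra.
- by move=> A B AB [b b0 Bb]; exists b => // D E Y s h /AB; exact: Bb s h.
- move=> h _; have [a a0 ha] := spread_point h.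
  exists [set (h * v)%g | v in V].
    apply: open_nbhs_nbhs; split; first exact: open_mulgl.
    by exists 1%g => //; rewrite mulg1.
  exists (2 * a + 2 * c); first by rewrite addr_ge0// mulr_ge0.
  move=> D E Y s _ [v Vv <-]; have := spreadM s h v.
  have := ha _ _ _ s; have := Vc _ _ _ s _ Vv; lra.
Qed.

End Spread.

Section Additive.
Context {R : realType}.

(** * Approximately additive functions *)

(** The difference [g] from the linear function vanishes on the integer multiples of 1/(N+1), which
    come within [e] of every point, so [g] is bounded; a bounded additive function is zero. *)
Lemma additive_continuous_linear (f : R -> R) :
  (forall x y, f (x + y) = f x + f y) -> {for 0, continuous f} ->
  forall x, f x = x * f 1.
Proof.
move=> fD cf.
have f0 : f 0 = 0 by apply: (@addrI _ (f 0)); rewrite -fD !addr0.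
have fN x : f (- x) = - f x by apply/eqP; rewrite -addr_eq0 -fD addNr f0.
have fMn x n : f (x *+ n) = f x *+ n.
  by elim: n => [|n ih]; rewrite ?mulr0n// !mulrS fD ih.
pose g x := f x - x * f 1.
have gD x y : g (x + y) = g x + g y by rewrite /g fD mulrDl; lra.
have gMn x n : g (x *+ n) = g x *+ n.
  by rewrite /g fMn mulrnAl mulrnBl.
have [e e0 fe] : exists2 e : R, 0 < e & forall x, `|x| < e -> `|f x| <= 1.
  have : \forall x \near (0 : R), `|f x| <= 1.
    have : \forall x \near (0 : R), ball (f 0) 1 (f x) by apply: cf; exact: nbhsx_ballx.
    by apply: filterS => x; rewrite /ball /= f0 sub0r normrN; exact: ltW.
  move=> /nbhs_ballP[e e0 H]; exists e => // x xe; apply: H.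
  by rewrite /ball /= sub0r normrN.
have [N Ne] : exists N : nat, N.+1%:R^-1 < e.
  exists (Num.truncn e^-1); rewrite invf_plt ?posrE//; exact: truncnS_gt.
have g1 : g N.+1%:R^-1 = 0.
  have := gMn N.+1%:R^-1 N.+1; rewrite -[_^-1 *+ _]mulr_natr mulVf ?pnatr_eq0//.
  by rewrite {1}/g mul1r subrr => /esym/eqP; rewrite mulrn_eq0 => /eqP.
pose M := 1 + e * `|f 1|.
have gb x : `|g x| <= M.
  pose k := Num.floor (x * N.+1%:R).
  pose y := x - k%:~R * N.+1%:R^-1.
  have gk : g (k%:~R * N.+1%:R^-1) = 0.
    case: (k) => n.
      by rewrite -pmulrn mulr_natl gMn g1 mul0rn.
    rewrite NegzE mulrNz mulNr.
    have -> : g (- (n.+1%:~R * N.+1%:R^-1)) = - g (n.+1%:~R * N.+1%:R^-1).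
      by rewrite /g fN mulNr opprB opprK addrC.
    by rewrite -pmulrn mulr_natl gMn g1 mul0rn oppr0.
  have -> : g x = g y by rewrite -[x in LHS](subrK (k%:~R * N.+1%:R^-1)) gD gk addr0.
  have ye : `|y| < e.
    have N0 : 0 < N.+1%:R :> R by [].
    have y0 : 0 <= y.
      by rewrite subr_ge0 ler_pdivrMr// floor_le.
    rewrite ger0_norm//; apply: lt_trans Ne.
    rewrite ltrBlDr -[X in _ < X + _]mul1r -mulrDl ltr_pdivlMr//.
    by rewrite addrC -[1]/(1%:~R) -intrD; exact: floorD1_gt.
  rewrite /g; apply: le_trans (ler_normB _ _) _; apply: lerD; first exact: fe.
  by rewrite normrM ler_wpM2r// ltW.
move=> x; apply/eqP; rewrite -subr_eq0 -/(g x) -normr_le0 leNgt; apply/negP => gx.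
have := gb (x *+ (Num.truncn (M / `|g x|)).+1).
rewrite gMn normrMn -mulr_natr leNgt => /negP; apply.
by rewrite -ltr_pdivrMl// mulrC; exact: truncnS_gt.
Qed.

End Additive.

(** * Continuous homomorphisms from the group to the real line *)

Lemma pair_continuous (X Y : topologicalType) (x : X) :
  continuous (fun y : Y => (x, y)).
Proof. by move=> y; apply: cvg_pair; [exact: cvg_cst|exact: cvg_id]. Qed.

Lemma pair_continuousl (X Y : topologicalType) (y : Y) :
  continuous (fun x : X => (x, y)).
Proof. by move=> x; apply: cvg_pair; [exact: cvg_id|exact: cvg_cst]. Qed.

Lemma entry_continuous (T : topologicalType) m n (i : 'I_m) (j : 'I_n) :
  continuous (fun M : 'M[T]_(m, n) => M i j).
Proof.
move=> M A MA; exists (fun i' j' => [set x | i' = i -> j' = j -> A x]).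
  by move=> i' j'; have [[->  ->]|ne] := pselect (i' = i /\ j' = j);
    [apply: filterS MA => x Ax|apply: nearW => x ii jj; case: ne].
by move=> N /= /(_ i j); apply.
Qed.

Lemma pair_addE (A B : nmodType) (a a' : A) (b b' : B) :
  (a, b) + (a', b') = (a + a', b + b').
Proof. by []. Qed.

Section Homomorphisms.
Context {R : realType} {G : topGroupType}.
Variable D : splitting R G.
Local Notation q := (splitting_q D).
Local Notation r := (splitting_r D).
Local Notation M := (splitting_M D).
Local Notation target := ('rV[R]_q * 'rV[int]_r * M)%type.

Lemma pi1M i (g h : G) : pi1 D i (g * h)%g = pi1 D i g + pi1 D i h.
Proof.
rewrite /pi1 splitting_isoM; case: (fintype.split i) => j /=; rewrite !mxE//.
by rewrite intrD.
Qed.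

Lemma pi1_continuous i : continuous (pi1 D i).
Proof.
have ci : continuous (fun g : G => splitting_iso D (pi0 g)).
  move=> g; apply: (@continuous_comp _ _ _ (@pi0 G) (splitting_iso D)).
    exact: pi_continuous.
  exact: splitting_iso_continuous.
rewrite /pi1; case: (fintype.split i) => j g.
- apply: (@continuous_comp _ _ _ (fun g : G => splitting_iso D (pi0 g))
    (fun v : target => v.1.1 ord0 j)); first exact: ci.
  apply: (@continuous_comp _ _ _ (fun v : target => v.1)
    (fun v : 'rV[R]_q * 'rV[int]_r => v.1 ord0 j)); first exact: cvg_fst.
  apply: (@continuous_comp _ _ _ (fun v : 'rV[R]_q * 'rV[int]_r => v.1)
    (fun v : 'rV[R]_q => v ord0 j)); first exact: cvg_fst.
  exact: entry_continuous.
- apply: (@continuous_comp _ _ _ (fun g : G => splitting_iso D (pi0 g))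
    (fun v : target => (v.1.2 ord0 j)%:~R : R)); first exact: ci.
  apply: (@continuous_comp _ _ _ (fun v : target => v.1)
    (fun v : 'rV[R]_q * 'rV[int]_r => (v.2 ord0 j)%:~R : R)); first exact: cvg_fst.
  apply: (@continuous_comp _ _ _ (fun v : 'rV[R]_q * 'rV[int]_r => v.2)
    (fun v : 'rV[int]_r => (v ord0 j)%:~R : R)); first exact: cvg_snd.
  apply: (@continuous_comp _ _ _ (fun v : 'rV[int]_r => v ord0 j)
    (fun z : int => z%:~R : R)); first exact: entry_continuous.
  by move=> A /nbhs_singleton Az; apply/principal_filterP.
Qed.

Definition pi1_comb (c : 'I_(q + r) -> R) (g : G) : R := \sum_i c i * pi1 D i g.

Lemma pi1_combM c g h : pi1_comb c (g * h)%g = pi1_comb c g + pi1_comb c h.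
Proof.
by rewrite /pi1_comb -big_split; apply: eq_bigr => i _; rewrite pi1M mulrDr.
Qed.

Lemma pi1_comb_continuous c : continuous (pi1_comb c).
Proof.
rewrite /pi1_comb; elim: (index_enum _) => [|i s ih] g.
  rewrite (_ : (fun g => _) = cst 0); first exact: cvg_cst.
  by apply/funext => x; rewrite big_nil.
rewrite (_ : (fun g => _) =
    (fun g => c i * pi1 D i g + \sum_(i <- s) c i * pi1 D i g)).
  by apply: cvgD; [apply: cvgMr; exact: pi1_continuous|exact: ih].
by apply/funext => x; rewrite big_cons.
Qed.

Variable b : G -> R.
Hypothesis bM : forall x y, b (x * y)%g = b x + b y.
Hypothesis bc : continuous b.

Let b1 : b 1%g = 0.
Proof. by apply: (@addrI _ (b 1%g)); rewrite -bM mulg1 addr0. Qed.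

Let bV x : b x^-1%g = - b x.
Proof. by apply/eqP; rewrite -addr_eq0 -bM mulVg b1. Qed.

(** The kernel of [b] is a closed subgroup containing the commutators. *)
Let bG0 x : G0 x -> b x = 0.
Proof.
have sub : @commutator_subgroup G `<=` b @^-1` [set 0].
  move=> y /(_ (b @^-1` [set 0])); apply; split; first split => //.
    by move=> u v /= u0 v0; rewrite bM bV u0 v0 subr0.
  by move=> _ [u [v ->]] /=; rewrite /commg /conjg !bM !bV; lra.
have cl : closed (b @^-1` [set 0]).
  apply: closed_comp => [y _|]; first exact: bc.
  exact: closed_eq.
by rewrite /G0 => /(closure_subset sub); rewrite -(closure_id _).1.
Qed.

Let bfib x y : pi0 x = pi0 y -> b x = b y.
Proof.
move=> /eqmodP /asboolP /bG0; rewrite bM bV => /eqP.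
by rewrite addrC subr_eq0 => /eqP.
Qed.

Let bq (y : abelianization G) : R := b (generic_quotient.repr y).

Let bqE x : bq (pi0 x) = b x.
Proof. by apply: bfib; rewrite /pi0 reprK. Qed.

Let bq_continuous : continuous bq.
Proof.
apply: (@repr_comp_continuous G _ R b bc) => x y /eqP xy; apply/eqP.
exact: bfib.
Qed.

Let beta (v : target) := bq (@splitting_inv _ _ D v).

Let betaE x : beta (splitting_iso D (pi0 x)) = b x.
Proof. by rewrite /beta splitting_isoK bqE. Qed.

Let betaD u v : beta (u + v) = beta u + beta v.
Proof.
have H w : exists x, w = splitting_iso D (pi0 x).
  exists (generic_quotient.repr (@splitting_inv _ _ D w)).
  by rewrite /pi0 reprK splitting_invK.
have [x ->] := H u; have [y ->] := H v.
by rewrite -splitting_isoM !betaE bM.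
Qed.

Let beta_continuous : continuous beta.
Proof.
move=> v; apply: (@continuous_comp _ _ _ (@splitting_inv _ _ D) bq).
  exact: splitting_inv_continuous.
exact: bq_continuous.
Qed.

Let beta0 : beta 0 = 0.
Proof. by apply: (@addrI _ (beta 0)); rewrite -betaD !addr0. Qed.

(** The values on the compact factor are bounded, while those at the multiples of [m] grow linearly
    unless [beta] vanishes at [m]. *)
Let betaM_ (m : M) : beta (0, 0, m) = 0.
Proof.
have cf : continuous (fun m : M => beta (0, 0, m)).
  move=> k; apply: (@continuous_comp _ _ _ (fun m : M => (0, 0, m) : target) beta).
    exact: (@pair_continuous _ M ((0, 0) : 'rV[R]_q * 'rV[int]_r)).
  exact: beta_continuous.
have cI : compact [set beta (0, 0, m) | m in [set: M]].
  by apply: compact_image => //; exact: splitting_M_compact.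
have [B [_ HB]] := compact_bounded cI.
have bB k : `|beta (0, 0, k)| <= B + 1.
  by apply: (HB (B + 1)); [rewrite ltrDl|exists k].
have bn n : beta (0, 0, m *+ n) = beta (0, 0, m) *+ n.
  elim: n => [|n ih]; first exact: beta0.
  rewrite !mulrS -ih -betaD; congr (beta (_, _)).
  by rewrite /GRing.add /=; congr pair; rewrite addr0.
apply/eqP; rewrite -normr_le0 leNgt; apply/negP => m0.
have := bB (m *+ (Num.truncn ((B + 1) / `|beta (0, 0, m)|)).+1).
rewrite bn normrMn -mulr_natr leNgt => /negP; apply.
by rewrite -ltr_pdivrMl// mulrC; exact: truncnS_gt.
Qed.

Let betaR (u : 'rV[R]_q) :
  beta (u, 0, 0) = \sum_j u ord0 j * beta ('e_j, 0, 0).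
Proof.
have D0 u1 u2 : beta (u1 + u2, 0, 0) = beta (u1, 0, 0) + beta (u2, 0, 0).
  by rewrite -betaD; congr (beta (_, _, _)); rewrite addr0.
have Z t j : beta (t *: 'e_j, 0, 0) = t * beta ('e_j, 0, 0).
  have := @additive_continuous_linear R (fun t => beta (t *: 'e_j, 0, 0)).
  rewrite scale1r; apply => [x y|]; first by rewrite scalerDl D0.
  apply: (@continuous_comp _ _ _ (fun t : R => (t *: 'e_j, 0, 0) : target) beta).
    apply: (@continuous_comp _ _ _ (fun t : R => t *: 'e_j : 'rV[R]_q)
      (fun u : 'rV[R]_q => (u, 0, 0) : target)); last first.
      apply: (@continuous_comp _ _ _
        (fun u : 'rV[R]_q => (u, 0) : 'rV[R]_q * 'rV[int]_r)
        (fun u : 'rV[R]_q * 'rV[int]_r => (u, 0) : target)).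
        exact: (@pair_continuousl 'rV[R]_q 'rV[int]_r 0).
      exact: (@pair_continuousl ('rV[R]_q * 'rV[int]_r)%type M 0).
    (* Neighborhoods of a matrix are given entry by entry, so continuity of scaling reduces to
       finitely many scalar statements. *)
    move=> A [P NP PA]; rewrite /nbhs /=.
    have H (i : 'I_1) (k : 'I_q) :
        \forall t \near (0 : R), P i k (t * ('e_j : 'rV[R]_q) i k).
      have cm : {for 0, continuous (fun t : R => t * ('e_j : 'rV[R]_q) i k)}.
        by apply: cvgMl; exact: cvg_id.
      by apply: cm; have := NP i k; rewrite mxE.
    have : \forall t \near (0 : R), forall i k, P i k (t * ('e_j : 'rV[R]_q) i k).
      apply: (@filter_forall R _ (fun i t => forall k,
        P i k (t * ('e_j : 'rV[R]_q) i k)) (nbhs (0 : R))) => i.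
      apply: (@filter_forall R _ (fun k t =>
        P i k (t * ('e_j : 'rV[R]_q) i k)) (nbhs (0 : R))) => k.
      exact: H.
    apply: filterS => z Pz; apply: PA => i k; rewrite mxE; exact: Pz.
  exact: beta_continuous.
rewrite [in LHS](row_sum_delta u).
have : forall s : seq 'I_q, beta (\sum_(j <- s) u ord0 j *: 'e_j, 0, 0) =
    \sum_(j <- s) u ord0 j * beta ('e_j, 0, 0).
  elim=> [|j s ih]; first by rewrite !big_nil beta0.
  by rewrite !big_cons D0 Z ih.
by apply.
Qed.

Let betaZ (u : 'rV[int]_r) :
  beta (0, u, 0) = \sum_j (u ord0 j)%:~R * beta (0, 'e_j, 0).
Proof.
have D0 u1 u2 : beta (0, u1 + u2, 0) = beta (0, u1, 0) + beta (0, u2, 0).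
  by rewrite -betaD; congr (beta (_, _, _)); rewrite addr0.
have N0 u1 : beta (0, - u1, 0) = - beta (0, u1, 0).
  by apply/eqP; rewrite -addr_eq0 -D0 addNr beta0.
have Zn n j : beta (0, n%:Z *: 'e_j, 0) = n%:R * beta (0, 'e_j, 0).
  elim: n => [|n ih]; first by rewrite scale0r beta0 mul0r.
  by rewrite intS scalerDl scale1r D0 ih [n.+1%:R]mulrS mulrDl mul1r.
have Z t j : beta (0, t *: 'e_j, 0) = t%:~R * beta (0, 'e_j, 0).
  case: t => n; first by rewrite Zn.
  by rewrite NegzE scaleNr N0 Zn mulrNz mulNr.
rewrite [in LHS](row_sum_delta u).
have : forall s : seq 'I_r, beta (0, \sum_(j <- s) u ord0 j *: 'e_j, 0) =
    \sum_(j <- s) (u ord0 j)%:~R * beta (0, 'e_j, 0).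
  elim=> [|j s ih]; first by rewrite !big_nil beta0.
  by rewrite !big_cons D0 Z ih.
by apply.
Qed.

(** Such a [b] descends to the quotient by [G0] and becomes, through the splitting, a continuous
    additive function on R^q * Z^r * M. It is linear on the first factor, determined by the basis
    vectors on the second, and zero on the third. *)
Lemma hom_pi1_comb : exists c, forall g, b g = pi1_comb c g.
Proof.
exists (fun i => match fintype.split i with
  | inl j => beta ('e_j, 0, 0) | inr j => beta (0, 'e_j, 0) end) => g.
have splitl (j : 'I_q) : fintype.split (lshift r j) = inl j.
  exact: (unsplitK (inl j)).
have splitr (j : 'I_r) : fintype.split (rshift q j) = inr j.
  exact: (unsplitK (inr j)).
rewrite -betaE /pi1_comb /pi1; set v := splitting_iso D (pi0 g).
case: v => -[u n] m.
have -> : beta (u, n, m) = beta (u, 0, 0) + beta (0, n, 0) + beta (0, 0, m).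
  have -> : beta (u, 0, 0) + beta (0, n, 0) = beta ((u, 0, 0) + (0, n, 0)).
    by rewrite betaD.
  have -> : (u, 0, 0) + (0, n, 0) = (u, n, 0) :> target.
    by rewrite !pair_addE !addr0 add0r.
  have -> : beta (u, n, 0) + beta (0, 0, m) = beta ((u, n, 0) + (0, 0, m)).
    by rewrite betaD.
  by rewrite !pair_addE !addr0 add0r.
rewrite betaM_ addr0 betaR betaZ big_split_ord /=; congr (_ + _).
- by apply: eq_bigr => j _; rewrite splitl; exact: mulrC.
- by apply: eq_bigr => j _; rewrite splitr; exact: mulrC.
Qed.

End Homomorphisms.

Arguments pi1_comb {R G} D c g.

(** * Functions that are additive up to an error on compact sets *)

Lemma ultra_bounded_lim (R : realType) (F : set_system nat) (u : nat -> R) m :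
  UltraFilter F -> (forall j, `|u j| <= m) ->
  exists l : R, `|l| <= m /\ forall e, 0 < e -> F [set j | `|u j - l| < e].
Proof.
move=> UF um; have PF := @ultra_proper _ _ UF.
have cI : compact `[- m, m]%classic by exact: segment_compact.
have FI : (u @ F) `[- m, m]%classic.
  rewrite /fmap /= (_ : _ @^-1` _ = setT); first exact: filterT.
  by apply/seteqP; split => // j _ /=; rewrite in_itv /= -ler_norml.
have [l [lI cl]] := cI _ (fmap_proper_filter u PF) FI.
exists l; split; first by move: lI; rewrite /= in_itv /= -ler_norml.
move=> e e0.
have [//|nF] := in_ultra_setVsetC [set j | `|u j - l| < e] UF.
have nB : nbhs l (ball l e) by exact: nbhsx_ballx.
have FC : (u @ F) (~` ball l e).
  have : F (u @^-1` (~` ball l e)); last by [].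
  by apply: filterS nF => j /= ue; rewrite /ball /= distrC.
by have [x [nx Bx]] := cl _ _ FC nB.
Qed.

Section QuasiHom.
Context {R : realType} {G : topGroupType}.
Variable D : splitting R G.
Variables (W B : set G).
Hypotheses (oW : open W) (W_gen : generating_nbhd W) (cB : compact B) (WB : W `<=` B).

Let W1 : W 1%g. Proof. exact: generating_nbhd1. Qed.

(** The error on [C] is [kappa C] times a single scalar [d], so that with [kappa] fixed the whole
    condition scales in [d]. The second clause is qualitative, its bound entering no constant. *)
Definition quasi_hom (kappa : set G -> R) (d : R) (A : G -> R) :=
  (forall C : set G, compact C -> forall h k, C h -> C k ->
    `|A (h * k)%g - A h - A k| <= kappa C * d) /\
  (forall C : set G, compact C -> exists m, forall h, C h -> `|A h| <= m).

Lemma near1_expg n : \forall v \near (1%g : G), forall i, (i <= n)%N -> W (v ^+ i)%g.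
Proof.
have cX i : continuous (fun v : G => v ^+ i)%g.
  elim: i => [|i ih] v; first exact: cvg_cst.
  rewrite (_ : (fun v => _) = (fun v : G => v * v ^+ i)%g); last first.
    by apply/funext => x; rewrite expgS.
  by apply: continuous_mulg => // x; exact: cvg_id.
elim: n => [|n ih].
  by apply: nearW => v i; rewrite leqn0 => /eqP ->; rewrite expg0.
have : nbhs (1%g : G) [set v | W (v ^+ n.+1)%g].
  by apply: (cX n.+1 1%g); rewrite expg1n; exact: open_nbhs_nbhs.
apply: filterS2 ih => v Wv Wn i; rewrite leq_eqVlt => /orP[/eqP -> //|].
by rewrite ltnS; exact: Wv.
Qed.

(** Telescoping over the powers of [v]. The factor is [n.+1] rather than [n] because [A 1] need not
    vanish, only be at most [d] in absolute value. *)
Lemma quasi_hom_expg d (A : G -> R) v n : 0 <= d ->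
  (forall h k, B h -> B k -> `|A (h * k)%g - A h - A k| <= d) ->
  (forall i, (i <= n)%N -> W (v ^+ i)%g) ->
  `|A (v ^+ n)%g - n%:R * A v| <= n.+1%:R * d.
Proof.
move=> d0 qA; elim: n => [|n ih] Wv.
  rewrite mul0r subr0 expg0 mul1r.
  have := qA 1%g 1%g (WB W1) (WB W1); rewrite mulg1.
  by rewrite (_ : A 1%g - A 1%g - A 1%g = - A 1%g) ?normrN//; lra.
have Bn : B (v ^+ n)%g by apply: WB; exact: Wv.
have Bv : B v.
  by apply: WB; have := Wv 1%N; rewrite expg1; apply.
have := qA v (v ^+ n)%g Bv Bn; rewrite -expgS.
have := ih (fun i ni => Wv i (leqW ni)).
set a := A (v ^+ n)%g; set b := A (v ^+ n.+1)%g; set c := A v.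
rewrite (_ : b - n.+1%:R * c = (b - c - a) + (a - n%:R * c)); last first.
  by rewrite [n.+1%:R]mulrS mulrDl mul1r; lra.
move=> h1 h2; apply: le_trans (ler_normD _ _) _.
by rewrite [n.+2%:R]mulrS mulrDl mul1r; exact: lerD.
Qed.

Variable kappa : set G -> R.

(** Here [m] is, up to a factor 2 on either side, the distance on [B] from [A] to the span of the
    components of pi1; the slack is there because the infimum need not be attained. *)
Let bad (A : G -> R) (m : R) := [/\ quasi_hom kappa 1 A, 1 <= m &
  (exists c, forall h, B h -> `|A h - pi1_comb D c h| <= 2 * m) /\
  forall c, exists2 h, B h & m / 2 < `|A h - pi1_comb D c h|].

Let bad_exists (n : nat) :
  ~ (exists m, forall A, quasi_hom kappa 1 A ->
     exists c, forall h, B h -> `|A h - pi1_comb D c h| <= m) ->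
  exists A m, bad A m /\ n%:R <= m.
Proof.
move=> nH.
have [A [qA nA]] : exists A, quasi_hom kappa 1 A /\ forall c, exists2 h, B h &
    n.+1%:R < `|A h - pi1_comb D c h|.
  apply: contrapT => nex; apply: nH; exists n.+1%:R => A qA.
  apply: contrapT => nc; apply: nex; exists A; split => // c.
  apply: contrapT => nh; apply: nc; exists c => h Bh.
  by rewrite leNgt; apply/negP => lt; apply: nh; exists h.
pose S := [set m : R | exists c, forall h, B h -> `|A h - pi1_comb D c h| <= m].
have lbS : lbound S n.+1%:R.
  move=> m [c Hc]; have [h Bh nh] := nA c.
  by apply: le_trans (Hc _ Bh); exact: ltW.
have S0 : S !=set0.
  have [_ /(_ _ cB)[m Am]] := qA; exists m; exists (fun=> 0) => h Bh.
  rewrite /pi1_comb big1 ?subr0; first exact: Am.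
  by move=> i _; rewrite mul0r.
have hS : has_inf S by split => //; exists n.+1%:R.
have m1 : n.+1%:R <= inf S by exact: lb_le_inf.
have m0 : 1 <= inf S by apply: le_trans m1; rewrite ler1n.
exists A, (inf S); split; last by apply: le_trans m1; rewrite ler_nat.
split => //; split.
  have [m Sm mlt] := @inf_adherent _ S (inf S) (lt_le_trans ltr01 m0) hS.
  have [c Hc] := Sm; exists c => h Bh; apply: le_trans (Hc _ Bh) _; lra.
move=> c; apply: contrapT => nh.
have : S (inf S / 2).
  exists c => h Bh; rewrite leNgt; apply/negP => lt; apply: nh; by exists h.
move=> /(ge_inf hS.2); lra.
Qed.

(** Otherwise, counterexamples normalized to have size one away from the [pi1_comb]s have a limit along an
    ultrafilter on [nat]; it is additive, and continuous since it is bounded on powers of small elements,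
    hence is a [pi1_comb]. *)
Lemma quasi_hom_near_pi1 : exists m, forall A, quasi_hom kappa 1 A ->
  exists c, forall h, B h -> `|A h - pi1_comb D c h| <= m.
Proof.
apply: contrapT => nH.
have {nH}/choice[A_ /choice[m_ Am]] := fun n : nat => bad_exists n nH.
have m1 n : 1 <= m_ n by have [[]] := Am n.
have m0 n : 0 < m_ n by exact: lt_le_trans (m1 n).
have nm n : n%:R <= m_ n by have [] := Am n.
have qA n : quasi_hom kappa 1 (A_ n) by have [[]] := Am n.
have /choice[c_ cA] n : exists c, forall h, B h ->
    `|A_ n h - pi1_comb D c h| <= 2 * m_ n.
  by have [[_ _ []]] := Am n.
(* Subtracting a nearly optimal combination and dividing by the distance leaves functions of size
   about one whose additivity error tends to 0, since [m_ n >= n]. *)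
pose b_ n h := (A_ n h - pi1_comb D (c_ n) h) / m_ n.
have bdef n (C : set G) h k : compact C -> C h -> C k ->
    `|b_ n (h * k)%g - b_ n h - b_ n k| <= `|kappa C| / m_ n.
  move=> cC Ch Ck; rewrite /b_ pi1_combM -!mulrBl normrM.
  rewrite [`|(m_ n)^-1|]gtr0_norm ?invr_gt0//; apply: ler_wpM2r.
    by rewrite invr_ge0 ltW.
  apply: le_trans (ler_norm (kappa C)); rewrite -[leRHS]mulr1.
  apply: le_trans ((qA n).1 _ cC _ _ Ch Ck); rewrite le_eqVlt; apply/orP; left.
  by apply/eqP; congr (`| _ |); lra.
have bB n h : B h -> `|b_ n h| <= 2.
  move=> Bh; rewrite /b_ normrM [`|(m_ n)^-1|]gtr0_norm ?invr_gt0//.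
  by rewrite ler_pdivrMr//; exact: cA.
have bfar n c : exists2 h, B h & 1 / 2 < `|b_ n h - pi1_comb D c h|.
  have [[_ _ [_ H]] _] := Am n.
  (* Undoing the normalization turns a combination [c] subtracted from [b_ n] into this one
     subtracted from [A_ n]. *)
  have [h Bh hlt] := H (fun i => c_ n i + m_ n * c i); exists h => //.
  rewrite -(ltr_pM2l (m0 n)) -[X in X * `| _ |](gtr0_norm (m0 n)) -normrM.
  rewrite mul1r; apply: (lt_le_trans hlt); rewrite le_eqVlt; apply/orP; left.
  apply/eqP; congr (`| _ |).
  have -> : pi1_comb D (fun i => c_ n i + m_ n * c i) h =
      pi1_comb D (c_ n) h + m_ n * pi1_comb D c h.
    rewrite /pi1_comb mulr_sumr -big_split /=; apply: eq_bigr => i _.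
    by rewrite mulrDl mulrA.
  by rewrite /b_; field; rewrite gt_eqF.
have Kdiv C n : `|kappa C| / m_ n <= `|kappa C|.
  by rewrite ler_pdivrMr// ler_peMr.
(* Uniform boundedness is known on [W] only; near additivity makes the points where it holds a
   subgroup. *)
have bbd h : exists M, forall n, `|b_ n h| <= M.
  have [_ _ _ gW] := W_gen.
  suff : generated W `<=` [set h | exists M, forall n, `|b_ n h| <= M].
    by rewrite gW => /(_ h I).
  move=> x /(_ [set h | exists M, forall n, `|b_ n h| <= M]); apply; split.
    have b1 n : `|b_ n 1%g| <= 2 by apply: bB; exact: WB.
    split; first by exists 2.
    move=> y z [My Hy] [Mz Hz].
    pose C := [set y; z^-1; z; 1]%g.
    have cC : compact C by do ! apply: compactU; exact: compact_set1.
    exists (`|kappa C| + My + (2 + Mz + `|kappa C|)) => n.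
    have z1 : `|b_ n z^-1%g| <= 2 + Mz + `|kappa C|.
      have := le_trans (bdef n C z^-1%g z cC _ _) (Kdiv C n).
      rewrite mulVg => /(_ ltac:(by left; left; right) ltac:(by left; right)).
      have := b1 n; have := Hz n; rewrite !ler_norml; lra.
    have := le_trans (bdef n C y z^-1%g cC _ _) (Kdiv C n).
    move=> /(_ ltac:(by left; left; left) ltac:(by left; left; right)).
    have := Hy n; move: z1; rewrite !ler_norml; lra.
  by move=> w Ww; exists 2 => n; apply: bB; exact: WB.
have [F [UF Foo]] := ultraFilterLemma (@eventually_filter : ProperFilter \oo).
have PF := @ultra_proper _ _ UF.
have fI (P Q : set nat) : F P -> F Q -> F (P `&` Q) by exact: filterI.
have {bbd}/choice[b blim] h : exists l : R, forall e, 0 < e ->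
    F [set j | `|b_ j h - l| < e].
  have [M HM] := bbd h; have [l [_ Hl]] := ultra_bounded_lim UF HM.
  by exists l.
have Fsmall C e : 0 < e -> F [set j | `|kappa C| / m_ j < e].
  move=> e0; apply: Foo.
  exists (Num.truncn (`|kappa C| / e)).+1 => // j /= ltj.
  rewrite ltr_pdivrMr// mulrC -ltr_pdivrMr//.
  apply: lt_le_trans (nm j); apply: lt_le_trans (truncnS_gt _) _.
  by rewrite ler_nat.
have bM h k : b (h * k)%g = b h + b k.
  apply/eqP; rewrite -subr_eq0 -normr_le0 leNgt; apply/negP => lt0.
  set d := `| _ | in lt0.
  have e0 : 0 < d / 4 by rewrite divr_gt0.
  have cC : compact [set h; k] by apply: compactU; exact: compact_set1.
  have /filter_ex[j [[H1 [H2 H3]] H4]] :=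
    fI _ _ (fI _ _ (blim (h * k)%g _ e0) (fI _ _ (blim h _ e0) (blim k _ e0)))
    (Fsmall [set h; k] _ e0).
  have H5 := bdef j [set h; k] h k cC (or_introl erefl) (or_intror erefl).
  have : `|b (h * k)%g - (b h + b k)| < d; last by rewrite ltxx.
  move: H1 H2 H3 H4 H5 => /=; rewrite !ltr_norml ler_norml; lra.
have bB2 h : B h -> `|b h| <= 2.
  move=> Bh; rewrite leNgt; apply/negP => lt2.
  have e0 : 0 < `|b h| - 2 by rewrite subr_gt0.
  have /filter_ex[j /= Hj] := blim h _ e0.
  have := bB j _ Bh; have : `|b h| <= `|b_ j h| + `|b_ j h - b h|.
    by rewrite -[X in `|X| <= _](subKr (b_ j h)) ler_normB.
  lra.
have b1 : b 1%g = 0 by apply: (@addrI _ (b 1%g)); rewrite -bM mulg1 addr0.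
have bX v n : b (v ^+ n)%g = n%:R * b v.
  elim: n => [|n ih]; first by rewrite expg0 b1 mul0r.
  by rewrite expgS bM ih [n.+1%:R]mulrS mulrDl mul1r.
(* If the [N]-th power of [x^-1 y] is in [W], then [N] times the difference of values is at most
   2. *)
have bc : continuous b.
  move=> x; apply/cvgrPdist_lt => e e0.
  pose N := (Num.truncn (2 / e)).+1.
  have N0 : 0 < N%:R :> R by rewrite ltr0n.
  have : \forall v \near (1%g : G), W (v ^+ N)%g.
    by apply: filterS (near1_expg N) => v; apply.
  have -> : (1 = x^-1 * x)%g by rewrite mulVg.
  move=> /nbhs_mulgl; apply: filterS => y /= Wy.
  have -> : b x - b y = - b (x^-1 * y)%g.
    by have := bM x (x^-1 * y)%g; rewrite mulVKg; lra.
  rewrite normrN -(ltr_pM2l N0) -[X in X * `| _ |](gtr0_norm N0) -normrM -bX.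
  apply: le_lt_trans (bB2 _ (WB Wy)) _.
  by rewrite -ltr_pdivrMr//; exact: truncnS_gt.
have [c bE] := hom_pi1_comb D bM bc.
(* Pointwise limits do not yet contradict [bfar]; convergence within 1/2, uniformly on [B], does. *)
suff : F [set j | forall h, B h -> `|b_ j h - b h| <= 1 / 2].
  move=> /filter_ex[j Hj]; have [h Bh] := bfar j c.
  by rewrite -bE ltNge Hj.
apply: (compact_local (P := fun S => F [set j | forall h, S h ->
  `|b_ j h - b h| <= 1 / 2]) cB).
- rewrite (_ : [set j | _] = setT); first exact: filterT.
  apply/seteqP; split => j _ //=.
- move=> S T FS FT; apply: filterS (fI _ _ FS FT) => j /= [HS HT] h.
  by move=> [/HS|/HT].
- by move=> S T ST; apply: filterS => j HT h /ST; exact: HT.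
- move=> x Bx.
  (* On [v] the error is at most (2 + 2 + 17/32) / 16, from the bound 2 at [v ^+ 16] and the 17
     additivity errors; adding 1/16 at [x] and 1/32 for the product stays below 1/2. *)
  have nV := near1_expg 16.
  exists [set (x * v)%g | v in [set v | forall i, (i <= 16)%N -> W (v ^+ i)%g]].
    have -> : x = (x * 1)%g by rewrite mulg1.
    rewrite mulg1; have : nbhs (x^-1 * x)%g
        [set v | forall i, (i <= 16)%N -> W (v ^+ i)%g] by rewrite mulVg.
    move=> /nbhs_mulgl; apply: filterS => y /= Wy.
    by exists (x^-1 * y)%g => //; rewrite mulVKg.
  have e1 : 0 < 1 / 16 :> R by lra.
  have e2 : 0 < 1 / 32 :> R by lra.
  apply: filterS (fI _ _ (blim x _ e1) (Fsmall B _ e2)) => j [/= H1 H2].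
  move=> _ [v Wv <-].
  have Bv : B v by apply: WB; have := Wv 1%N; rewrite expg1; apply.
  have B16 : B (v ^+ 16)%g by apply: WB; exact: Wv.
  set d := `|kappa B| / m_ j in H2.
  have d0 : 0 <= d by rewrite divr_ge0// ltW.
  have qE h k : B h -> B k -> `|(b_ j (h * k)%g - b (h * k)%g) -
      (b_ j h - b h) - (b_ j k - b k)| <= d.
    move=> Bh Bk; have := bdef j B h k cB Bh Bk; rewrite bM.
    by congr (`| _ | <= _); lra.
  have := quasi_hom_expg d0 qE Wv.
  have := qE _ _ Bx Bv; have := bB j _ B16; have := bB2 _ B16.
  move: H1 H2; set e16 := b_ j (v ^+ 16)%g; set f16 := b (v ^+ 16)%g.
  rewrite !ler_norml !ltr_norml; lra.
Qed.

(** After scaling to [d = 1], subtract the nearby combination of the components of pi1: centeredness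
    makes its integral against [K] zero, and the difference is bounded on [B]. *)
Lemma quasi_hom_int (mu : {measure set (borel G) -> \bar R}) (hG : hausdorff_space G)
    (mu_haar : left_haar mu) :
  exists2 m, 0 <= m & forall d A K, 0 < d -> quasi_hom kappa d A ->
    bcs K -> (forall x, 0 <= K x) -> (forall x, ~ B x -> K x = 0) ->
    \int[mu]_x K x = 1 -> (forall i, \int[mu]_x (K x * pi1 D i x) = 0) ->
    bcs (fun x => K x * A x) ->
    `|\int[mu]_x (K x * A x)| <= m * d.
Proof.
have muC := compact_haar_lty mu_haar.
have [m Hm] := quasi_hom_near_pi1; exists `|m| => // d A K d0 [qA bA] bK K0 KB K1 Kc bKA.
have qAd : quasi_hom kappa 1 (fun x => d^-1 * A x).
  split=> [C cC h k Ch Ck|C cC].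
    rewrite -!mulrBr normrM gtr0_norm ?invr_gt0// mulr1 mulrC ler_pdivrMr//.
    exact: qA.
  have [M HM] := bA _ cC; exists (d^-1 * M) => h Ch.
  by rewrite normrM gtr0_norm ?invr_gt0// ler_wpM2l ?HM// invr_ge0 ltW.
have [c Hc] := Hm _ qAd.
have bKp i : bcs (fun x => K x * pi1 D i x).
  by apply: bcsMr => //; apply: lbm_continuous; exact: pi1_continuous.
have bKc : bcs (fun x => K x * pi1_comb D c x).
  by apply: bcsMr => //; apply: lbm_continuous; exact: pi1_comb_continuous.
have Kc0 : \int[mu]_x (K x * pi1_comb D c x) = 0.
  have : forall s : seq 'I_(splitting_q D + splitting_r D),
      bcs (fun x => K x * \sum_(i <- s) c i * pi1 D i x) /\
      \int[mu]_x (K x * \sum_(i <- s) c i * pi1 D i x) = 0.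
    elim=> [|i s [ih1 ih2]].
      under eq_fun do rewrite big_nil.
      split; first by apply: bcsMr => //; exact: lbm_cst.
      by under eq_Rintegral do rewrite mulr0; rewrite /Rintegral integral0.
    have E x : K x * \sum_(i <- i :: s) c i * pi1 D i x =
        c i * (K x * pi1 D i x) + K x * \sum_(i <- s) c i * pi1 D i x.
      by rewrite big_cons mulrDr mulrCA.
    under eq_fun do rewrite E.
    split; first by apply: bcsD => //; exact: bcsZ.
    by rewrite bcs_intD//; [rewrite bcs_intZ// Kc ih2 mulr0 addr0|exact: bcsZ].
  by move=> /(_ (index_enum _))[].
have -> : \int[mu]_x (K x * A x) =
    d * \int[mu]_x (K x * (d^-1 * A x - pi1_comb D c x)).
  have E x : K x * (d^-1 * A x - pi1_comb D c x) =
      d^-1 * (K x * A x) - K x * pi1_comb D c x by ring.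
  under [in RHS]eq_Rintegral do rewrite E.
  rewrite bcs_intB//; last exact: bcsZ.
  by rewrite Kc0 subr0 bcs_intZ// mulVKf// gt_eqF.
rewrite normrM gtr0_norm// mulrC ler_pM2r//.
apply: le_trans (_ : \int[mu]_x (`|m| * K x) <= _); last first.
  by rewrite bcs_intZ// K1 mulr1.
apply: le_norm_bcs_int => //.
- have E x : K x * (d^-1 * A x - pi1_comb D c x) =
      d^-1 * (K x * A x) - K x * pi1_comb D c x by ring.
  under eq_fun do rewrite E; apply: bcsB => //; exact: bcsZ.
- exact: bcsZ.
- move=> x; have [Bx|nBx] := pselect (B x); last by rewrite KB// mul0r mulr0 normr0.
  rewrite normrM ger0_norm// mulrC ler_wpM2r//.
  by apply: le_trans (Hc _ Bx) _; exact: ler_norm.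
Qed.

End QuasiHom.

(** * Exponential inequalities, and weights that are Lipschitz almost everywhere *)

Section ExpInequalities.
Context {R : realType}.

Lemma expR_sub1_le (x : R) : `|expR x - 1| <= `|x| * expR `|x|.
Proof.
have h1 := expR_ge1Dx x; have h2 := expR_ge1Dx (- x).
have e0 := expR_gt0 x; have e1 : expR x * expR (- x) = 1.
  by rewrite -expRD subrr expR0.
have h3 : expR x - 1 <= x * expR x.
  have : expR x * (1 + - x) <= expR x * expR (- x) by rewrite ler_pM2l.
  rewrite e1; lra.
have [x0|x0] := leP 0 x.
  by rewrite !ger0_norm//; lra.
rewrite ltr0_norm; last by rewrite subr_lt0 -[ltRHS]expR0 ltr_expR.
rewrite ltr0_norm//; apply: (@le_trans _ _ (- x)); first lra.
rewrite -[leLHS]mulr1 ler_pM2l ?oppr_gt0//; apply: le_trans h2; lra.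
Qed.

Lemma expR_le_quadratic (x : R) : expR x <= 1 + x + x ^+ 2 * expR `|x|.
Proof.
have h1 := expR_ge1Dx x; have h2 := expR_sub1_le x.
have e0 := expR_gt0 x; have e1 : expR x * expR (- x) = 1.
  by rewrite -expRD subrr expR0.
have h3 : expR x - 1 <= x * expR x.
  have : expR x * (1 + - x) <= expR x * expR (- x).
    by rewrite ler_pM2l//; exact: expR_ge1Dx.
  rewrite e1; lra.
have h4 : x * (expR x - 1) <= x ^+ 2 * expR `|x|.
  apply: le_trans (ler_norm _) _; rewrite normrM -[x ^+ 2]real_normK ?num_real//.
  by rewrite expr2 -mulrA ler_wpM2l.
have h5 : x * (expR x - 1) = x * expR x - x by ring.
lra.
Qed.

End ExpInequalities.

Section AlmostEverywhere.
Context {R : realType} {G : topGroupType}.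
Variable mu : {measure set (borel G) -> \bar R}.
Hypothesis mu_haar : left_haar mu.

Lemma ae_translate (a : G) (P : G -> Prop) :
  {ae mu, forall x : borel G, P x} -> {ae mu, forall x : borel G, P (a * x)%g}.
Proof.
move=> [N [mN N0 PN]]; exists [set (a^-1 * x)%g | x in N]; split.
- rewrite (_ : [set _ | _ in _] = (fun x : G => a * x)%g @^-1` N).
    exact: (borel_preimage (@continuous_mulgl G a) mN).
  apply/seteqP; split => [_ [x Nx <-]|x Nx] /=; first by rewrite mulVKg.
  by exists (a * x)%g => //; rewrite mulKg.
- by rewrite (haar_invariant mu_haar).
- by move=> x nP; exists (a * x)%g; [exact: PN|rewrite mulKg].
Qed.

(** The common property of functions of class E and of [rho] on which the estimates rest. The
    exceptional null set may depend on [h], because the norm in class E is an essential supremum. *)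
Definition coarse_lipschitz (U : set G) (psi : G -> R) := lbm psi /\
  forall n h, setpow U n h ->
    {ae mu, forall g : borel G, `|psi (h * g)%g - psi g| <= n%:R}.

Lemma classE_coarse_lipschitz (U : set G) psi : open U -> generating_nbhd U ->
  classE mu U psi -> coarse_lipschitz U psi.
Proof.
move=> oU U_gen [mpsi lpsi pE]; split.
  split => // C cC.
  apply: (compact_local
    (P := fun C => exists M, forall x, C x -> `|psi x| <= M) cC).
  - by exists 0.
  - move=> A B [M AM] [N BN]; exists (Num.max M N) => x [/AM|/BN];
      by rewrite le_max => ->; rewrite ?orbT.
  - by move=> A B AB [M BM]; exists M => x /AB /BM.
  - move=> x _; have [M HM] := lpsi x.
    by exists [set h | `|psi h| <= M] => //; exists M.
have mu0 : (0 < mu [set: borel G])%E.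
  by rewrite lt0e (haar_neq0 mu_haar) measure_ge0.
have step u : U u ->
    {ae mu, forall g : borel G, `|psi (u * g)%g - psi g| <= 1}.
  move=> Uu; have Uv := generating_nbhdV U_gen Uu.
  (* [partial] evaluates psi at the inverse translate, so the increment along [u] is read off at
     [u^-1]. *)
  have : (Lnorm mu +oo (fun g : borel G => (partial u^-1%g psi g)%:E) <= 1)%E.
    by apply: le_trans pE; apply: ereal_sup_ubound; exists u^-1%g.
  rewrite unlock /= mu0 => /ess_supP; apply: filterS => g /=.
  by rewrite /partial /ltrans /= invgK lee_fin.
elim=> [|n ih] h /=.
  by move=> ->; apply: nearW => g; rewrite mul1g subrr normr0.
move=> [[u y] /= [Uu yn] <-].
(* The increment from [y g] to [u y g] is controlled for almost every [y g], hence for almost every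
   [g] by invariance. *)
have H1 := ae_translate (P := fun g => `|psi (u * g)%g - psi g| <= 1) y (step _ Uu).
apply: filterS2 H1 (ih _ yn) => g /= h1 h2.
rewrite -mulgA -[n.+1%:R]natr1.
move: h1 h2; rewrite !ler_norml; lra.
Qed.

End AlmostEverywhere.

Section Tensor.
Context {R : realType} {G : topGroupType}.
Implicit Types f k : G -> R.

Lemma lbm_fst f : lbm f -> lbm (fun z : G * G => f z.1).
Proof.
move=> lf; apply: (@lbm_comp R (G * G)%type G fst) => // z; exact: cvg_fst.
Qed.

Lemma lbm_snd f : lbm f -> lbm (fun z : G * G => f z.2).
Proof.
move=> lf; apply: (@lbm_comp R (G * G)%type G snd) => // z; exact: cvg_snd.
Qed.

Lemma bcs_tensor k f : bcs k -> bcs f -> bcs (fun z : G * G => k z.2 * f z.1).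
Proof.
move=> [lk [C cC k0]] [lf [D cD f0]]; split.
  by apply: lbmM; [exact: lbm_snd|exact: lbm_fst].
exists (D `*` C); first exact: compact_setX.
move=> [g h] /= nCD; have [Ch|/k0->] := pselect (C h); last by rewrite mul0r.
by rewrite f0 ?mulr0// => Dg; apply: nCD.
Qed.

End Tensor.

(** * The one-step estimate *)

Section Displacement.
Context {R : realType} {G : topGroupType}.
Variable mu : {measure set (borel G) -> \bar R}.
Hypotheses (hG : hausdorff_space G) (mu_haar : left_haar mu) (muR : open_radon mu).
Let muC := compact_haar_lty mu_haar.
Variable f : G -> R.
Hypothesis bf : bcs f.

Definition displacement (u : G) := \int[mu]_g (f g - f (u^-1 * g)%g) ^+ 2.

Let bfu u : bcs (fun g => (f g - f (u^-1 * g)%g) ^+ 2).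
Proof. by apply: bcsX; apply: bcsB => //; exact: bcs_translate. Qed.

Lemma displacement_ge0 u : 0 <= displacement u.
Proof. by apply: Rintegral_ge0 => g _; exact: sqr_ge0. Qed.

Lemma displacementE h k :
  displacement (h^-1 * k)%g = \int[mu]_g (f (h^-1 * g)%g - f (k^-1 * g)%g) ^+ 2.
Proof.
rewrite /displacement -(int_translate hG mu_haar h^-1%g (bfu _)).
by apply: eq_Rintegral => g _; rewrite invgM invgK mulgA mulgK.
Qed.

Lemma displacementV u : displacement u^-1%g = displacement u.
Proof.
have -> : (u^-1 = u^-1 * 1)%g by rewrite mulg1.
rewrite displacementE; apply: eq_Rintegral => g _.
by rewrite invg1 mul1g -sqrrN opprB.
Qed.

(** The triangle inequality in L^2, squared, after moving the second difference by [u]. *)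
Lemma displacementM u v : displacement (u * v)%g <= 2 * displacement u + 2 * displacement v.
Proof.
have -> : displacement v = \int[mu]_g (f (u^-1 * g)%g - f ((u * v)^-1 * g)%g) ^+ 2.
  by rewrite -displacementE mulKg.
have b1 : bcs (fun g => (f (u^-1 * g)%g - f ((u * v)^-1 * g)%g) ^+ 2).
  by apply: bcsX; apply: bcsB; exact: bcs_translate.
rewrite /displacement -!bcs_intZ// -bcs_intD//; [|exact: bcsZ|exact: bcsZ].
apply: bcs_le_int => //; first by apply: bcsD; exact: bcsZ.
move=> g; set a := f g; set b := f (u^-1 * g)%g; set c := f (_ * g)%g.
have := sqr_ge0 ((a - b) - (b - c)); lra.
Qed.

Lemma bcs_indR_sqr (S : set G) (X : G * G -> R) :
  bcs (fun z : G * G => indR S z.2 * X z) ->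
  bcs (fun z : G * G => indR S z.2 * X z ^+ 2).
Proof.
move=> /(bcsX 1); under eq_fun do rewrite exprMn.
congr bcs; apply/funext => z; congr (_ * _).
by have [Sz|nSz] := pselect (S z.2); rewrite ?(indR1 Sz) ?(indR0 nSz) ?expr1n ?expr0n.
Qed.

Lemma displacement_local_bcs : local_bcs displacement.
Proof.
move=> S oS pS.
have bS : bcs (indR S : G -> R) by apply: bcs_indR => //; exact: open_borel.
have bF : bcs (fun z : G * G => indR S z.2 * (f z.1 - f (z.2^-1 * z.1)%g) ^+ 2).
  apply: (@bcs_indR_sqr S (fun z => f z.1 - f (z.2^-1 * z.1)%g)).
  under eq_fun do rewrite mulrBr.
  by apply: bcsB; [exact: bcs_tensor|exact: bcs_conv].
have := bcs_partial_int muR muC (bcs_pswap bF).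
congr bcs; apply/funext => u /=.
by rewrite bcs_intZ.
Qed.

End Displacement.

Section OneStep.
Context {R : realType} {G : topGroupType}.
Variable mu : {measure set (borel G) -> \bar R}.
Hypotheses (hG : hausdorff_space G) (mu_haar : left_haar mu) (muR : open_radon mu).
Let muC := compact_haar_lty mu_haar.
Variables (K psi f : G -> R) (lam : R).
Hypotheses (bK : bcs K) (K0 : forall x, 0 <= K x) (K1 : \int[mu]_x K x = 1).
Hypotheses (lpsi : lbm psi) (bf : bcs f).

(** In the notation of the overview: [tw] is w, [tconv] is Tf, [drift] is A, [displacement] is D,
    and [tmass h], [tenergy h] are the integrals over g of w(g, h)^2 and (w(g, h) - Tf(g))^2. Here
    [f] already carries its exponential, so that [tconv] is the twisted operator. *)
Definition tw (g h : G) : R :=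
  expR (lam * (psi g - psi (h^-1 * g)%g)) * f (h^-1 * g)%g.

Definition tconv (g : G) : R := \int[mu]_h (K h * tw g h).

Definition tenergy (h : G) : R := \int[mu]_g (tw g h - tconv g) ^+ 2.

Definition tmass (h : G) : R := \int[mu]_g tw g h ^+ 2.

Definition drift (h : G) : R := \int[mu]_g (f g ^+ 2 * (psi (h * g)%g - psi g)).

Let N : R := \int[mu]_g f g ^+ 2.

Let bf2 : bcs (fun g => f g ^+ 2). Proof. exact: bcsX. Qed.

Let lex : lbm (fun z : G * G => expR (lam * (psi z.1 - psi (z.2^-1 * z.1)%g))).
Proof.
apply: lbm_expR; apply: lbmM; first exact: lbm_cst.
by apply: lbmB; [exact: lbm_fst|exact: (lbm_comp continuous_mulVg2)].
Qed.

Let ltw : lbm (fun z : G * G => tw z.1 z.2).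
Proof.
by apply: lbmM => //; apply: (lbm_comp continuous_mulVg2); exact: bcs_lbm.
Qed.

Let bktw k : bcs k -> bcs (fun z : G * G => k z.2 * tw z.1 z.2).
Proof.
move=> bk; have := bcsMl lex (bcs_conv bk bf).
by congr bcs; apply/funext => z; rewrite /tw mulrCA.
Qed.

Lemma bcs_tconv : bcs tconv.
Proof. exact: (bcs_partial_int muR muC (bktw bK)). Qed.

Let btw h : bcs (fun g => tw g h).
Proof.
apply: bcsMl; last exact: bcs_translate.
exact: (lbm_comp (@pair_continuousl G G h) lex).
Qed.

Let bkdev k : bcs k -> bcs (fun z : G * G => k z.2 * (tw z.1 z.2 - tconv z.1)).
Proof.
move=> bk; under eq_fun do rewrite mulrBr.
by apply: bcsB; [exact: bktw|apply: bcs_tensor => //; exact: bcs_tconv].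
Qed.

Let bdev h : bcs (fun g => (tw g h - tconv g) ^+ 2).
Proof. by apply: bcsX; apply: bcsB => //; exact: bcs_tconv. Qed.

Let bF1 : bcs (fun z : G * G => K z.2 * tw z.1 z.2 ^+ 2).
Proof.
have := bcsMr (bktw bK) ltw.
by congr bcs; apply/funext => z; rewrite expr2 mulrA.
Qed.

Let bF2 : bcs (fun z : G * G => K z.2 * (tw z.1 z.2 - tconv z.1) ^+ 2).
Proof.
have ld : lbm (fun z : G * G => tw z.1 z.2 - tconv z.1).
  by apply: lbmB => //; apply: lbm_fst; exact: bcs_lbm bcs_tconv.
have := bcsMr (bkdev bK) ld.
by congr bcs; apply/funext => z; rewrite expr2 mulrA.
Qed.

Lemma bcs_Ktmass : bcs (fun h => K h * tmass h).
Proof.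
have := bcs_partial_int muR muC (bcs_pswap bF1).
by congr bcs; apply/funext => h; rewrite /= bcs_intZ//; exact: bcsX.
Qed.

Lemma bcs_Ktenergy : bcs (fun h => K h * tenergy h).
Proof.
have := bcs_partial_int muR muC (bcs_pswap bF2).
by congr bcs; apply/funext => h; rewrite /= bcs_intZ.
Qed.

Lemma tenergy_ge0 h : 0 <= tenergy h.
Proof. by apply: Rintegral_ge0 => g _; exact: sqr_ge0. Qed.

Lemma tenergy_local_bcs : local_bcs tenergy.
Proof.
move=> S oS pS.
have bS : bcs (indR S : G -> R) by apply: bcs_indR => //; exact: open_borel.
have bF := @bcs_indR_sqr R G S (fun z => tw z.1 z.2 - tconv z.1) (bkdev bS).
have := bcs_partial_int muR muC (bcs_pswap bF).
by congr bcs; apply/funext => u /=; rewrite bcs_intZ.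
Qed.

(* For each g the numbers tw g h, averaged against K, have mean tconv g. *)
Lemma tconv_variance : \int[mu]_g tconv g ^+ 2 =
  \int[mu]_h (K h * tmass h) - \int[mu]_h (K h * tenergy h).
Proof.
have P g : tconv g ^+ 2 = \int[mu]_h (K h * tw g h ^+ 2) -
    \int[mu]_h (K h * (tw g h - tconv g) ^+ 2).
  have E h : K h * (tw g h - tconv g) ^+ 2 =
      (K h * tw g h ^+ 2 - 2 * tconv g * (K h * tw g h)) + tconv g ^+ 2 * K h.
    by ring.
  under [X in _ = _ - X]eq_Rintegral do rewrite E.
  have s1 := bcs_slicel g bF1; have s2 := bcs_slicel g (bktw bK).
  rewrite bcs_intD//; [|by apply: bcsB => //; exact: bcsZ|exact: bcsZ].
  rewrite bcs_intB//; last exact: bcsZ.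
  by rewrite !bcs_intZ// K1 -/(tconv g); ring.
under eq_Rintegral do rewrite P.
rewrite bcs_intB//; last 2 first.
- exact: (bcs_partial_int muR muC bF1).
- exact: (bcs_partial_int muR muC bF2).
rewrite (bcs_fubini muR muR muC muC bF1) (bcs_fubini muR muR muC muC bF2).
congr (_ - _); apply: eq_Rintegral => h _ /=; rewrite bcs_intZ//.
exact: bcsX.
Qed.

Lemma tmassE h : tmass h =
  \int[mu]_g (expR (2 * (lam * (psi (h * g)%g - psi g))) * f g ^+ 2).
Proof.
rewrite /tmass -(int_translate hG mu_haar h (bcsX 1 (btw h))).
apply: eq_Rintegral => g _; rewrite /tw mulKg exprMn -expRM_natl.
by [].
Qed.

Section Lipschitz.
Variables (h : G) (L : R).
Hypotheses (L0 : 0 <= L).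
Hypothesis hL : {ae mu, forall g : borel G, `|psi (h * g)%g - psi g| <= L}.

Let ldpsi : lbm (fun g => psi (h * g)%g - psi g).
Proof. by apply: lbmB => //; exact: (lbm_comp (@continuous_mulgl G h)). Qed.

Let lexp c : lbm (fun g => expR (c * (lam * (psi (h * g)%g - psi g)))).
Proof.
by apply: lbm_expR; do ! (apply: lbmM; first exact: lbm_cst).
Qed.

Lemma tmass_le : tmass h <= expR (2 * L * `|lam|) * N.
Proof.
rewrite tmassE -bcs_intZ//.
apply: bcs_ae_le_int => //; [exact: bcsMl|exact: bcsZ|].
apply: filterS hL => g hg; rewrite ler_wpM2r ?sqr_ge0// ler_expR -mulrA ler_wpM2l//.
apply: le_trans (ler_norm _) _; rewrite normrM mulrC; exact: ler_wpM2r.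
Qed.

Let bdrift : bcs (fun g => f g ^+ 2 * (psi (h * g)%g - psi g)).
Proof. exact: bcsMr. Qed.

Lemma drift_le : `|drift h| <= L * N.
Proof.
rewrite ler_norml /drift -mulNr -!bcs_intZ//; apply/andP; split;
  (apply: bcs_ae_le_int => //; [exact: bcsZ|]);
  apply: filterS hL => g; rewrite ler_norml => /andP[h1 h2];
  by rewrite [f g ^+ 2 * _]mulrC ler_wpM2r ?sqr_ge0.
Qed.

Hypothesis lam1 : `|lam| <= 1.

Let arg_le (d : R) : `|d| <= L -> `|lam * d| <= L /\ (lam * d) ^+ 2 <= L ^+ 2 * lam ^+ 2.
Proof.
move=> dL; split.
  by rewrite normrM -[leRHS]mul1r ler_pM.
rewrite exprMn mulrC ler_wpM2r ?sqr_ge0//.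
by rewrite -[d ^+ 2]real_normK ?num_real// lerXn2r ?nnegrE.
Qed.

(** Substituting [h g] for [g] puts the weight e^(2 x), x = lam (psi (h g) - psi g), on [f g ^+ 2].
    The first order term of the exponential is the drift; the quadratic remainder is at most 4 x^2
    e^(2 |x|) with |x| <= L |lam|. *)
Lemma tmass_le_drift : tmass h <=
  N + 2 * lam * drift h + 4 * L ^+ 2 * expR (2 * L) * lam ^+ 2 * N.
Proof.
rewrite tmassE /drift -!bcs_intZ// -!bcs_intD//; try exact: bcsZ;
  try (by apply: bcsD => //; exact: bcsZ).
apply: bcs_ae_le_int => //; first exact: bcsMl.
  by do ! apply: bcsD => //; exact: bcsZ.
apply: filterS hL => g /arg_le[]; set x := lam * _ => xL x2.
rewrite (_ : _ + _ = (1 + 2 * x + 4 * L ^+ 2 * expR (2 * L) * lam ^+ 2) * f g ^+ 2).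
  rewrite ler_wpM2r ?sqr_ge0//; apply: le_trans (expR_le_quadratic _) _.
  rewrite lerD2l exprMn normrM ger0_norm//.
  have : expR (2 * `|x|) <= expR (2 * L) by rewrite ler_expR ler_wpM2l.
  have := expR_gt0 (2 * `|x|); have := sqr_ge0 x.
  set a := x ^+ 2 in x2 *; set e := expR _; set e' := expR _ => a0 e0 ee'.
  rewrite (_ : 2 ^+ 2 * a * e = 4 * (a * e)); last by ring.
  rewrite (_ : _ * e' * _ = 4 * (L ^+ 2 * lam ^+ 2 * e')); last by ring.
  by rewrite ler_wpM2l// ler_pM// ltW.
by rewrite /x; ring.
Qed.

(** After the same substitution the difference is (e^x - 1) f, of order |lam|. *)
Lemma untwist_le : \int[mu]_g (f (h^-1 * g)%g - tw g h) ^+ 2 <=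
  L ^+ 2 * expR (2 * L) * lam ^+ 2 * N.
Proof.
have b1 : bcs (fun g => (f (h^-1 * g)%g - tw g h) ^+ 2).
  by apply: bcsX; apply: bcsB => //; exact: bcs_translate.
rewrite -(int_translate hG mu_haar h b1) -bcs_intZ//.
apply: bcs_ae_le_int => //; [exact: (bcs_translate h b1)|exact: bcsZ|].
apply: filterS hL => g /arg_le[]; rewrite /tw !mulKg; set x := lam * _ => xL x2.
rewrite (_ : f g - _ = - ((expR x - 1) * f g)); last by ring.
rewrite sqrrN exprMn ler_wpM2r ?sqr_ge0//.
have h1 := expR_sub1_le x.
have h2 : (expR x - 1) ^+ 2 <= (`|x| * expR `|x|) ^+ 2.
  by rewrite -[(expR x - 1) ^+ 2]real_normK ?num_real// lerXn2r ?nnegrE// mulr_ge0 ?expR_ge0.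
apply: le_trans h2 _; rewrite exprMn real_normK ?num_real// [leRHS]mulrAC -expRM_natl.
by rewrite ler_pM ?sqr_ge0 ?expR_ge0// ler_expR ler_wpM2l.
Qed.

End Lipschitz.

(** Between the translates by [h] and by [k] insert w(., h), the mean Tf and w(., k): two of the
    four differences are deviations from the mean, two are untwisting errors. The square of a sum of
    four terms costs the factor 4. *)
Lemma displacement_le_tenergy (h k : G) (L : R) : 0 <= L -> `|lam| <= 1 ->
  {ae mu, forall g : borel G, `|psi (h * g)%g - psi g| <= L} ->
  {ae mu, forall g : borel G, `|psi (k * g)%g - psi g| <= L} ->
  displacement mu f (h^-1 * k)%g <= 4 * tenergy h + 4 * tenergy k +
    8 * (L ^+ 2 * expR (2 * L) * lam ^+ 2 * N).
Proof.
move=> L0 lam1 hL kL; rewrite displacementE//.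
have b1 l : bcs (fun g => (f (l^-1 * g)%g - tw g l) ^+ 2).
  by apply: bcsX; apply: bcsB => //; exact: bcs_translate.
apply: (@le_trans _ _ (4 * tenergy h + 4 * tenergy k +
  (4 * \int[mu]_g (f (h^-1 * g)%g - tw g h) ^+ 2 +
   4 * \int[mu]_g (f (k^-1 * g)%g - tw g k) ^+ 2))); last first.
  have := untwist_le L0 hL lam1; have := untwist_le L0 kL lam1; lra.
rewrite -!bcs_intZ// -!bcs_intD//; try exact: bcsZ;
  try (by do ! apply: bcsD; exact: bcsZ).
apply: bcs_le_int => //.
- by apply: bcsX; apply: bcsB; exact: bcs_translate.
- by do ! apply: bcsD; exact: bcsZ.
- move=> g.
  set a := f (h^-1 * g)%g; set b := f (k^-1 * g)%g; set c := tw g h; set d := tw g k.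
  set e := tconv g.
  have := sqr_ge0 ((c - e) + (d - e)); have := sqr_ge0 ((a - c) + (b - d)).
  have := sqr_ge0 ((c - e) - (d - e) - (a - c) + (b - d)); lra.
Qed.

End OneStep.

Lemma normM_le_young (R : realFieldType) (t a b : R) : 0 < t ->
  `|a * b| <= 2^-1 * t * a ^+ 2 + 2^-1 * t^-1 * b ^+ 2.
Proof.
move=> t0; have t'0 : 0 < t^-1 by rewrite invr_gt0.
have tt : t * t^-1 = 1 by rewrite mulfV// gt_eqF.
have p : forall x : R, 0 <= t^-1 * (t * a + x * b) ^+ 2.
  by move=> x; rewrite mulr_ge0 ?sqr_ge0// ltW.
have E x : t^-1 * (t * a + x * b) ^+ 2 =
    t * a ^+ 2 + 2 * x * (a * b) + t^-1 * x ^+ 2 * b ^+ 2.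
  by field; rewrite gt_eqF.
have := p 1; have := p (- 1); rewrite !E => h1 h2.
by rewrite ler_norml; apply/andP; split; lra.
Qed.

Section DriftDefect.
Context {R : realType} {G : topGroupType}.
Variable mu : {measure set (borel G) -> \bar R}.
Hypotheses (hG : hausdorff_space G) (mu_haar : left_haar mu).
Let muC := compact_haar_lty mu_haar.
Variables (psi f : G -> R).
Hypotheses (lpsi : lbm psi) (bf : bcs f).

(** Substituting [k g] for [g] in the drift of [h] turns the defect into the integral of (f_k^2 -
    f^2)(psi (h g) - psi g). Then f_k^2 - f^2 factors into a difference, paid for by the
    displacement of [k], and a sum, paid for by the norm of [f], with weights t and 1/t. *)
Lemma drift_defect (h k : G) (L t : R) : 0 < t ->
  {ae mu, forall g : borel G, `|psi (h * g)%g - psi g| <= L} -> 0 <= L ->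
  `|drift mu psi f (h * k)%g - drift mu psi f h - drift mu psi f k| <=
  L * (2^-1 * t * displacement mu f k + 2 * t^-1 * \int[mu]_g f g ^+ 2).
Proof.
move=> t0 hL L0.
have ld l : lbm (fun g => psi (l * g)%g - psi g).
  by apply: lbmB => //; exact: (lbm_comp (@continuous_mulgl G l)).
have bf2 : bcs (fun g => f g ^+ 2) by exact: bcsX.
have bfk : bcs (fun g => f (k^-1 * g)%g) by exact: bcs_translate.
have bfk2 : bcs (fun g => f (k^-1 * g)%g ^+ 2) by exact: bcsX.
have bX : bcs (fun g => f (k^-1 * g)%g ^+ 2 * (psi (h * g)%g - psi g)).
  exact: bcsMr.
have bd l : bcs (fun g => f g ^+ 2 * (psi (l * g)%g - psi g)) by exact: bcsMr.
have -> : drift mu psi f (h * k)%g - drift mu psi f h - drift mu psi f k =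
    \int[mu]_g ((f (k^-1 * g)%g ^+ 2 - f g ^+ 2) * (psi (h * g)%g - psi g)).
  have E1 g : (f (k^-1 * g)%g ^+ 2 - f g ^+ 2) * (psi (h * g)%g - psi g) =
    f (k^-1 * g)%g ^+ 2 * (psi (h * g)%g - psi g) -
    f g ^+ 2 * (psi (h * g)%g - psi g) by rewrite mulrBl.
  under [RHS]eq_Rintegral do rewrite E1.
  rewrite bcs_intB// -(int_translate hG mu_haar k bX) /drift.
  under [X in _ = X - _]eq_Rintegral do rewrite mulKg mulgA.
  have E2 g : f g ^+ 2 * (psi (h * k * g)%g - psi (k * g)%g) =
    f g ^+ 2 * (psi (h * k * g)%g - psi g) - f g ^+ 2 * (psi (k * g)%g - psi g).
    by ring.
  under [X in _ = X - _]eq_Rintegral do rewrite E2.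
  by rewrite bcs_intB//; ring.
have bfd : bcs (fun g => (f g - f (k^-1 * g)%g) ^+ 2) by apply: bcsX; exact: bcsB.
have b1 : bcs (fun g => (f (k^-1 * g)%g ^+ 2 - f g ^+ 2) * (psi (h * g)%g - psi g)).
  by apply: bcsMr => //; exact: bcsB.
pose Y g := L * (2^-1 * t * (f g - f (k^-1 * g)%g) ^+ 2 +
   (t^-1 * f g ^+ 2 + t^-1 * f (k^-1 * g)%g ^+ 2)).
have bY : bcs Y.
  by apply: bcsZ; apply: bcsD; [exact: bcsZ|apply: bcsD; exact: bcsZ].
have -> : L * (2^-1 * t * displacement mu f k + 2 * t^-1 * \int[mu]_g f g ^+ 2) =
    \int[mu]_g Y g.
  rewrite /Y bcs_intZ//; last by apply: bcsD; [exact: bcsZ|apply: bcsD; exact: bcsZ].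
  rewrite bcs_intD//; [|exact: bcsZ|by apply: bcsD; exact: bcsZ].
  rewrite bcs_intD//; [|exact: bcsZ|exact: bcsZ].
  rewrite !bcs_intZ// (int_translate hG mu_haar k^-1%g bf2) /displacement.
  by congr (_ * (_ + _)); ring.
have pt : {ae mu, forall g : borel G,
    `|(f (k^-1 * g)%g ^+ 2 - f g ^+ 2) * (psi (h * g)%g - psi g)| <= Y g}.
  apply: filterS hL => g hg; rewrite normrM mulrC; apply: ler_pM => //.
  rewrite (_ : _ - _ = (f g - f (k^-1 * g)%g) * (- (f g + f (k^-1 * g)%g))); last by ring.
  apply: le_trans (normM_le_young _ _ t0) _; rewrite lerD2l sqrrN.
  have t'0 : 0 < t^-1 by rewrite invr_gt0.
  set a := f g; set b := f _.
  have := mulr_ge0 (ltW t'0) (sqr_ge0 (a - b)); lra.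
rewrite ler_norml; apply/andP; split.
  rewrite lerNl -[leLHS]mulN1r -bcs_intZ//; apply: bcs_ae_le_int => //; first exact: bcsZ.
  by apply: filterS pt => g; rewrite ler_norml => /andP[h1 _]; lra.
by apply: bcs_ae_le_int => //; apply: filterS pt => g; exact: le_trans (ler_norm _).
Qed.

End DriftDefect.

Section OneStepBound.
Context {R : realType} {G : topGroupType}.
Variable mu : {measure set (borel G) -> \bar R}.
Hypotheses (hG : hausdorff_space G) (mu_haar : left_haar mu).
Variables (D : splitting R G) (U W B : set G) (eps : R).
Hypotheses (oU : open U) (U_gen : generating_nbhd U).
Hypotheses (oW : open W) (W_gen : generating_nbhd W).
Hypotheses (cB : compact B) (WB : W `<=` B) (eps0 : 0 < eps).
Let muC := compact_haar_lty mu_haar.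
Let muR : open_radon mu. Proof. exact: (haar_open_radon hG mu_haar oU U_gen). Qed.

(** [B] is a compact set standing for the closure of W'. The constants below depend on the kernel
    only through [W], [B] and [eps]. *)
Record step_kernel (K : G -> R) : Prop := StepKernel {
  step_bcs : bcs K;
  step_ge0 : forall x, 0 <= K x;
  step_supp : forall x, ~ B x -> K x = 0;
  step_int : \int[mu]_x K x = 1;
  step_centered : forall i, \int[mu]_x (K x * pi1 D i x) = 0;
  step_lower : forall x, W x -> eps <= K x }.

(** Drop the deviation term and bound each mass by e^(2 n |lam|) times the norm, where [B] lies in
    the [n]-th power of [U]. *)
Lemma tconv_trivial_bound : exists2 L : R, 0 <= L &
  forall (K psi : G -> R) (lam : R) (f : G -> R), step_kernel K -> coarse_lipschitz mu U psi -> bcs f ->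
  \int[mu]_g tconv mu K psi f lam g ^+ 2 <=
    expR (L * `|lam|) * \int[mu]_g f g ^+ 2.
Proof.
have [n _ Bn] := compact_setpow U_gen oU cB.
exists (2 * n%:R); first by rewrite mulr_ge0.
move=> K psi lam f [bK K0 KB K1 _ _] [lpsi psiL] bf.
rewrite (tconv_variance hG mu_haar muR _ bK K1 lpsi bf).
apply: (@le_trans _ _ (\int[mu]_h (K h * tmass mu psi f lam h))).
  rewrite gerBl; apply: Rintegral_ge0 => h _; rewrite mulr_ge0//.
  exact: tenergy_ge0.
have bKm := @bcs_Ktmass R G mu hG mu_haar muR K psi f lam bK lpsi bf.
apply: (@le_trans _ _ (\int[mu]_h
    (expR (2 * n%:R * `|lam|) * \int[mu]_g f g ^+ 2 * K h))).
  apply: bcs_le_int => //; first exact: bcsZ.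
  move=> h; have [Bh|nBh] := pselect (B h); last by rewrite KB// mul0r mulr0.
  rewrite mulrC ler_wpM2r//; apply: tmass_le => //.
  exact: (psiL _ _ (Bn _ Bh)).
by rewrite bcs_intZ// K1 mulr1.
Qed.

Lemma tconv_small_bound : exists2 w : R, 0 <= w &
  forall (K psi : G -> R) (lam : R) (f : G -> R), step_kernel K -> coarse_lipschitz mu U psi -> bcs f ->
  `|lam| <= 1 -> 0 < \int[mu]_g f g ^+ 2 ->
  \int[mu]_g tconv mu K psi f lam g ^+ 2 <=
    (1 + w * lam ^+ 2) * \int[mu]_g f g ^+ 2.
Proof.
have [n n0 Bn] := compact_setpow U_gen oU cB.
pose L : R := n%:R; have L0 : 0 <= L by exact: ler0n.
(* [kappa] must be a function of the compact set alone, chosen before the kernel, psi and [f]; so an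
   exponent and a propagation constant are selected for every set at once. *)
have /choice[cn Hcn] : forall C : set G, exists c : nat * R, compact C ->
    [/\ C `<=` setpow U c.1, 0 <= c.2 & forall D E Y, spread mu W D E Y ->
     forall h, C h -> D h <= c.2 * Y].
  move=> C; have [cC|ncC] := pselect (compact C); last by exists (0%N, 0).
  have [m _ Cm] := compact_setpow U_gen oU cC.
  have [c c0 Hc] := spread_bound hG mu_haar oW W_gen cC.
  by exists (m, c).
(* From [drift_defect]: with [n] and [c] the two selected numbers, n (t c Y / 2 + 2 N / t) is at
   most n (c / 2 + 2) (t Y + N / t). *)
pose kappa (C : set G) : R := (cn C).1%:R * (2^-1 * (cn C).2 + 2).
have [m m0 Hm] := quasi_hom_int D oW W_gen cB WB kappa hG mu_haar.
pose a := 8 * (L ^+ 2 * expR (2 * L)).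
have a0 : 0 <= a by rewrite !mulr_ge0 ?sqr_ge0 ?expR_ge0.
(* Chosen so that 2 m (4 / eps) / M <= 1, which makes the multiple of [Q] produced by the drift at
   most [Q]; the summand 1 gives M >= 1. *)
pose M := 8 * m / eps + 1.
have M0 : 0 < M by rewrite ltr_wpDl// divr_ge0 ?mulr_ge0// ltW.
(* The three summands come from the quadratic remainder of the mass, from the untwisting error
   inside [Y], and from N / t = M |lam| N. *)
exists (4 * L ^+ 2 * expR (2 * L) + 2 * m * a + 2 * m * M).
  by rewrite !addr_ge0// !mulr_ge0 ?sqr_ge0 ?expR_ge0// ltW.
move=> K psi lam f sK [lpsi psiL] bf lam1; set N := \int[mu]_g f g ^+ 2 => N0.
have [bK K0 KB K1 Kc KW] := sK.
have LB h : B h -> {ae mu, forall g : borel G, `|psi (h * g)%g - psi g| <= L}.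
  by move=> Bh; exact: (psiL _ _ (Bn _ Bh)).
rewrite (tconv_variance hG mu_haar muR _ bK K1 lpsi bf).
set Q := \int[mu]_h (K h * tenergy mu K psi f lam h).
have bE := @bcs_Ktenergy R G mu hG mu_haar muR K psi f lam bK lpsi bf.
have Q0 : 0 <= Q.
  by apply: Rintegral_ge0 => h _; rewrite mulr_ge0//; exact: tenergy_ge0.
have bf2 : bcs (fun g => f g ^+ 2) by exact: bcsX.
have bKd : bcs (fun h => K h * drift mu psi f h).
  have ldd : lbm (fun z : G * G => psi (z.2 * z.1)%g - psi z.1).
    apply: lbmB; last exact: lbm_fst.
    apply: (lbm_comp (c := fun z : G * G => (z.2 * z.1)%g)) => //.
    by apply: continuous_mulg => z; [exact: cvg_snd|exact: cvg_fst].
  have bF := bcsMr (bcs_tensor bK bf2) ldd.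
  have := bcs_partial_int muR muC (bcs_pswap bF).
  congr bcs; apply/funext => h /=; rewrite -bcs_intZ//.
    by apply: eq_Rintegral => g _; rewrite mulrA.
  apply: bcsMr => //; apply: lbmB => //.
  exact: (lbm_comp (@continuous_mulgl G h)).
set J := \int[mu]_h (K h * drift mu psi f h).
have mass : \int[mu]_h (K h * tmass mu psi f lam h) <=
    N + 2 * lam * J + 4 * L ^+ 2 * expR (2 * L) * lam ^+ 2 * N.
  have -> : N + 2 * lam * J + 4 * L ^+ 2 * expR (2 * L) * lam ^+ 2 * N =
    \int[mu]_h ((N + 4 * L ^+ 2 * expR (2 * L) * lam ^+ 2 * N) * K h +
      2 * lam * (K h * drift mu psi f h)).
    rewrite bcs_intD//; [|exact: bcsZ|exact: bcsZ].
    by rewrite !bcs_intZ// K1 -/J; ring.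
  apply: bcs_le_int => //.
  - exact: (@bcs_Ktmass R G mu hG mu_haar muR K psi f lam bK lpsi bf).
  - by apply: bcsD; exact: bcsZ.
  move=> h; have [Bh|nBh] := pselect (B h); last first.
    by rewrite KB// !(mul0r, mulr0) addr0.
  have := ler_wpM2l (K0 h) (tmass_le_drift hG mu_haar lpsi bf L0 (LB _ Bh) lam1).
  by rewrite -/N => /le_trans; apply; rewrite le_eqVlt; apply/orP; left; apply/eqP; ring.
have [l0|lamn0] := eqVneq lam 0.
  rewrite lerBlDr; apply: le_trans mass _.
  by rewrite l0 expr0n /= !(mulr0, mul0r) !addr0 mul1r lerDl.
(* The first term is the untwisting error; the second bounds the integral over [W] of four times the
   deviation, because the kernel is at least [eps] there. *)
pose Y := a * lam ^+ 2 * N + 4 / eps * Q.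
have sp : spread mu W (displacement mu f) (fun h => 4 * tenergy mu K psi f lam h) Y.
  have E0 h : 0 <= tenergy mu K psi f lam h by exact: tenergy_ge0.
  have lE := tenergy_local_bcs hG mu_haar muR lam bK lpsi bf.
  have l4E : local_bcs (fun h => 4 * tenergy mu K psi f lam h).
    by move=> S oS pS; under eq_fun do rewrite mulrCA; apply: bcsZ; exact: lE.
  split => //.
  - exact: displacement_local_bcs.
  - exact: displacement_ge0.
  - by move=> h; rewrite mulr_ge0.
  - exact: displacementV.
  - exact: displacementM.
  - move=> h k Wh Wk.
    have := displacement_le_tenergy hG mu_haar muR bK lpsi bf L0 lam1
      (LB _ (WB Wh)) (LB _ (WB Wk)).
    rewrite -/N /Y => /le_trans; apply; rewrite lerD2l.
    rewrite (_ : 8 * _ = a * lam ^+ 2 * N); last by rewrite /a; ring.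
    by rewrite lerDl mulr_ge0// divr_ge0// ltW.
  - apply: (@le_trans _ _ (4 / eps * Q)); last first.
    rewrite /Y lerDr; apply: mulr_ge0; last exact: ltW.
    by apply: mulr_ge0 => //; exact: sqr_ge0.
    rewrite -bcs_intZ//; apply: bcs_le_int => //; last first.
      move=> h; have [Wh|nWh] := pselect (W h); last first.
        by rewrite (indR0 nWh) mul0r !mulr_ge0// invr_ge0 ltW.
      rewrite (indR1 Wh) mul1r mulrA ler_wpM2r// -mulrA -[leLHS]mulr1 ler_wpM2l//.
      by rewrite mulrC ler_pdivlMr// mul1r; exact: KW.
      exact: bcsZ.
    by apply: l4E => //; case: W_gen.
pose t := (M * `|lam|)^-1.
have t0 : 0 < t by rewrite invr_gt0 mulr_gt0// normr_gt0.
pose d := t * Y + t^-1 * N.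
have Y0 : 0 <= Y.
  rewrite /Y; apply: addr_ge0; last first.
    by apply: mulr_ge0 => //; rewrite divr_ge0// ltW.
  apply: mulr_ge0; last exact: ltW.
  by apply: mulr_ge0 => //; exact: sqr_ge0.
have d0 : 0 < d.
  by rewrite /d ltr_wpDl//; [rewrite mulr_ge0// ltW|rewrite mulr_gt0// invr_gt0].
have qA : quasi_hom kappa d (drift mu psi f).
  split => C cC.
    move=> h k Ch Ck; have [Cn c0 Hc] := Hcn _ cC.
    have hn := psiL _ _ (Cn _ Ch).
    apply: le_trans (drift_defect hG mu_haar lpsi bf k t0 hn (ler0n _ _)) _.
    rewrite /kappa -[leRHS]mulrA ler_wpM2l// -/N /d.
    have Dk := Hc _ _ _ sp _ Ck.
    have tD : t * displacement mu f k <= t * ((cn C).2 * Y) by rewrite ler_wpM2l// ltW.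
    have tY : 0 <= t * Y by rewrite mulr_ge0// ltW.
    have tN : 0 <= (cn C).2 * (t^-1 * N).
      by apply: mulr_ge0 => //; apply: mulr_ge0;
      [rewrite invr_ge0 ltW|exact: ltW].
    lra.
  have [Cn _ _] := Hcn _ cC; exists ((cn C).1%:R * N) => h Ch.
  by apply: drift_le => //; exact: (psiL _ _ (Cn _ Ch)).
(* Centeredness enters here, bringing the first order term down to order [d = t Y + N / t]. *)
have HJ := Hm d _ K d0 qA bK K0 KB K1 Kc bKd; rewrite -/J in HJ.
have lamJ : 2 * lam * J <= 2 * m * (M^-1 * Y) + 2 * m * M * lam ^+ 2 * N.
  apply: (@le_trans _ _ (2 * `|lam| * (m * d))).
    rewrite -!mulrA ler_wpM2l//; apply: le_trans (ler_norm _) _.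
    by rewrite normrM ler_wpM2l.
  rewrite le_eqVlt; apply/orP; left; apply/eqP.
  rewrite /d /t invrK -[lam ^+ 2]real_normK ?num_real//.
  by field; rewrite gt_eqF//= normr_eq0.
have M1 : M^-1 <= 1 by rewrite invf_le1// lerDr divr_ge0 ?mulr_ge0// ltW.
have QM : 2 * m * (M^-1 * (4 / eps * Q)) <= Q.
  rewrite (_ : 2 * m * _ = (8 * m / eps) / M * Q); last by field; rewrite !gt_eqF.
  by rewrite -[leRHS]mul1r ler_wpM2r// ler_pdivrMr// mul1r /M lerDl ler01.
have aM : 2 * m * (M^-1 * (a * lam ^+ 2 * N)) <= 2 * m * (a * lam ^+ 2 * N).
  rewrite ler_wpM2l ?mulr_ge0// -[leRHS]mul1r ler_wpM2r//.
  apply: mulr_ge0; last exact: ltW.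
  by apply: mulr_ge0 => //; exact: sqr_ge0.
move: lamJ; rewrite /Y !mulrDr => lamJ; lra.
Qed.

(** For |lam| > 1 the crude exponent L |lam| is at most L lam^2. The case of vanishing norm is also
    taken from the crude bound, as the refined one requires [d > 0]. *)
Theorem tconv_L2_bound : exists2 w : R, 0 < w &
  forall (K psi : G -> R) (lam : R) (f : G -> R), step_kernel K ->
  coarse_lipschitz mu U psi -> bcs f ->
  \int[mu]_g tconv mu K psi f lam g ^+ 2 <=
    expR (w * lam ^+ 2) * \int[mu]_g f g ^+ 2.
Proof.
have [L L0 HL] := tconv_trivial_bound; have [w w0 Hw] := tconv_small_bound.
exists (L + w + 1); first by rewrite ltr_wpDl// addr_ge0.
move=> K psi lam f sK lp bf; set N := \int[mu]_g f g ^+ 2.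
have N0 : 0 <= N by apply: Rintegral_ge0 => g _; exact: sqr_ge0.
have l2 := sqr_ge0 lam.
have [lam1|lam1] := leP `|lam| 1; last first.
  apply: le_trans (HL K psi lam f sK lp bf) _; rewrite ler_wpM2r// ler_expR.
  have : `|lam| <= lam ^+ 2.
    by rewrite -[lam ^+ 2]real_normK ?num_real// expr2 ler_peMl// ltW.
  move=> h; have := ler_wpM2l L0 h.
  have := mulr_ge0 w0 l2; lra.
have [N00|Nn0] := eqVneq N 0.
  by apply: le_trans (HL K psi lam f sK lp bf) _; rewrite -/N N00 !mulr0.
have Np : 0 < N by rewrite lt_neqAle eq_sym Nn0.
apply: le_trans (Hw K psi lam f sK lp bf lam1 Np) _; rewrite -/N ler_wpM2r//.
apply: le_trans (expR_ge1Dx _) _; rewrite ler_expR.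
have := mulr_ge0 L0 l2; lra.
Qed.

End OneStepBound.

(** * Extension to nonnegative functions with values in the extended reals *)

Lemma ge0_cvg_integral d (T : measurableType d) (R : realType)
    (mu : {measure set T -> \bar R}) (u : nat -> T -> \bar R) (f : T -> \bar R) :
  (forall n, measurable_fun setT (u n)) -> (forall n x, (0 <= u n x)%E) ->
  (forall x m n, (m <= n)%N -> (u m x <= u n x)%E) ->
  (forall x, u ^~ x @ \oo --> f x) ->
  (fun n => \int[mu]_x u n x)%E @ \oo --> (\int[mu]_x f x)%E.
Proof.
move=> mu' u0 ndu cu.
rewrite [X in _ --> X](_ : _ = \int[mu]_x limn (fun n => u n x))%E.
  by apply: cvg_monotone_convergence => // x _ m n mn; exact: ndu.
by apply: eq_integral => x _; apply/esym/cvg_lim => //; exact: cu.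
Qed.

Section EConvolution.
Context {R : realType} {G : topGroupType}.
Variable mu : {measure set (borel G) -> \bar R}.
Hypothesis muR : open_radon mu.
Implicit Types (K : G -> R) (phi : borel G -> \bar R).
Local Open Scope ereal_scope.
Local Notation bmeas F := (measurable_fun setT (F : borel G -> \bar R)).

Definition econv K phi : borel G -> \bar R :=
  fun g => \int[mu]_h ((K h)%:E * phi (h^-1 * g)%g).

Lemma econv_integrand_measurable K phi :
  measurable_fun setT (K : borel G -> measurableTypeR R) -> bmeas phi ->
  measurable_fun setT
    ((fun z => (K z.2)%:E * phi (z.2^-1 * z.1)%g) : borel (G * G)%type -> \bar R).
Proof.
move=> mK mphi; apply: emeasurable_funM.
  apply/measurable_EFinP; apply: (borel_comp (c := snd)) => //.
  by move=> z; exact: cvg_snd.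
exact: (borel_comp continuous_mulVg2).
Qed.

Lemma econv_slice_measurable K phi g :
  measurable_fun setT (K : borel G -> measurableTypeR R) -> bmeas phi ->
  bmeas (fun h => (K h)%:E * phi (h^-1 * g)%g).
Proof.
move=> mK mphi; exact: (slice_fun_measurable g (econv_integrand_measurable mK mphi)).
Qed.

Lemma econv_measurable K phi :
  measurable_fun setT (K : borel G -> measurableTypeR R) -> bmeas phi ->
  (forall x, (0 <= K x)%R) -> (forall x, 0 <= phi x) -> bmeas (econv K phi).
Proof.
move=> mK mphi K0 phi0.
apply: (slice_integral_measurable muR (econv_integrand_measurable mK mphi)).
by move=> z; rewrite mule_ge0// lee_fin.
Qed.

Lemma econv_ge0 K phi g : (forall x, (0 <= K x)%R) -> (forall x, 0 <= phi x) ->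
  0 <= econv K phi g.
Proof.
by move=> K0 phi0; apply: integral_ge0 => h _; rewrite mule_ge0// lee_fin.
Qed.

Lemma le_econv K phi1 phi2 g :
  measurable_fun setT (K : borel G -> measurableTypeR R) ->
  bmeas phi1 -> bmeas phi2 ->
  (forall x, (0 <= K x)%R) -> (forall x, 0 <= phi1 x) ->
  (forall x, phi1 x <= phi2 x) -> econv K phi1 g <= econv K phi2 g.
Proof.
move=> mK m1 m2 K0 p0 p12; apply: ge0_le_integral => //.
- by move=> h _; rewrite mule_ge0// lee_fin.
- exact: econv_slice_measurable.
- exact: econv_slice_measurable.
- by move=> h _; rewrite lee_wpmul2l// lee_fin.
Qed.

Fixpoint econvn (K_ : nat -> G -> R) (m n : nat) phi : borel G -> \bar R :=
  if n is n'.+1 then econv (K_ (m + n)%N) (econvn K_ m n' phi) else phi.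

End EConvolution.

Section EOneStep.
Context {R : realType} {G : topGroupType}.
Variable mu : {measure set (borel G) -> \bar R}.
Hypotheses (hG : hausdorff_space G) (mu_haar : left_haar mu).
Variables (D : splitting R G) (U W B : set G) (eps : R).
Hypotheses (oU : open U) (U_gen : generating_nbhd U).
Hypotheses (oW : open W) (W_gen : generating_nbhd W).
Hypotheses (cB : compact B) (WB : W `<=` B) (eps0 : 0 < eps).
Let muC := compact_haar_lty mu_haar.
Let muR : open_radon mu. Proof. exact: (haar_open_radon hG mu_haar oU U_gen). Qed.
Local Open Scope ereal_scope.
Local Notation bmeas F := (measurable_fun setT (F : borel G -> \bar R)).

(** Cut both in height and in support; the support runs through the powers of [U], with exponent
    [n.+1] so that it is open. *)
Let trunc (phi : borel G -> \bar R) (n : nat) (x : G) : R :=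
  (fine (mine (phi x) n%:R%:E) * indR (setpow U n.+1) x)%R.

Let truncE (phi : borel G -> \bar R) n x : 0 <= phi x ->
  (trunc phi n x)%:E = mine (phi x) n%:R%:E * (indR (setpow U n.+1) x)%:E.
Proof.
move=> phi0; rewrite /trunc EFinM fineK//.
rewrite ge0_fin_numE; last by rewrite le_min phi0 lee_fin ler0n.
by apply: (@le_lt_trans _ _ n%:R%:E); [rewrite ge_min lexx orbT|rewrite ltey].
Qed.

Let trunc_ge0 (phi : borel G -> \bar R) n x : 0 <= phi x -> (0 <= trunc phi n x)%R.
Proof.
move=> phi0; apply: mulr_ge0; last exact: indR_ge0.
by rewrite fine_ge0// le_min phi0 lee_fin ler0n.
Qed.

Let trunc_le (phi : borel G -> \bar R) n x : 0 <= phi x ->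
  (trunc phi n x)%:E <= phi x.
Proof.
move=> phi0; rewrite truncE// -[leRHS]mule1; apply: lee_pmul.
- by rewrite le_min phi0 lee_fin ler0n.
- by rewrite lee_fin indR_ge0.
- by rewrite ge_min lexx.
- rewrite lee_fin; have [Sx|nSx] := pselect (setpow U n.+1 x).
    by rewrite indR1.
  by rewrite indR0.
Qed.

Let bcs_trunc (phi : borel G -> \bar R) n : bmeas phi -> (forall x, 0 <= phi x) ->
  bcs (trunc phi n).
Proof.
move=> mphi phi0.
have mS : measurable (setpow U n.+1 : set (borel G)).
  by apply: open_borel; exact: open_setpow.
have pS : precompact (setpow U n.+1).
  by apply: (precompact_setpow hG); case: U_gen.
apply: bcsMl; last exact: bcs_indR.
split.
  apply: measurableT_comp => //; apply: measurable_mine => //.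
move=> C _; exists n%:R => x _.
have m0 : 0 <= mine (phi x) n%:R%:E by rewrite le_min phi0 lee_fin ler0n.
have mn : mine (phi x) n%:R%:E <= n%:R%:E by rewrite ge_min lexx orbT.
have mf : mine (phi x) n%:R%:E \is a fin_num.
  by rewrite ge0_fin_numE//; apply: le_lt_trans mn _; rewrite ltey.
by rewrite ger0_norm ?fine_ge0// -lee_fin fineK.
Qed.

Let trunc_nd (phi : borel G -> \bar R) x m n : (forall x, 0 <= phi x) -> (m <= n)%N ->
  (trunc phi m x)%:E <= (trunc phi n x)%:E.
Proof.
move=> phi0 mn; rewrite !truncE//; apply: lee_pmul => //.
- by rewrite le_min phi0 lee_fin ler0n.
- by rewrite lee_fin indR_ge0.
- by rewrite le_min ge_min lexx/= ge_min lee_fin ler_nat mn orbT.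
- rewrite lee_fin; have [Sx|nSx] := pselect (setpow U m.+1 x).
    rewrite (indR1 Sx) indR1//; apply: setpow_sub Sx => //.
    exact: generating_nbhd1.
  by rewrite (indR0 nSx) indR_ge0.
Qed.

Let trunc_cvg (phi : borel G -> \bar R) x : (forall x, 0 <= phi x) ->
  (fun n => (trunc phi n x)%:E) @ \oo --> phi x.
Proof.
move=> phi0; have [k Ukx] := generating_nbhd_cover U_gen x.
have U1 := generating_nbhd1 U_gen.
have E n : (k <= n)%N -> (trunc phi n x)%:E = mine (phi x) n%:R%:E.
  move=> kn; rewrite truncE// indR1 ?mule1//.
  by apply: setpow_sub Ukx => //; exact: leqW.
case px : (phi x) => [r| |].
- apply: cvg_near_cst; exists (maxn k (Num.truncn r).+1) => // n /=.
  rewrite geq_max => /andP[kn rn]; rewrite E// px min_l// lee_fin.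
  by apply/ltW; apply: lt_le_trans (truncnS_gt _) _; rewrite ler_nat.
- apply/cvgeyPge => A; exists (maxn k (Num.truncn A).+1) => // n /=.
  rewrite geq_max => /andP[kn rn]; rewrite E// px min_r ?leey// lee_fin.
  by apply/ltW; apply: lt_le_trans (truncnS_gt _) _; rewrite ler_nat.
- by have := phi0 x; rewrite px.
Qed.

(** The truncations increase to [phi], and so do their convolutions and weighted squares; for each
    truncation the inequality is [tconv_L2_bound]. *)
Theorem econv_L2_bound : exists2 w : R, (0 < w)%R &
  forall (K psi : G -> R) (lam : R) (phi : borel G -> \bar R),
  step_kernel mu D W B eps K -> coarse_lipschitz mu U psi -> bmeas phi ->
  (forall x, 0 <= phi x) ->
  \int[mu]_g (((expR (lam * psi g))%:E * econv mu K phi g) *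
    ((expR (lam * psi g))%:E * econv mu K phi g)) <=
  (expR (w * lam ^+ 2))%:E * \int[mu]_g (((expR (lam * psi g))%:E * phi g) *
    ((expR (lam * psi g))%:E * phi g)).
Proof.
have [w w0 Hw] := @tconv_L2_bound R G mu hG mu_haar D U W B eps oU U_gen oW W_gen cB WB eps0.
exists w => // K psi lam phi sK lp mphi phi0.
have [bK K0 _ _ _ _] := sK; have mK := bK.1.1.
have lpsi := lp.1.
pose e g : R := expR (lam * psi g).
have e0 g : (0 < e g)%R by exact: expR_gt0.
have eE0 g : 0 <= (e g)%:E by rewrite lee_fin ltW.
have le : lbm e by apply: lbm_expR; apply: lbmM => //; exact: lbm_cst.
have meE : bmeas (fun g => (e g)%:E) by apply/measurable_EFinP; exact: le.1.
pose phin n : borel G -> \bar R := fun x => (trunc phi n x)%:E.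
have mphin n : bmeas (phin n).
  by apply/measurable_EFinP; have [[]] := bcs_trunc n mphi phi0.
have phin0 n x : 0 <= phin n x by rewrite lee_fin trunc_ge0.
pose a n g := (e g)%:E * econv mu K (phin n) g.
have a0 n g : 0 <= a n g.
  by apply: mule_ge0 => //; exact: econv_ge0.
have ma n : bmeas (a n).
  by apply: emeasurable_funM => //; exact: econv_measurable.
have and_ g m n : (m <= n)%N -> a m g <= a n g.
  move=> mn; rewrite lee_wpmul2l//; apply: le_econv => //.
  by move=> x; exact: trunc_nd.
have acvg g : a ^~ g @ \oo --> (e g)%:E * econv mu K phi g.
  apply: cvgeZl => //; apply: ge0_cvg_integral.
  - by move=> n; exact: econv_slice_measurable.
  - by move=> n h; rewrite mule_ge0// lee_fin.
  - by move=> h m n mn; rewrite lee_wpmul2l ?lee_fin//; exact: trunc_nd.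
  - by move=> h; apply: cvgeZl => //; exact: trunc_cvg.
have cv : (fun n => \int[mu]_g (a n g * a n g)) @ \oo -->
    \int[mu]_g (((e g)%:E * econv mu K phi g) * ((e g)%:E * econv mu K phi g)).
  apply: ge0_cvg_integral.
  - by move=> n; exact: emeasurable_funM.
  - by move=> n g; rewrite mule_ge0.
  - by move=> g m n mn; apply: lee_pmul => //; exact: and_.
  - move=> g; apply: cvgeM => //.
    have : 0 <= (e g)%:E * econv mu K phi g.
      by apply: mule_ge0 => //; exact: econv_ge0.
    by set x := _ * _; case: x => [r| |] // _; rewrite /mule_def /= ?eqxx.
apply: (cvge_le _ cv); apply: nearW => n.
(* The truncation is multiplied by the exponential because [tw] divides by it again: the
   exponentials at [h^-1 g] cancel and [tconv] of [f] is the weighted convolution. *)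
pose f x : R := (e x * trunc phi n x)%R.
have bt := bcs_trunc n mphi phi0.
have bf : bcs f by exact: bcsMl.
have bc := bcs_conv bK bt.
have aE g : a n g = (tconv mu K psi f lam g)%:E.
  rewrite /a /econv /phin.
  transitivity ((e g)%:E * (\int[mu]_h (K h * trunc phi n (h^-1 * g)%g))%R%:E).
    by rewrite bcs_intEFin//; exact: (bcs_slicel g bc).
  rewrite -EFinM -bcs_intZ//; last exact: (bcs_slicel g bc).
  congr EFin; apply: eq_Rintegral => h _.
  rewrite /tw /f /e mulrBr expRD mulrCA -!mulrA; congr (_ * (_ * _))%R.
  by rewrite mulrA -expRD addNr expR0 mul1r.
have bT : bcs (tconv mu K psi f lam) by apply: bcs_tconv.
apply: (@le_trans _ _ ((\int[mu]_g tconv mu K psi f lam g ^+ 2)%R%:E)).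
  rewrite bcs_intEFin//; last exact: bcsX.
  by under eq_integral do rewrite aE -EFinM -expr2.
apply: (@le_trans _ _ ((expR (w * lam ^+ 2) * \int[mu]_g f g ^+ 2)%R%:E)).
  by rewrite lee_fin; exact: (Hw K psi lam f sK lp bf).
rewrite EFinM lee_wpmul2l ?lee_fin ?expR_ge0// bcs_intEFin//; last exact: bcsX.
apply: ge0_le_integral => //.
- by move=> g _; rewrite lee_fin sqr_ge0.
- by apply/measurable_EFinP; have [[]] := bcsX 1 bf.
- by apply: emeasurable_funM; exact: emeasurable_funM.
- move=> g _; rewrite /f expr2 !EFinM; apply: lee_pmul.
  + by apply: mule_ge0 => //; exact: phin0.
  + by apply: mule_ge0 => //; exact: phin0.
  + by rewrite lee_wpmul2l//; exact: trunc_le.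
  + by rewrite lee_wpmul2l//; exact: trunc_le.
Qed.

End EOneStep.

(** * Operator norms *)

Section ComplexModulus.
Context {R : realType}.
Implicit Types z : R[i].

Definition cmod z : R := complex.Re `|z|.

Lemma cmodE z : cmod z = Num.sqrt (complex.Re z ^+ 2 + complex.Im z ^+ 2).
Proof. by rewrite /cmod normc_def. Qed.

Lemma cmod_ge0 z : 0 <= cmod z.
Proof. by rewrite cmodE sqrtr_ge0. Qed.

Lemma cmod_sqr z : cmod z ^+ 2 = complex.Re z ^+ 2 + complex.Im z ^+ 2.
Proof. by rewrite cmodE sqr_sqrtr// addr_ge0 ?sqr_ge0. Qed.

Lemma Re_realM (x : R) z : complex.Re (x%:C%C * z) = x * complex.Re z.
Proof. by case: z => a b /=; rewrite mul0r subr0. Qed.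

Lemma Im_realM (x : R) z : complex.Im (x%:C%C * z) = x * complex.Im z.
Proof. by case: z => a b /=; rewrite mul0r addr0. Qed.

Lemma cmod_realM (x : R) z : 0 <= x -> cmod (x%:C%C * z) = x * cmod z.
Proof.
move=> x0; rewrite !cmodE Re_realM Im_realM !exprMn -mulrDr sqrtrM ?sqr_ge0//.
by rewrite sqrtr_sqr ger0_norm.
Qed.

Lemma Re_le_cmod z : `|complex.Re z| <= cmod z.
Proof. by rewrite cmodE -sqrtr_sqr ler_wsqrtr// lerDl sqr_ge0. Qed.

Lemma Im_le_cmod z : `|complex.Im z| <= cmod z.
Proof. by rewrite cmodE -sqrtr_sqr ler_wsqrtr// lerDr sqr_ge0. Qed.

Lemma cauchy_schwarz_cmod (c s : R) z : c ^+ 2 + s ^+ 2 = 1 ->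
  c * complex.Re z + s * complex.Im z <= cmod z.
Proof.
move=> cs; apply: le_trans (ler_norm _) _.
rewrite cmodE -sqrtr_sqr ler_wsqrtr//.
set a := complex.Re z; set b := complex.Im z.
have -> : a ^+ 2 + b ^+ 2 = (c ^+ 2 + s ^+ 2) * (a ^+ 2 + b ^+ 2) by rewrite cs mul1r.
have := sqr_ge0 (c * b - s * a); lra.
Qed.

End ComplexModulus.

Section ComplexIntegral.
Context {R : realType} {G : topGroupType}.
Variable mu : {measure set (borel G) -> \bar R}.
Implicit Types F : G -> R[i].

Lemma cmod_measurable F : cmeasurable F ->
  measurable_fun setT ((fun g => cmod (F g)) : borel G -> measurableTypeR R).
Proof.
move=> [mR mI]; under eq_fun do rewrite cmodE.
apply: (measurableT_comp (f := @Num.sqrt R)).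
  by apply: continuous_measurable_fun; exact: sqrt_continuous.
by apply: measurable_funD; exact: measurable_funX.
Qed.

(** Project on the unit vector in the direction of the integral and apply Cauchy-Schwarz pointwise.
    If the right side is infinite there is nothing to prove, so the default values in the definition
    of [cintegral] do no harm. *)
Lemma cmod_cintegral_le F : cmeasurable F ->
  ((cmod (cintegral mu F))%:E <= \int[mu]_g (cmod (F g))%:E)%E.
Proof.
move=> mF; have mc := cmod_measurable mF; have [mR mI] := mF.
have I0 : (0 <= \int[mu]_g (cmod (F g))%:E)%E.
  by apply: integral_ge0 => g _; rewrite lee_fin cmod_ge0.
have [fin|] := ltP (\int[mu]_g (cmod (F g))%:E)%E (+oo)%E; last first.
  by rewrite leye_eq => /eqP ->; rewrite leey.
have ic : mu.-integrable setT (EFin \o (fun g => cmod (F g))).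
  apply/integrableP; split; first exact/measurable_EFinP.
  by under eq_integral do rewrite /= ger0_norm ?cmod_ge0//.
have iR : mu.-integrable setT (EFin \o (fun g => complex.Re (F g))).
  apply: (le_integrable measurableT _ _ ic) => [|g _]; first exact/measurable_EFinP.
  by rewrite /= lee_fin [leRHS]ger0_norm ?cmod_ge0// Re_le_cmod.
have iI : mu.-integrable setT (EFin \o (fun g => complex.Im (F g))).
  apply: (le_integrable measurableT _ _ ic) => [|g _]; first exact/measurable_EFinP.
  by rewrite /= lee_fin [leRHS]ger0_norm ?cmod_ge0// Im_le_cmod.
have -> : (\int[mu]_g (cmod (F g))%:E = (\int[mu]_g cmod (F g))%:E)%E.
  by rewrite /Rintegral fineK// ge0_fin_numE.
rewrite lee_fin; set z := cintegral mu F.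
have [z0|z0] := eqVneq (cmod z) 0.
  by rewrite z0; apply: Rintegral_ge0 => g _; exact: cmod_ge0.
pose c := complex.Re z / cmod z; pose s := complex.Im z / cmod z.
have cs : c ^+ 2 + s ^+ 2 = 1.
  by rewrite /c /s !expr_div_n -mulrDl -cmod_sqr divff// expf_neq0.
have -> : cmod z = c * complex.Re z + s * complex.Im z.
  rewrite /c /s mulrAC [X in _ + X]mulrAC -mulrDl -!expr2 -cmod_sqr expr2.
  by rewrite mulfK.
have icR : mu.-integrable setT (EFin \o (fun g => c * complex.Re (F g))).
  exact: (integrableZl measurableT c iR).
have isI : mu.-integrable setT (EFin \o (fun g => s * complex.Im (F g))).
  exact: (integrableZl measurableT s iI).
rewrite /z /cintegral /= -!RintegralZl// -RintegralD//.
apply: le_Rintegral => //; first exact: (integrableD measurableT icR isI).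
by move=> g _; exact: cauchy_schwarz_cmod.
Qed.

Lemma cmeasurable_realM (e : G -> R) F :
  measurable_fun setT (e : borel G -> measurableTypeR R) -> cmeasurable F ->
  cmeasurable (fun g => (e g)%:C%C * F g).
Proof.
move=> me [mR mI]; split.
  by under eq_fun do rewrite Re_realM; exact: measurable_funM.
by under eq_fun do rewrite Im_realM; exact: measurable_funM.
Qed.

Hypothesis muR : open_radon mu.

(** Tonelli's measurability applies to the positive and negative parts; no integrability is asked,
    since the difference in the extended reals and then [fine] are measurable maps. *)
Lemma slice_Rintegral_measurable (H : G * G -> R) :
  measurable_fun setT (H : borel (G * G)%type -> measurableTypeR R) ->
  measurable_fun setT ((fun g => \int[mu]_h H (g, h)) : borel G -> measurableTypeR R).
Proof.
move=> mH; apply: measurableT_comp => //.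
have mE : measurable_fun setT (EFin \o H : borel (G * G)%type -> \bar R).
  exact/measurable_EFinP.
rewrite (_ : (fun g => _) = (fun g => \int[mu]_h ((EFin \o H)^\+ (g, h)) -
    \int[mu]_h ((EFin \o H)^\- (g, h)))%E); last first.
  apply/funext => g; rewrite integralE; congr (_ - _)%E.
    by apply: eq_integral => h _; rewrite !funeposE.
  by apply: eq_integral => h _; rewrite !funenegE.
apply: emeasurable_funB.
- exact: (slice_integral_measurable muR (measurable_funepos mE)
    (fun z => funepos_ge0 _ z)).
- exact: (slice_integral_measurable muR (measurable_funeneg mE)
    (fun z => funeneg_ge0 _ z)).
Qed.

Section Convop.
Variables (K : G -> R) (F : G -> R[i]).
Hypotheses (mK : measurable_fun setT (K : borel G -> measurableTypeR R)).
Hypotheses (K0 : forall x, 0 <= K x) (mF : cmeasurable F).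

Let mKF (H : G -> R) : measurable_fun setT (H : borel G -> measurableTypeR R) ->
  measurable_fun setT ((fun z => K z.2 * H (z.2^-1 * z.1)%g)
    : borel (G * G)%type -> measurableTypeR R).
Proof.
move=> mH; apply: measurable_funM; last exact: (borel_comp continuous_mulVg2 mH).
by apply: (borel_comp (c := snd) _ mK) => z; exact: cvg_snd.
Qed.

Lemma convop_cmeasurable : cmeasurable (convop mu K F).
Proof.
have [mR mI] := mF; split; rewrite /convop /=.
- have := slice_Rintegral_measurable (mKF mR).
  congr (measurable_fun _ _); apply/funext => g.
  by apply: eq_Rintegral => h _; rewrite Re_realM.
- have := slice_Rintegral_measurable (mKF mI).
  congr (measurable_fun _ _); apply/funext => g.
  by apply: eq_Rintegral => h _; rewrite Im_realM.
Qed.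

Lemma cmod_convop_le g :
  ((cmod (convop mu K F g))%:E <= econv mu K (fun x => (cmod (F x))%:E) g)%E.
Proof.
rewrite /convop; apply: le_trans (cmod_cintegral_le _) _.
  apply: cmeasurable_realM => //.
  have cV : continuous (fun h : G => (h^-1 * g)%g).
    apply: continuous_mulg => [|h]; last exact: cvg_cst.
    exact: invg_continuous.
  by have [mR mI] := mF; split; [exact: (borel_comp cV mR)|exact: (borel_comp cV mI)].
by under eq_integral do rewrite cmod_realM// EFinM.
Qed.

End Convop.

End ComplexIntegral.

Section Iteration.
Context {R : realType} {G : topGroupType}.
Variable mu : {measure set (borel G) -> \bar R}.
Hypothesis muR : open_radon mu.
Variable K_ : nat -> G -> R.
Hypothesis mK : forall n, (0 < n)%N ->
  measurable_fun setT (K_ n : borel G -> measurableTypeR R).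
Hypothesis K0 : forall n, (0 < n)%N -> forall x, 0 <= K_ n x.
Local Notation bmeas F := (measurable_fun setT (F : borel G -> \bar R)).

Lemma econvn_ge0 m n phi g : (forall x, (0 <= phi x)%E) ->
  (0 <= econvn mu K_ m n phi g)%E.
Proof.
move=> phi0; elim: n g => [//|n ih] g /=.
by apply: econv_ge0 => //; apply: K0; rewrite addnS.
Qed.

Lemma econvn_measurable m n phi : bmeas phi -> (forall x, (0 <= phi x)%E) ->
  bmeas (econvn mu K_ m n phi).
Proof.
move=> mphi phi0; elim: n => [//|n ih] /=.
apply: econv_measurable => //.
- by apply: mK; rewrite addnS.
- by apply: K0; rewrite addnS.
- by move=> x; exact: econvn_ge0.
Qed.

(** Reduces the operators to nonnegative functions: each step takes the modulus inside the integral,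
    then uses monotonicity of [econv]. *)
Lemma convops_le m n F : cmeasurable F -> cmeasurable (convops mu K_ m n F) /\
  forall g, ((cmod (convops mu K_ m n F g))%:E <=
    econvn mu K_ m n (fun x => (cmod (F x))%:E) g)%E.
Proof.
move=> mF; elim: n => [|n [mc ih]]; first by split.
have mn : (0 < m + n.+1)%N by rewrite addnS.
have mKn := mK mn; have Kn0 := K0 mn; split; first exact: convop_cmeasurable.
move=> g /=; apply: le_trans (cmod_convop_le mu mKn Kn0 mc g) _.
apply: le_econv => //.
- by apply/measurable_EFinP; exact: cmod_measurable.
- apply: econvn_measurable; first by apply/measurable_EFinP; exact: cmod_measurable.
  by move=> x; rewrite lee_fin cmod_ge0.
- by move=> x; rewrite lee_fin cmod_ge0.
Qed.

End Iteration.

Section TwoNorm.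
Context {R : realType} {G : topGroupType}.
Variable mu : {measure set (borel G) -> \bar R}.
Implicit Type F : G -> R[i].

Definition sqint F : \bar R := (\int[mu]_g (cmod (F g) ^+ 2)%:E)%E.

Lemma sqint_ge0 F : (0 <= sqint F)%E.
Proof. by apply: integral_ge0 => g _; rewrite lee_fin sqr_ge0. Qed.

Lemma cnorm2E F : cnorm mu 2%:E F = ((sqint F) `^ 2^-1)%E.
Proof.
rewrite /cnorm unlock /sqint; congr (_ `^ _)%E; apply: eq_integral => g _ /=.
rewrite -/(cmod (F g)) ger0_norm ?cmod_ge0//.
by rewrite powR_mulrn// cmod_ge0.
Qed.

Lemma sqint_le_cnorm2 (F1 F2 : G -> R[i]) (c : R) :
  (sqint F1 <= (expR (2 * c))%:E * sqint F2)%E ->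
  (cnorm mu 2%:E F1 <= (expR c)%:E * cnorm mu 2%:E F2)%E.
Proof.
move=> h; rewrite !cnorm2E.
have -> : (expR c)%:E = ((expR (2 * c))%:E `^ 2^-1)%E.
  by rewrite poweR_EFin -expRM mulrAC divff ?mul1r.
rewrite -poweRM ?lee_fin ?expR_ge0 ?sqint_ge0//.
apply: gt0_ler_poweR => //; rewrite ?in_itv/= ?leey ?andbT ?sqint_ge0//.
by rewrite mule_ge0 ?lee_fin ?expR_ge0 ?sqint_ge0.
Qed.

End TwoNorm.

Section TwistedBound.
Context {R : realType} {G : topGroupType}.
Variable mu : {measure set (borel G) -> \bar R}.
Hypotheses (hG : hausdorff_space G) (mu_haar : left_haar mu).
Variables (D : splitting R G) (U W B : set G) (eps : R).
Hypotheses (oU : open U) (U_gen : generating_nbhd U).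
Variable K_ : nat -> G -> R.
Hypothesis sK : forall n, (0 < n)%N -> step_kernel mu D W B eps (K_ n).
Let muR : open_radon mu. Proof. exact: (haar_open_radon hG mu_haar oU U_gen). Qed.
Let mK n : (0 < n)%N -> measurable_fun setT (K_ n : borel G -> measurableTypeR R).
Proof. by move=> /sK[[[]]]. Qed.
Let K0 n : (0 < n)%N -> forall x, 0 <= K_ n x.
Proof. by move=> /sK[]. Qed.
Local Notation bmeas F := (measurable_fun setT (F : borel G -> \bar R)).
Variable w : R.
Hypothesis step : forall (K psi : G -> R) (lam : R) (phi : borel G -> \bar R),
  step_kernel mu D W B eps K -> coarse_lipschitz mu U psi -> bmeas phi ->
  (forall x, 0 <= phi x)%E ->
  (\int[mu]_g (((expR (lam * psi g))%:E * econv mu K phi g) *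
    ((expR (lam * psi g))%:E * econv mu K phi g)) <=
  (expR (w * lam ^+ 2))%:E * \int[mu]_g (((expR (lam * psi g))%:E * phi g) *
    ((expR (lam * psi g))%:E * phi g)))%E.

Lemma econvn_L2_bound m n psi lam (phi : borel G -> \bar R) :
  coarse_lipschitz mu U psi -> bmeas phi -> (forall x, 0 <= phi x)%E ->
  (\int[mu]_g (((expR (lam * psi g))%:E * econvn mu K_ m n phi g) *
    ((expR (lam * psi g))%:E * econvn mu K_ m n phi g)) <=
  (expR (w * lam ^+ 2 * n%:R))%:E * \int[mu]_g (((expR (lam * psi g))%:E * phi g) *
    ((expR (lam * psi g))%:E * phi g)))%E.
Proof.
move=> lp mphi phi0; elim: n => [|n ih] /=; first by rewrite mulr0 expR0 mul1e.
have mn : (0 < m + n.+1)%N by rewrite addnS.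
have mP := econvn_measurable muR mK K0 m n mphi phi0.
have P0 x := econvn_ge0 mu K0 m n x phi0.
have st := step lam (sK mn) lp mP P0.
apply: (le_trans st).
rewrite -[n.+1%:R]natr1 mulrDr mulr1 addrC expRD EFinM -muleA.
by rewrite lee_wpmul2l// lee_fin expR_ge0.
Qed.

(** Take the modulus of e^(- lam psi) f as starting function; multiplied by e^(lam psi) it is the
    modulus of [f], so the weighted estimate is an unweighted one for the twisted operator. *)
Lemma twist_L2_bound m n psi lam f : coarse_lipschitz mu U psi -> cmeasurable f ->
  cmeasurable (twist lam psi (convops mu K_ m n) f) /\
  (sqint mu (twist lam psi (convops mu K_ m n) f) <=
    (expR (w * lam ^+ 2 * n%:R))%:E * sqint mu f)%E.
Proof.
move=> lp mf.
have mpsi : measurable_fun setT (psi : borel G -> measurableTypeR R) by case: lp => [[]].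
have me (c : R) : measurable_fun setT
    ((fun g => expR (c * psi g)) : borel G -> measurableTypeR R).
  apply: (measurableT_comp (@measurable_expR R)).
  by apply: measurable_funM => //; exact: measurable_cst.
pose F h := ((expR (- (lam * psi h)))%:C%C * f h).
have mF : cmeasurable F.
  apply: cmeasurable_realM => //.
  by under eq_fun do rewrite -mulNr; exact: me.
have [mT leT] := convops_le muR mK K0 m n mF.
split; first exact: cmeasurable_realM.
have mphi : bmeas (fun x => (cmod (F x))%:E).
  by apply/measurable_EFinP; exact: cmod_measurable.
have phi0 x : (0 <= (cmod (F x))%:E)%E by rewrite lee_fin cmod_ge0.
have := econvn_L2_bound m n lam lp mphi phi0.
have E0 g : (0 <= (expR (lam * psi g))%:E)%E by rewrite lee_fin expR_ge0.
have meE : bmeas (fun g => (expR (lam * psi g))%:E).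
  by apply/measurable_EFinP; exact: me.
have -> : (\int[mu]_g (((expR (lam * psi g))%:E * (cmod (F g))%:E) *
    ((expR (lam * psi g))%:E * (cmod (F g))%:E)) = sqint mu f)%E.
  apply: eq_integral => g _.
  have -> : ((expR (lam * psi g))%:E * (cmod (F g))%:E)%E = (cmod (f g))%:E.
    by rewrite -EFinM /F cmod_realM ?expR_ge0// mulrA -expRD subrr expR0 mul1r.
  by rewrite -EFinM expr2.
move=> /(le_trans _); apply; apply: ge0_le_integral => //.
- by move=> g _; rewrite lee_fin sqr_ge0.
- apply/measurable_EFinP; apply: measurable_funX; apply: cmod_measurable.
  exact: cmeasurable_realM.
- by apply: emeasurable_funM; apply: emeasurable_funM => //; exact: econvn_measurable.
- move=> g _; rewrite /twist cmod_realM ?expR_ge0// expr2 !EFinM.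
  apply: lee_pmul; try (by rewrite -EFinM lee_fin mulr_ge0 ?expR_ge0 ?cmod_ge0);
    by rewrite lee_wpmul2l.
Qed.

Lemma twist_opnorm_bound m n psi lam : coarse_lipschitz mu U psi ->
  maps_Lp mu 2%:E 2%:E (twist lam psi (convops mu K_ m n)) /\
  (opnorm mu 2%:E 2%:E (twist lam psi (convops mu K_ m n)) <=
    (expR (w / 2 * lam ^+ 2 * n%:R))%:E)%E.
Proof.
move=> lp.
have key f : cmeasurable f ->
    (cnorm mu 2%:E (twist lam psi (convops mu K_ m n) f) <=
     (expR (w / 2 * lam ^+ 2 * n%:R))%:E * cnorm mu 2%:E f)%E.
  move=> mf; apply: sqint_le_cnorm2.
  rewrite (_ : 2 * _ = w * lam ^+ 2 * n%:R); last by field.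
  by have [] := twist_L2_bound m n lam lp mf.
split=> [f [mf nf]|].
  split; first by have [] := twist_L2_bound m n lam lp mf.
  apply: le_lt_trans (key _ mf) _.
  by rewrite lte_mul_pinfty// ?lee_fin ?expR_ge0.
apply: ge_ereal_sup => _ [f [[mf _] nf] <-].
apply: le_trans (key _ mf) _; rewrite -[leRHS]mule1.
by rewrite lee_wpmul2l// lee_fin expR_ge0.
Qed.

End TwistedBound.

(** * The pointwise kernel bound *)

Section WordLength.
Context {R : realType} {G : topGroupType}.
Variable U : set G.
Hypotheses (oU : open U) (U_gen : generating_nbhd U).
Local Notation rho := (@rho R G U).

Let lb_rho g : lbound [set n%:R | n in [set n | (0 < n)%N /\ setpow U n g]] (1 : R).
Proof. by move=> _ [n [n0 _] <-]; rewrite ler1n. Qed.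

Lemma rho_le n g : (0 < n)%N -> setpow U n g -> rho g <= n%:R.
Proof.
by move=> n0 ng; apply: ge_inf; [exists 1; exact: lb_rho|exists n].
Qed.

(** An infimum of a nonempty set of natural numbers is a minimum. In particular [rho] is 1, not 0,
    at the identity. *)
Lemma rho_attained g : exists2 n, (0 < n)%N /\ setpow U n g & rho g = n%:R.
Proof.
have [m mg] := generating_nbhd_cover U_gen g.
have ex : exists n, (0 < n)%N && `[< setpow U n g >].
  by exists m.+1; apply/asboolP; exact: setpow_ge1.
case: (ex_minnP ex) => n /andP[n0 /asboolP ng] nmin; exists n => //.
apply/eqP; rewrite eq_le rho_le//=; apply: lb_le_inf; first by exists n%:R, n.
move=> _ [k [k0 kg] <-]; rewrite ler_nat; apply: nmin.
by rewrite k0; apply/asboolP.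
Qed.

Lemma rho_ge1 g : 1 <= rho g.
Proof. by have [n [n0 _] ->] := rho_attained g; rewrite ler1n. Qed.

Lemma rhoM g h : rho (g * h)%g <= rho g + rho h.
Proof.
have [m [m0 mg] ->] := rho_attained g; have [n [n0 nh] ->] := rho_attained h.
by rewrite -natrD; apply: rho_le; [rewrite addn_gt0 m0|exact: setpowD].
Qed.

(** Sublevel sets are open because the positive powers of [U] are, so [rho] is upper
    semicontinuous. *)
Lemma lbm_rho : lbm rho.
Proof.
split.
  apply: (measurability _ (RGenInftyO.measurableE R)) => //.
  move=> _ [_ [r ->] <-]; rewrite setTI; apply: open_borel.
  rewrite openE => g /=; rewrite in_itv/= => gr.
  have [n [n0 ng] E] := rho_attained g.
  apply: (@filterS _ _ _ (setpow U n)) => [h nh /=|].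
    by rewrite in_itv/=; apply: le_lt_trans gr; rewrite E; exact: rho_le.
  by apply: open_nbhs_nbhs; split => //; exact: open_setpow.
move=> C cC; have [n n0 Cn] := compact_setpow U_gen oU cC.
exists n%:R => h Ch; rewrite ger0_norm; last by apply: le_trans (rho_ge1 h).
by apply: rho_le => //; exact: Cn.
Qed.

Lemma rho_coarse_lipschitz (mu : {measure set (borel G) -> \bar R}) :
  coarse_lipschitz mu U rho.
Proof.
split; first exact: lbm_rho.
move=> n h nh; apply: nearW => g.
(* Exponent 0 is separate, as [rho_le] holds for positive exponents only. *)
have [n0|n0] := posnP n.
  by move: nh; rewrite n0 /= => ->; rewrite mul1g subrr normr0.
have sU : symmetric_set U by case: U_gen.
have h1 := rho_le n0 nh; have h2 := rho_le n0 (setpowV sU nh).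
have h3 := rhoM h g; have := rhoM h^-1%g (h * g)%g; rewrite mulKg => h4.
by rewrite ler_norml; apply/andP; split; lra.
Qed.

End WordLength.

Section ModularBound.
Context {R : realType} {G : topGroupType}.
Variable mu : {measure set (borel G) -> \bar R}.
Hypotheses (hG : hausdorff_space G) (mu_haar : left_haar mu).
Variable Delta : G -> R.
Hypothesis Delta_mod : modular_function mu Delta.

(** The substitution is the translation by [g] followed by inversion, which brings in [Delta h^-1].
    Where [g h^-1] lies in [B], multiplicativity and the bound on [B] give
    [Delta h^-1 <= M / Delta g]. *)
Lemma int_inverse_translate_le (B : set G) (M : R) (F : borel G -> \bar R) g :
  compact B -> (forall x, B x -> Delta x <= M) -> 0 <= M ->
  measurable_fun setT F -> (forall x, 0 <= F x)%E ->
  (\int[mu]_h ((indR B h)%:E * F (h^-1 * g)%g) <=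
   (M / Delta g)%:E * \int[mu]_h F h)%E.
Proof.
move=> cB BM M0 mF F0.
have mB : measurable (B : set (borel G)) by exact: compact_borel.
have cV : continuous (fun h : G => h^-1%g) by exact: invg_continuous.
have mI : measurable_fun setT ((fun h => (indR B h)%:E) : borel G -> \bar R).
  by apply/measurable_EFinP; exact: (lbm_indR mB).1.
have mX : measurable_fun setT
    ((fun h => (indR B h)%:E * F (h^-1 * g)%g)%E : borel G -> \bar R).
  apply: emeasurable_funM => //.
  have c : continuous (fun h : G => (h^-1 * g)%g).
    by apply: continuous_mulg => // h; exact: cvg_cst.
  exact: (borel_comp c mF).
have mY : measurable_fun setT
    ((fun h => (indR B (g * h^-1)%g)%:E * F h)%E : borel G -> \bar R).
  apply: emeasurable_funM => //.
  have c : continuous (fun h : G => (g * h^-1)%g).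
    by apply: continuous_mulg => // h; exact: cvg_cst.
  exact: (borel_comp c mI).
have ind0 x : (0 <= (indR B x : R)%:E)%E by rewrite lee_fin indR_ge0.
rewrite -(haar_translate mu_haar g mX); last by move=> x; rewrite mule_ge0.
have -> : (\int[mu]_h ((indR B (g * h)%g)%:E * F ((g * h)^-1 * g)%g) =
    \int[mu]_h ((indR B (g * (h^-1)^-1)%g)%:E * F h^-1%g))%E.
  by apply: eq_integral => h _; rewrite invgK invgM mulgVK.
rewrite (haar_inverse Delta_mod mY); last by move=> x; rewrite mule_ge0.
have D0 x : 0 < Delta x := modular_gt0 Delta_mod x.
have MD : 0 <= M / Delta g by rewrite divr_ge0// ltW.
rewrite -ge0_integralZl// ?lee_fin//.
apply: ge0_le_integral => //.
- by move=> h _; rewrite !mule_ge0// lee_fin ltW.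
- apply: emeasurable_funM => //; apply/measurable_EFinP.
  apply: (continuous_borelR (f := fun x => Delta x^-1%g)) => x.
  apply: (@continuous_comp _ _ _ (fun x : G => x^-1%g) Delta).
    exact: cV.
  exact: (modular_continuous Delta_mod).
- exact: measurable_funeM.
- move=> h _; have [Bh|nBh] := pselect (B (g * h^-1)%g); last first.
    by rewrite (indR0 nBh) !mul0e mule_ge0// lee_fin.
  rewrite (indR1 Bh) mul1e muleC lee_wpmul2r// lee_fin.
  have := BM _ Bh; rewrite (modularM Delta_mod) => BMh.
  by rewrite ler_pdivlMr// mulrC.
Qed.

End ModularBound.

(** The substitute for the Cauchy-Schwarz inequality that remains meaningful at +oo; optimizing [s]
    afterwards recovers it. *)
Lemma ereal_le_young (R : realFieldType) (s : R) (x : \bar R) : 0 < s ->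
  (0 <= x)%E -> (x <= (s / 2)%:E + (s^-1 / 2)%:E * (x * x))%E.
Proof.
move=> s0; have s'0 : 0 < s^-1 / 2 by rewrite divr_gt0 ?invr_gt0.
case: x => [a| |] //= a0.
  rewrite -!EFinM -EFinD lee_fin -subr_ge0.
  have -> : s / 2 + s^-1 / 2 * (a * a) - a = s^-1 / 2 * (a - s) ^+ 2.
    by field; rewrite gt_eqF.
  by rewrite mulr_ge0 ?sqr_ge0// ltW.
by rewrite mulyy gt0_muley ?lte_fin// addey.
Qed.

Section KernelBound.
Context {R : realType} {G : topGroupType}.
Variable mu : {measure set (borel G) -> \bar R}.
Hypotheses (hG : hausdorff_space G) (mu_haar : left_haar mu).
Variable Delta : G -> R.
Hypothesis Delta_mod : modular_function mu Delta.
Variables (D : splitting R G) (U W B : set G) (eps M0 : R).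
Hypotheses (oU : open U) (U_gen : generating_nbhd U) (cB : compact B).
Variable K_ : nat -> G -> R.
Hypothesis sK : forall n, (0 < n)%N -> step_kernel mu D W B eps (K_ n).
Hypothesis M00 : 0 <= M0.
Hypothesis upK : forall n, (0 < n)%N -> forall g, K_ n g <= M0 * indR B g.
Let muR : open_radon mu. Proof. exact: (haar_open_radon hG mu_haar oU U_gen). Qed.
Let muC := compact_haar_lty mu_haar.
Let mK n : (0 < n)%N -> measurable_fun setT (K_ n : borel G -> measurableTypeR R).
Proof. by move=> /sK[[[]]]. Qed.
Let K0 n : (0 < n)%N -> forall x, 0 <= K_ n x.
Proof. by move=> /sK[]. Qed.
Local Notation bmeas F := (measurable_fun setT (F : borel G -> \bar R)).
Local Notation rho := (@rho R G U).
Variable w : R.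
Hypothesis w0 : 0 < w.
Hypothesis step : forall m n psi lam (phi : borel G -> \bar R),
  coarse_lipschitz mu U psi -> bmeas phi -> (forall x, 0 <= phi x)%E ->
  (\int[mu]_g (((expR (lam * psi g))%:E * econvn mu K_ m n phi g) *
    ((expR (lam * psi g))%:E * econvn mu K_ m n phi g)) <=
  (expR (w * lam ^+ 2 * n%:R))%:E * \int[mu]_g (((expR (lam * psi g))%:E * phi g) *
    ((expR (lam * psi g))%:E * phi g)))%E.

(** The product of the [n.+1] kernels with indices from m+1 to m+n+1, with [K_ m.+1] as the function
    on which the others act. *)
Let P m n := econvn mu K_ m.+1 n (EFin \o K_ m.+1).

Let mP m n : bmeas (P m n).
Proof.
apply: econvn_measurable => //; last by move=> x; rewrite lee_fin; exact: K0.
by apply/measurable_EFinP; exact: mK.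
Qed.

Let P0 m n x : (0 <= P m n x)%E.
Proof. by apply: econvn_ge0 => // y; rewrite lee_fin; exact: K0. Qed.

(** The real integral in [convolution] equals the extended one when that is finite and is 0
    otherwise, so it can only be smaller. *)
Lemma convn_le_econvn m n :
  [/\ measurable_fun setT (convn mu K_ m n.+1 : borel G -> measurableTypeR R),
      forall g, 0 <= convn mu K_ m n.+1 g &
      forall g, ((convn mu K_ m n.+1 g)%:E <=
        econvn mu K_ m.+1 n (EFin \o K_ m.+1) g)%E].
Proof.
elim: n => [|n [mc c0 cP]].
  by split; [exact: mK|exact: K0|move=> g; rewrite lexx].
have E : convn mu K_ m n.+2 = convolution mu (K_ (m + n.+2)) (convn mu K_ m n.+1).
  by [].
have mn : (0 < m + n.+2)%N by rewrite addnS.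
have mKn := mK mn; have Kn0 := K0 mn.
rewrite E; split.
- apply: (slice_Rintegral_measurable muR
    (H := fun z => K_ (m + n.+2) z.2 * convn mu K_ m n.+1 (z.2^-1 * z.1)%g)).
  apply: measurable_funM; last exact: (borel_comp continuous_mulVg2 mc).
  by apply: (borel_comp (c := snd) _ mKn) => z; exact: cvg_snd.
- by move=> g; apply: Rintegral_ge0 => h _; rewrite mulr_ge0.
- move=> g; rewrite /P /= addSnnS.
  apply: (@le_trans _ _ (econv mu (K_ (m + n.+2)) (EFin \o convn mu K_ m n.+1) g)).
    have J0 : (0 <= econv mu (K_ (m + n.+2)) (EFin \o convn mu K_ m n.+1) g)%E.
      by apply: integral_ge0 => h _; rewrite -EFinM lee_fin mulr_ge0.
    rewrite /convolution /Rintegral [X in fine X](_ : _ =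
      econv mu (K_ (m + n.+2)) (EFin \o convn mu K_ m n.+1) g).
      by move: J0; case: econv => [a| |] //= _; rewrite leey.
    by apply: eq_integral => h _.
  apply: le_econv => //; first exact/measurable_EFinP.
  exact: (mP m n).
Qed.

Let bB : {b : R | 0 <= b & forall x, B x -> rho x <= b}.
Proof.
apply: cid2; have [n n0 Bn] := compact_setpow U_gen oU cB.
by exists n%:R => // x Bx; apply: rho_le => //; exact: Bn.
Qed.

Let DB : {M : R | 1 <= M & forall x, B x -> Delta x <= M}.
Proof.
apply: cid2; have [_ /(_ _ cB)[M HM]] := lbm_continuous (modular_continuous Delta_mod).
exists (1 + `|M|); first by rewrite lerDl.
move=> x Bx; apply: le_trans (ler_norm _) _; apply: le_trans (HM _ Bx) _.
by apply: le_trans (ler_norm _) _; rewrite lerDr.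
Qed.

Let b0 := s2val bB.
Let MD := s2val DB.
Let beta : R := fine (mu B).
Let r g := Delta g `^ (- 2^-1).

Let D0 g : 0 < Delta g. Proof. exact: (modular_gt0 Delta_mod). Qed.

Let r0 g : 0 < r g. Proof. exact: powR_gt0. Qed.

Let rr g : r g * r g = (Delta g)^-1.
Proof.
rewrite /r -powRD; last by apply/implyP => _; rewrite gt_eqF.
rewrite (_ : _ + _ = -1); last by lra.
by rewrite powR_inv1// ltW.
Qed.

Let mB : measurable (B : set (borel G)).
Proof. exact: compact_borel. Qed.

Let muB : (\int[mu]_h (indR B h)%:E = beta%:E :> \bar R)%E.
Proof. by rewrite integral_indic// setIT /beta fineK// ge0_fin_numE// muC. Qed.

Let beta0 : 0 <= beta. Proof. exact: fine_ge0. Qed.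

(** The weighted estimate with psi = [rho], started at [K_ m.+1], which is bounded by [M0] and lives
    on [B], where the weight is at most e^(lam b0). The exponent is halved so that the bound is a
    square. *)
Let V m n (lam : R) : 0 <= lam ->
  (\int[mu]_g (((expR (lam * rho g))%:E * P m n g) *
    ((expR (lam * rho g))%:E * P m n g)) <=
  (expR (lam * b0 + w / 2 * lam ^+ 2 * n%:R) ^+ 2 * (M0 ^+ 2 * beta))%:E)%E.
Proof.
move=> lam0; have [bp bx] := (s2valP bB, s2valP' bB).
have K1 : (0 < m.+1)%N by [].
have mphi : bmeas (EFin \o K_ m.+1) by apply/measurable_EFinP; exact: mK.
apply: le_trans (step m.+1 n lam (rho_coarse_lipschitz oU U_gen mu) mphi _) _.
  by move=> x; rewrite lee_fin; exact: K0.
have me : bmeas (fun g => (expR (lam * rho g))%:E).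
  apply/measurable_EFinP; apply: (measurableT_comp (@measurable_expR R)).
  by apply: measurable_funM => //; exact: (lbm_rho oU U_gen).1.
apply: (@le_trans _ _ ((expR (w * lam ^+ 2 * n%:R))%:E *
    \int[mu]_g ((expR (lam * b0) ^+ 2 * M0 ^+ 2)%:E * (indR B g)%:E))%E).
  rewrite lee_wpmul2l ?lee_fin ?expR_ge0//; apply: ge0_le_integral => //.
  - by move=> g _; rewrite /= !mule_ge0// lee_fin ?expR_ge0// K0.
  - by apply: emeasurable_funM; exact: emeasurable_funM.
  - apply: measurable_funeM; apply/measurable_EFinP; exact: (lbm_indR mB).1.
  - move=> g _ /=; rewrite -!EFinM lee_fin; have [Bg|nBg] := pselect (B g); last first.
      by rewrite (step_supp (sK K1) nBg) (indR0 nBg) !(mulr0, mul0r).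
    rewrite (indR1 Bg) mulr1.
    have Kg : K_ m.+1 g <= M0 by have := upK K1 g; rewrite (indR1 Bg) mulr1.
    have eg : expR (lam * rho g) <= expR (lam * b0).
      by rewrite ler_expR ler_wpM2l// bx.
    have h : expR (lam * rho g) * K_ m.+1 g <= expR (lam * b0) * M0.
      by rewrite ler_pM ?expR_ge0// K0.
    rewrite -exprMn -expr2 lerXn2r// nnegrE mulr_ge0 ?expR_ge0// K0//.
rewrite ge0_integralZl//; last 3 first.
- by apply/measurable_EFinP; exact: (lbm_indR mB).1.
- by move=> x _; rewrite lee_fin indR_ge0.
- by rewrite lee_fin mulr_ge0 ?sqr_ge0.
rewrite muB -!EFinM lee_fin le_eqVlt; apply/orP; left; apply/eqP.
have -> : expR (w * lam ^+ 2 * n%:R) = expR (w / 2 * lam ^+ 2 * n%:R) ^+ 2.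
  by rewrite [RHS]expr2 -expRD; congr expR; lra.
rewrite expRD; set e1 := expR _; set e2 := expR _.
by ring.
Qed.

Let C1 := M0 * beta * (1 + MD * M0 ^+ 2) / 2.

(** Subadditivity gives rho g <= b0 + rho (h^-1 g) for [h] in [B], so the weight passes under the
    last convolution. What is left is an integral over [B], estimated by the L^2 bound of the
    remaining factors. *)
Let weighted_bound m n (lam : R) g : 0 <= lam ->
  ((expR (lam * rho g))%:E * P m n.+1 g <=
   (C1 * r g * expR (lam * b0) * expR (lam * b0 + w / 2 * lam ^+ 2 * n%:R))%:E)%E.
Proof.
move=> lam0; have [bp bx] := (s2valP bB, s2valP' bB).
have [MD1 DBx] := (s2valP DB, s2valP' DB).
set E := expR (lam * b0 + _); have E0 : 0 < E by exact: expR_gt0.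
pose X : borel G -> \bar R := fun h => ((expR (lam * rho h))%:E * P m n h)%E.
have X0 h : (0 <= X h)%E by rewrite mule_ge0// lee_fin expR_ge0.
have me : bmeas (fun g => (expR (lam * rho g))%:E).
  apply/measurable_EFinP; apply: (measurableT_comp (@measurable_expR R)).
  by apply: measurable_funM => //; exact: (lbm_rho oU U_gen).1.
have mX : bmeas X by exact: emeasurable_funM.
have cV : continuous (fun h : G => (h^-1 * g)%g).
  apply: (@continuous_mulg G G (fun h => h^-1%g) (fun=> g)).
    exact: invg_continuous.
  by move=> h; exact: cvg_cst.
have mXg : bmeas (fun h => X (h^-1 * g)%g) by exact: (borel_comp cV mX).
have mI : bmeas (fun h => (indR B h)%:E).
  by apply/measurable_EFinP; exact: (lbm_indR mB).1.
have I0 h : (0 <= (indR B h : R)%:E)%E by rewrite lee_fin indR_ge0.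
(* This choice makes both terms of Young's inequality proportional to [r g * E]: the second has E^2
   / Delta g = (r g E)^2 divided by [s]. The sum of their coefficients is the constant [C1]. *)
pose s := r g * E; have s0 : 0 < s by rewrite mulr_gt0.
have mN : (0 < m.+1 + n.+1)%N by [].
set c := (expR (lam * b0) * M0); have c0 : 0 <= c by rewrite mulr_ge0 ?expR_ge0.
pose S : borel G -> \bar R := fun h => ((K_ (m.+1 + n.+1)%N h)%:E * P m n (h^-1 * g)%g)%E.
have mS : bmeas S by exact: (econv_slice_measurable g (mK mN) (mP m n)).
have S0 h : (0 <= S h)%E by rewrite mule_ge0// lee_fin; exact: K0.
apply: (@le_trans _ _ (\int[mu]_h (c%:E * ((indR B h)%:E * X (h^-1 * g)%g)))%E).
  rewrite (_ : P m n.+1 g = \int[mu]_h S h)%E// -ge0_integralZl//.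
  apply: ge0_le_integral => //.
  - by move=> h _; rewrite mule_ge0// lee_fin expR_ge0.
  - exact: measurable_funeM.
  - by apply: measurable_funeM; exact: emeasurable_funM.
  - move=> h _; have [Bh|nBh] := pselect (B h); last first.
      by rewrite /S (step_supp (sK mN) nBh) (indR0 nBh) !(mul0e, mule0).
    rewrite (indR1 Bh) mul1e /S /X muleA [leRHS]muleA lee_wpmul2r//.
    rewrite -!EFinM lee_fin.
    have Kh : K_ (m.+1 + n.+1) h <= M0.
      by have := upK mN h; rewrite (indR1 Bh) mulr1.
    have rg : lam * rho g <= lam * b0 + lam * rho (h^-1 * g)%g.
      rewrite -mulrDr ler_wpM2l// -{1}[g](mulVKg h).
      by apply: le_trans (rhoM U_gen _ _) _; rewrite lerD2r bx.
    rewrite /c mulrAC -expRD ler_pM ?expR_ge0//; first exact: K0.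
    by rewrite ler_expR.
rewrite ge0_integralZl//; last 2 first.
- exact: emeasurable_funM.
- by move=> h _; rewrite mule_ge0.
apply: (@le_trans _ _ (c%:E * ((s / 2 * beta)%:E + (s^-1 / 2)%:E *
    ((MD / Delta g)%:E * (E ^+ 2 * (M0 ^+ 2 * beta))%:E)))%E).
  rewrite lee_wpmul2l//.
  have mXX : bmeas (fun h => X h * X h)%E by exact: (emeasurable_funM mX mX).
  have mXXg : bmeas (fun h => (indR B h)%:E * (X (h^-1 * g)%g * X (h^-1 * g)%g))%E.
    exact: (emeasurable_funM mI (borel_comp cV mXX)).
  apply: (@le_trans _ _ (\int[mu]_h ((s / 2)%:E * (indR B h)%:E +
      (s^-1 / 2)%:E * ((indR B h)%:E * (X (h^-1 * g)%g * X (h^-1 * g)%g))))%E).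
    apply: ge0_le_integral => //.
    - by move=> h _; rewrite mule_ge0.
    - exact: emeasurable_funM.
    - by apply: emeasurable_funD; exact: measurable_funeM.
    - move=> h _; have [Bh|nBh] := pselect (B h); last first.
        by rewrite (indR0 nBh) !(mul0e, mule0) adde0.
      by rewrite (indR1 Bh) !mul1e mule1; exact: ereal_le_young.
  have s2 : 0 <= s / 2 by rewrite divr_ge0// ltW.
  have s'2 : 0 <= s^-1 / 2 by rewrite divr_ge0// invr_ge0 ltW.
  rewrite ge0_integralD//; last 4 first.
  - by move=> h _; rewrite mule_ge0.
  - exact: measurable_funeM.
  - by move=> h _; rewrite !mule_ge0.
  - exact: measurable_funeM.
  rewrite ge0_integralZl// ge0_integralZl//; last by move=> h _; rewrite !mule_ge0.
  rewrite muB -EFinM leeD2l// lee_wpmul2l//.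
  have MD0 : 0 <= MD by apply: le_trans MD1.
  apply: le_trans (int_inverse_translate_le hG mu_haar Delta_mod g cB DBx MD0 mXX _) _.
    by move=> h; rewrite mule_ge0.
  by rewrite lee_wpmul2l ?lee_fin ?(divr_ge0 MD0 (ltW (D0 g)))//; exact: (V m n lam0).
rewrite -!EFinM lee_fin le_eqVlt; apply/orP; left; apply/eqP.
rewrite /c /C1 /s -(rr g).
by field; rewrite !gt_eqF.
Qed.

Theorem convn_gaussian_bound : exists c b : R, [/\ 0 < c, 0 < b &
  forall (m n : nat) (g : G), (0 < n)%N ->
    convn mu K_ m n g <=
      c * Delta g `^ (- 2^-1) * expR (- (b * rho g ^+ 2 / n%:R))].
Proof.
have [bp bx] := (s2valP bB, s2valP' bB).
have [MD1 DBx] := (s2valP DB, s2valP' DB).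
have MD0 : 0 < MD by apply: lt_le_trans MD1.
(* The value of the exponent - lam rho + (w / 2 + 1) lam^2 N at its minimum lam = rho / ((w + 2) N)
   is - b rho^2 / N. The extra lam^2 N, compared with w / 2, absorbs the linear terms 2 lam b0 <=
   b0^2 + lam^2. *)
pose b := (2 * (w + 2))^-1.
have w2 : 0 < w + 2 by rewrite addr_gt0.
have b00 : 0 < b by rewrite invr_gt0 mulr_gt0.
have C10 : 0 <= C1 by rewrite /C1 !mulr_ge0// addr_ge0// mulr_ge0 ?sqr_ge0// ltW.
have c20 : 0 <= M0 * MD * expR (b * b0 ^+ 2) by rewrite !mulr_ge0 ?expR_ge0// ltW.
have c10 : 0 <= C1 * expR (b0 ^+ 2) by rewrite mulr_ge0 ?expR_ge0.
exists (C1 * expR (b0 ^+ 2) + M0 * MD * expR (b * b0 ^+ 2) + 1), b; split => //.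
  by rewrite ltr_wpDl// addr_ge0.
move=> m [//|[|n]] g _.
all: have rg0 := r0 g.
all: have rho1 : 0 <= rho g by apply: le_trans (rho_ge1 U_gen g).
all: rewrite -/(r g).
all: set c := _ + 1; have c00 : 0 <= c by rewrite /c !addr_ge0.
- have [Bg|nBg] := pselect (B g); last first.
    by rewrite /= (step_supp (sK _) nBg)// !mulr_ge0 ?expR_ge0// ltW.
  apply: (@le_trans _ _ M0); first by have := upK (ltn0Sn m) g; rewrite (indR1 Bg) mulr1.
  (* A single kernel is bounded on [B] and zero elsewhere. On [B] the modular factor is bounded
     below: (MD r)^2 = MD^2 / Delta g >= MD >= 1. *)
  have rMD : 1 <= MD * r g.
    rewrite leNgt; apply/negP => lt1.
    have : (MD * r g) * (MD * r g) < 1 by rewrite mulr_ilt1 ?mulr_ge0 ?ltW.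
    rewrite mulrACA rr ltr_pdivrMr ?D0// mul1r => lt2.
    have := DBx _ Bg; have : MD <= MD * MD by rewrite ler_peMl// ltW.
    by rewrite -/MD; lra.
  have rb : rho g ^+ 2 <= b0 ^+ 2.
    by rewrite lerXn2r ?nnegrE ?bx.
  have eb : 1 <= expR (b * b0 ^+ 2) * expR (- (b * rho g ^+ 2 / 1%:R)).
    rewrite -expRD -[leLHS]expR0 ler_expR divr1 subr_ge0 ler_wpM2l// ltW//.
  apply: (@le_trans _ _ ((M0 * MD * expR (b * b0 ^+ 2)) * r g *
      expR (- (b * rho g ^+ 2 / 1%:R)))); last first.
    rewrite ler_wpM2r ?expR_ge0// ler_wpM2r ?ltW// /c.
    by rewrite /c; lra.
  rewrite (_ : _ * _ = M0 * ((MD * r g) * (expR (b * b0 ^+ 2) *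
      expR (- (b * rho g ^+ 2 / 1%:R))))); last by ring.
  by rewrite ler_peMr// mulr_ege1.
- have [_ _ cP] := convn_le_econvn m n.+1.
  set N : R := n.+2%:R; have N0 : 0 < N by rewrite ltr0n.
  pose lam := rho g / ((w + 2) * N).
  have lam0 : 0 <= lam by rewrite divr_ge0// ltW// mulr_gt0.
  have H := weighted_bound m n g lam0.
  have H2 : ((expR (lam * rho g) * convn mu K_ m n.+2 g)%:E <=
      (C1 * r g * expR (lam * b0) * expR (lam * b0 + w / 2 * lam ^+ 2 * n%:R))%:E)%E.
    apply: le_trans H; rewrite EFinM lee_wpmul2l ?lee_fin ?expR_ge0//.
  have {H2} : convn mu K_ m n.+2 g <= C1 * r g * expR (- (lam * rho g) + lam * b0 +
      (lam * b0 + w / 2 * lam ^+ 2 * n%:R)).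
    rewrite lee_fin in H2; rewrite -(ler_pM2l (expR_gt0 (lam * rho g))).
    apply: le_trans H2 _; rewrite le_eqVlt; apply/orP; left; apply/eqP.
    rewrite !expRD; have := expRxMexpNx_1 (lam * rho g).
    set e1 := expR (lam * rho g); set e2 := expR (- _) => e12.
    rewrite (_ : e1 * _ = (e1 * e2) * (C1 * r g * expR (lam * b0) *
      (expR (lam * b0) * expR (w / 2 * lam ^+ 2 * n%:R)))); last by ring.
    by rewrite e12 mul1r.
  move=> /le_trans; apply.
  apply: (@le_trans _ _ (C1 * expR (b0 ^+ 2) * r g *
      expR (- (b * rho g ^+ 2 / N)))); last first.
    rewrite ler_wpM2r ?expR_ge0// ler_wpM2r ?ltW// /c.
    by lra.
  rewrite [C1 * _ * r g]mulrAC -[leRHS]mulrA.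
  rewrite ler_wpM2l//; first by rewrite mulr_ge0// ltW.
  rewrite -expRD ler_expR.
  have e1 : - (b * rho g ^+ 2 / N) = - (lam * rho g) + (w / 2 + 1) * lam ^+ 2 * N.
    by rewrite /b /lam; field; rewrite !gt_eqF.
  rewrite e1.
  have e2 : lam * b0 + lam * b0 <= b0 ^+ 2 + lam ^+ 2.
    by have := sqr_ge0 (lam - b0); lra.
  (* [N] counts all kernels while the weighted estimate involves [n] of them; the difference of 2
     leaves room for the additional lam^2. *)
  have e3 : w / 2 * lam ^+ 2 * n%:R + lam ^+ 2 <= (w / 2 + 1) * lam ^+ 2 * N.
    rewrite /N -[n.+2%:R]natr1 -[n.+1%:R]natr1.
    have l2 := sqr_ge0 lam; have n0 : 0 <= n%:R :> R by [].
    have := mulr_ge0 l2 n0; have := mulr_ge0 (ltW w0) l2; lra.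
  lra.
Qed.

End KernelBound.

Theorem theorem1p20 (R : realType) (G : topGroupType)
  (G_locally_compact : locally_compact [set: G])
  (G_hausdorff : hausdorff_space G)
  (G_compactly_generated : compactly_generated G)
  (mu : {measure set (borel G) -> \bar R}) (mu_haar : left_haar mu)
  (Delta : G -> R) (Delta_modular : modular_function mu Delta)
  (U : set G) (U_open : open U) (U_gen : generating_nbhd U)
  (D : splitting R G)
  (K : nat -> G -> R)
  (K_density : forall n, (0 < n)%N -> density mu (K n))
  (K_supp : forall n, (0 < n)%N -> compactly_supported (K n))
  (K_centered : forall n, (0 < n)%N -> centered mu D (K n))
  (eps : R) (eps_gt0 : 0 < eps) (W W' : set G)
  (W_gen : generating_nbhd W) (W'_gen : generating_nbhd W')
  (WW' : W `<=` W') (W_open : open W)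
  (K_bounds : forall n, (0 < n)%N -> forall g,
     eps * \1_W g <= K n g /\ K n g <= eps^-1 * \1_W' g) :
  exists omega c b : R, [/\ 0 < omega, 0 < c, 0 < b,
    (forall (m n : nat) (lambda : R) (psi : G -> R),
       (0 < n)%N -> classE mu U psi ->
       maps_Lp mu 2%:E 2%:E (twist lambda psi (convops mu K m n)) /\
       (opnorm mu 2%:E 2%:E (twist lambda psi (convops mu K m n))
          <= (expR (omega * lambda ^+ 2 * n%:R))%:E)%E) &
    (forall (m n : nat) (g : G), (0 < n)%N ->
       convn mu K m n g <=
         c * Delta g `^ (- 2^-1) * expR (- (b * rho U g ^+ 2 / n%:R)))].
Proof.
(* The closure of W' serves as [B]: compact, and containing the supports of all kernels. *)
have cB : compact (closure W') by rewrite -precompactE; have [] := W'_gen.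
have W'B : W' `<=` closure W' by exact: subset_closure.
have e0 : 0 <= eps^-1 by rewrite invr_ge0 ltW.
have upK n : (0 < n)%N -> forall g, K n g <= eps^-1 * indR (closure W') g.
  move=> n0 g; have [_ Kg] := K_bounds n n0 g; apply: le_trans Kg _.
  rewrite ler_wpM2l//; have [W'g|nW'g] := pselect (W' g).
    by rewrite indicE mem_set// (indR1 (W'B _ W'g)).
  by rewrite indicE memNset// indR_ge0.
have sK n : (0 < n)%N -> step_kernel mu D W (closure W') eps (K n).
  move=> n0; have [mK K0 K1] := K_density n n0.
  have supp x : ~ closure W' x -> K n x = 0.
    move=> nx; apply/eqP; rewrite eq_le K0 andbT.
    by have := upK _ n0 x; rewrite (indR0 nx) mulr0.
  split => //.
  - split; last by exists (closure W').
    split=> // C _; exists eps^-1 => x _; rewrite ger0_norm//.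
    apply: le_trans (upK _ n0 x) _; rewrite ler_piMr//.
    have [Bx|nBx] := pselect (closure W' x); first by rewrite (indR1 Bx).
    by rewrite (indR0 nBx).
  - by rewrite /Rintegral K1.
  - by move=> i; rewrite /Rintegral (K_centered n n0 i).
  - move=> x Wx; have [+ _] := K_bounds n n0 x.
    by rewrite indicE mem_set// mulr1.
have [w w0 step] := econv_L2_bound G_hausdorff mu_haar D U_open U_gen W_open W_gen
  cB (subset_trans WW' W'B) eps_gt0.
have stepn := econvn_L2_bound G_hausdorff mu_haar U_open U_gen sK step.
have [c [b [c0 b0 cb]]] := convn_gaussian_bound G_hausdorff mu_haar Delta_modular
  U_open U_gen cB sK e0 upK w0 stepn.
(* [w] bounds the square of the L^2 norm, whence the half. *)
exists (w / 2), c, b; split => //; first by rewrite divr_gt0.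
move=> m n lam psi _ psiE; apply: (twist_opnorm_bound G_hausdorff mu_haar U_open U_gen
  sK step).
exact: classE_coarse_lipschitz psiE.
Qed.
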